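(* Let $P$ be a rational function with complex coefficients of degree $n$ which has only simple critical values. Then the functional equation $P(f)=P(g)$ has non-constant solutions $f,g$ such that $f\not\equiv g$ and $f,g$ are meromorphic on $\mathbb C$ if and only if $n<4$.
   Context: A rational function $F$ is regarded as a holomorphic map $\mathbb{CP}^1\to\mathbb{CP}^1$ of degree $\deg F$. A point $s\in\mathbb{CP}^1$ is called a critical value of $F$ if the set $F^{-1}\{s\}$ contains fewer than $\deg F$ points, and $s$ is called a simple critical value if $F^{-1}\{s\}$ contains exactly $\deg F-1$ points.
   Formalization: The degree n = 1 is excluded: a rational function of degree 1 has no critical values, so it satisfies the hypothesis vacuously, but it is injective, so P(f)=P(g) forces f≡g and the claim fails although 1<4. *)

(* Defs.v *)
From mathcomp Require Import all_boot all_order all_algebra.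
From mathcomp Require Import all_classical all_reals all_analysis.
From mathcomp.real_closed Require Export complex.

Set Implicit Arguments.
Unset Strict Implicit.
Unset Printing Implicit Defensive.

Import Order.TTheory GRing.Theory Num.Theory.
Import numFieldNormedType.Exports.

Local Open Scope classical_set_scope.
Local Open Scope card_scope.
Local Open Scope complex_scope.
Local Open Scope ring_scope.

(* CP^1 as the field C together with the point at infinity, which is [None]. *)
Definition CP1 (R : realType) : Type := option R[i].

(* A rational function in lowest terms; the pair is unique up to a common
   nonzero scalar, on which nothing below depends. *)
Record ratfun (R : realType) := RatFun {
  ratnum : {poly R[i]};
  ratden : {poly R[i]};
  ratden_neq0 : ratden != 0;
  rat_coprime : coprimep ratnum ratden
}.

Definition ratdeg (R : realType) (F : ratfun R) : nat :=
  (maxn (size (ratnum F)) (size (ratden F))).-1.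

(* In homogeneous coordinates this is [x : y] |-> [p(x, y) : q(x, y)], where p
   and q are the degree [ratdeg F] homogenizations of the numerator and the
   denominator; their values at infinity = [1 : 0] are the coefficients of
   index [ratdeg F]. *)
Definition ratmap (R : realType) (F : ratfun R) (x : CP1 R) : CP1 R :=
  let a := if x is Some z then (ratnum F).[z] else (ratnum F)`_(ratdeg F) in
  let b := if x is Some z then (ratden F).[z] else (ratden F)`_(ratdeg F) in
  if b == 0 then None else Some (a / b).

Definition critical_value (R : realType) (F : ratfun R) (s : CP1 R) : Prop :=
  exists2 m : nat, (m < ratdeg F)%N & ratmap F @^-1` [set s] #= `I_m.

Definition simple_critical_value (R : realType) (F : ratfun R) (s : CP1 R) :
    Prop :=
  exists2 m : nat, m.+1 = ratdeg F & ratmap F @^-1` [set s] #= `I_m.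

(* [derivable h w 1] over the field R[i] is complex differentiability. *)
Definition holomorphic_at (R : realType) (h : R[i] -> R[i]) (z : R[i]) : Prop :=
  \forall w \near (z : R[i]^o), derivable (h : R[i]^o -> R[i]^o) w 1.

Definition regular_at (R : realType) (f : R[i] -> CP1 R) (z : R[i]) : Prop :=
  exists2 h : R[i] -> R[i], holomorphic_at h z &
    \forall w \near (z : R[i]^o), f w = Some (h w).

(* z is an isolated point of f^{-1}(infinity), and 1/f extends holomorphically
   to z with the value 0. *)
Definition pole_at (R : realType) (f : R[i] -> CP1 R) (z : R[i]) : Prop :=
  f z = None /\
  exists h : R[i] -> R[i],
    [/\ holomorphic_at h z, h z = 0 &
        \forall w \near (z : R[i]^o)^', h w != 0 /\ f w = Some (h w)^-1].

(* Meromorphic on the whole of C, with the value [None] exactly at the poles. *)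
Definition meromorphic (R : realType) (f : R[i] -> CP1 R) : Prop :=
  forall z : R[i], regular_at f z \/ pole_at f z.

Definition nonconstant (R : realType) (f : R[i] -> CP1 R) : Prop :=
  exists z w : R[i], f z <> f w.

(* Main.v *)
(*
Write meromorphic functions as f = [f1 : f2], g = [g1 : g2] with local holomorphic lifts, and let J
be the Jacobian form of P, of degree 2n - 2.

Degree at least 4.  If P(f) = P(g) and f <> g, then for every monomial m of bidegree (2n - 6, 2n - 6)
the expression
  m(f, g) (f1 g2 - f2 g1)^2 W(f) W(g) / (J(f) J(g)),     W(f) = f1' f2 - f1 f2',
does not depend on the lifts.  As the critical values are simple, two points of a fibre are separated
by a multiple of the derivative, |f1 g2 - f2 g1| <= K (|J(f)| + |J(g)|), and J(f) W(f) and J(g) W(g)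
are comparable; so the expression is locally bounded by W(f)^2 + W(g)^2 and extends to an entire
function.  Let S be the sum of the moduli over m.  The quotients of the entire functions for adjacent
monomials recover f and g, which bounds W(f) and W(g) by Cauchy's estimates for S; on a disc of radius
r where S <= 32 S(z) this yields S(z) r^2 <= K.  Choosing the disc by the usual rescaling argument,
S(z) rho^2 is bounded for all rho, so that S = 0, and f is constant.

Degree 3.  In suitable coordinates P is (x^3 + al x^2 + ga) / x, and the curve of pairs (x, y) in a
common fibre is the elliptic curve x y (x + y + al) = ga.  Multiplication by -2 on it acts on x and on
y by one Lattes map L.  Linearizing L at infinity gives a germ f with f(-2z) = L(f(z)), and the small
root y = g of the equation for x = f satisfies the same equation; both extend to the plane by
iterating L, and P(f) = P(g) persists by the identity theorem.
*)
Require Import Defs.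
From mathcomp Require Import all_boot all_order all_algebra.
From mathcomp Require Import all_classical all_reals all_analysis.
From mathcomp Require Import ring lra zify.

Set Implicit Arguments.
Unset Strict Implicit.
Unset Printing Implicit Defensive.

Import Order.TTheory GRing.Theory Num.Theory.
Import numFieldNormedType.Exports.

Local Open Scope classical_set_scope.
Local Open Scope card_scope.
Local Open Scope complex_scope.
Local Open Scope ring_scope.
Local Notation Re := complex.Re.
Local Notation Im := complex.Im.

(** The differentials have a geometric origin. Off the diagonal, the pairs with [P(x) = P(y)] form a
    curve [F = 0] of bidegree [(n - 1, n - 1)], whose canonical bidegree is [(n - 3, n - 3)]; twice
    this is [(2n - 6, 2n - 6)]. The residue form can be written [dx / F_y] or [- dy / F_x]. In the
    product of the two expressions the factors comparing the lifts of [P(x)] and [P(y)] cancel, and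
    up to constants it is [(x - y)^2 dx dy / (J(x) J(y))]. Evaluating this formula along [(f, g)]
    avoids all questions of smoothness, irreducibility and uniformization of the curve: simplicity
    of the critical values gives the separation estimate, which bounds the quotient near the zeros
    of [J]. For [n = 3] the bidegree is zero, the curve is elliptic and solutions exist; for
    [n >= 4] it is positive, so that a monomial has neighbours by which it can be divided. *)

Definition abs (R : realType) (z : R[i]) : R := Normc.normc z.

Arguments abs R z : simpl never.

(** * Complex differentiation *)

Section Modulus.
Variable R : realType.
Implicit Types (z w : R[i]) (x : R).

(** The norm of [R[i]] takes its values in [R[i]] itself; estimates are carried out with the real
    modulus [abs], where linear arithmetic applies. *)
Lemma abs_norm z : (abs z)%:C = `|z|.
Proof. by case: z. Qed.

Lemma abs_ge0 z : 0 <= abs z.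
Proof. by rewrite -lecR abs_norm normr_ge0. Qed.

Lemma absD z w : abs (z + w) <= abs z + abs w.
Proof. exact: le_normcD. Qed.

Lemma absN z : abs (- z) = abs z.
Proof. exact: normcN. Qed.

Lemma absB z w : abs (z - w) = abs (w - z).
Proof. by rewrite -absN opprB. Qed.

Lemma absM z w : abs (z * w) = abs z * abs w.
Proof. exact: Normc.normcM. Qed.

Lemma absV z : abs z^-1 = (abs z)^-1.
Proof. exact: Normc.normcV. Qed.

Lemma abs0 : abs (0 : R[i]) = 0.
Proof. exact: Normc.normc0. Qed.

Lemma abs1 : abs (1 : R[i]) = 1.
Proof. exact: Normc.normc1. Qed.

Lemma absX z n : abs (z ^+ n) = abs z ^+ n.
Proof. by elim: n => [|n IH]; rewrite ?expr0 ?abs1 // !exprS absM IH. Qed.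

Lemma abs_eq0 z : (abs z == 0) = (z == 0).
Proof.
apply/eqP/eqP => [|->]; last exact: abs0.
exact: Normc.eq0_normc.
Qed.

Lemma abs_gt0 z : (0 < abs z) = (z != 0).
Proof. by rewrite lt0r abs_eq0 abs_ge0 andbT. Qed.

Lemma absC x : abs x%:C = `|x|.
Proof. by rewrite /abs /= expr0n /= addr0 sqrtr_sqr. Qed.

Lemma absi : abs ('i : R[i]) = 1.
Proof. by rewrite /abs /= expr0n /= add0r expr1n sqrtr1. Qed.

Lemma absn (n : nat) : abs (n%:R : R[i]) = n%:R.
Proof.
have -> : (n%:R : R[i]) = (n%:R)%:C by rewrite -[RHS]/(real_complex R _) rmorph_nat.
by rewrite absC ger0_norm.
Qed.

Lemma abs_Re z : `|Re z| <= abs z.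
Proof.
case: z => a b; rewrite /abs /= -sqrtr_sqr ler_wsqrtr // lerDl; exact: sqr_ge0.
Qed.

Lemma abs_Im z : `|Im z| <= abs z.
Proof.
case: z => a b; rewrite /abs /= -sqrtr_sqr ler_wsqrtr // lerDr; exact: sqr_ge0.
Qed.

Lemma abs_le_ReIm z : abs z <= `|Re z| + `|Im z|.
Proof.
have {1}-> := complexE z; apply: le_trans (absD _ _) _.
by rewrite absM absi mul1r !absC.
Qed.

Lemma abs_subD z w u : abs (z - u) <= abs (z - w) + abs (w - u).
Proof. by rewrite -{1}(subrK w z) -addrA absD. Qed.

Lemma abs_leB z w : abs z - abs w <= abs (z - w).
Proof. by rewrite lerBlDr -{1}(subrK w z) absD. Qed.

Lemma abs_sum (I : Type) (r : seq I) (P : pred I) (F : I -> R[i]) :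
  abs (\sum_(i <- r | P i) F i) <= \sum_(i <- r | P i) abs (F i).
Proof.
elim/big_ind2: _ => [|a b c d h1 h2|//]; first by rewrite abs0.
by apply: le_trans (absD _ _) _; rewrite lerD.
Qed.

Lemma complexP z w : Re z = Re w -> Im z = Im w -> z = w.
Proof. by case: z => a b; case: w => c d /= -> ->. Qed.

End Modulus.

(** * Induction over rectangles by bisection *)

Section Bisection.
Variable R : realType.
Variable P : R -> R -> R -> R -> Prop.
Implicit Types x y : R.

Let half x y := (x + y) / 2.

(** If [P] failed on the whole rectangle it would fail on one of the four quarters, and so on; the
    nested rectangles shrink to a point, near which [P] holds by assumption. Goursat's theorem,
    compactness of discs and connectedness of the plane are all instances. *)
Lemma rect_ind x0 x1 y0 y1 : x0 <= x1 -> y0 <= y1 ->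
  (forall a b c d, x0 <= a -> a <= b -> b <= x1 -> y0 <= c -> c <= d -> d <= y1 ->
     P a (half a b) c (half c d) -> P (half a b) b c (half c d) ->
     P a (half a b) (half c d) d -> P (half a b) b (half c d) d -> P a b c d) ->
  (forall x y, x0 <= x <= x1 -> y0 <= y <= y1 ->
     exists2 e, 0 < e & forall a b c d, x0 <= a -> a <= x <= b -> b <= x1 ->
       y0 <= c -> c <= y <= d -> d <= y1 -> b - a < e -> d - c < e -> P a b c d) ->
  P x0 x1 y0 y1.
Proof.
move=> x01 y01 stepP locP; apply: contrapT => nP.
(* The first quarter on which [P] fails; the last quarter is taken without a test, since [P] cannot
   hold on all four. *)
pose next (r : R * R * R * R) : R * R * R * R := let: (a, b, c, d) := r in
  let m := half a b in let k := half c d in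
  if pselect (P a m c k) then if pselect (P m b c k) then
  if pselect (P a m k d) then (m, b, k, d) else (a, m, k, d)
  else (m, b, c, k) else (a, m, c, k).
pose s n := iter n next (x0, x1, y0, y1).
pose A n := (s n).1.1.1; pose B n := (s n).1.1.2.
pose C n := (s n).1.2; pose D n := (s n).2.
have E n : s n = (A n, B n, C n, D n) by rewrite /A /B /C /D; case: (s n) => [[[]]].
have AS n : [/\ A n <= A n.+1, B n.+1 <= B n, C n <= C n.+1 & D n.+1 <= D n] /\
    (A n <= B n -> C n <= D n -> A n.+1 <= B n.+1 /\ C n.+1 <= D n.+1) \/
    ~ (A n <= B n /\ C n <= D n).
  case: (pselect (A n <= B n /\ C n <= D n)) => [[ab cd]|]; last by right.
  left; rewrite /A /B /C /D /s iterS -/(s n) (E n) /= /half.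
  by case: pselect => _ /=; [case: pselect => _ /=; [case: pselect => _ /=|]|];
    split; try split; try move=> _ _; lra.
have inv n : [/\ x0 <= A n, A n <= B n, B n <= x1 &
    [/\ y0 <= C n, C n <= D n, D n <= y1 & ~ P (A n) (B n) (C n) (D n)]].
  elim: n => [|n [h1 h2 h3 [h4 h5 h6 nPn]]].
    by rewrite /A /B /C /D /=; split => //; split.
  case: (AS n) => [[[a1 a2 a3 a4] /(_ h2 h5) [a5 a6]]|]; last by case; split.
  split; [lra|lra|lra|split; [lra|lra|lra|]].
  have S := stepP _ _ _ _ h1 h2 h3 h4 h5 h6.
  rewrite /A /B /C /D /s iterS -/(s n) (E n) /=.
  case: pselect => p1 //=; case: pselect => p2 //=; case: pselect => p3 //= p4.
  by apply: nPn; apply: S.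
have mono n : [/\ A n <= A n.+1, B n.+1 <= B n, C n <= C n.+1 & D n.+1 <= D n].
  have [h1 h2 h3 [h4 h5 h6 nPn]] := inv n.
  by case: (AS n) => [[]//|]; case.
have width n : B n - A n = (x1 - x0) / 2 ^+ n /\ D n - C n = (y1 - y0) / 2 ^+ n.
  elim: n => [|n [IH1 IH2]]; first by rewrite /A /B /C /D /= expr0 !divr1.
  have -> : (x1 - x0) / 2 ^+ n.+1 = (B n - A n) / 2 by rewrite IH1 exprSr invfM mulrA.
  have -> : (y1 - y0) / 2 ^+ n.+1 = (D n - C n) / 2 by rewrite IH2 exprSr invfM mulrA.
  rewrite /A /B /C /D /s iterS -/(s n) (E n) /= /half.
  by case: pselect => _ /=; [case: pselect => _ /=; [case: pselect => _ /=|]|];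
    split; lra.
have lim (u v : nat -> R) : (forall n, u n <= u n.+1) -> (forall n, v n.+1 <= v n) ->
    (forall n, u n <= v n) -> exists x, forall n, u n <= x <= v n.
  move=> hu hv uv.
  have hu' := @homo_leq _ u (fun a b => a <= b) (@lexx _ _) (fun a b c h => le_trans h) hu.
  have hv' := @homo_leq _ v (fun a b => b <= a) (@lexx _ _) (fun a b c h k => le_trans k h) hv.
  have uv' m n : u m <= v n.
    case: (leqP m n) => mn; first exact: le_trans (hu' _ _ mn) (uv n).
    exact: le_trans (uv m) (hv' _ _ (ltnW mn)).
  exists (sup (range u)) => n; apply/andP; split.
    apply: ub_le_sup; last by exists n.
    by exists (v 0%N) => _ [m _ <-].
  by apply: ge_sup => [|_ [m _ <-]]; [exists (u 0%N), 0%N|].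
have [x xP] : exists x, forall n, A n <= x <= B n.
  by apply: lim => n; have [] := mono n; have [] := inv n.
have [y yP] : exists y, forall n, C n <= y <= D n.
  by apply: lim => n; have [] := mono n; have [_ _ _ []] := inv n.
have xin : x0 <= x <= x1 by have := xP 0%N.
have yin : y0 <= y <= y1 by have := yP 0%N.
have [e e0 He] := locP x y xin yin.
have [n nP'] : exists n : nat, (x1 - x0 + (y1 - y0)) / 2 ^+ n < e.
  exists (Num.bound ((x1 - x0 + (y1 - y0)) / e)).
  set t := _ / e; have t0 : 0 <= t by apply: divr_ge0; lra.
  rewrite ltr_pdivrMr ?exprn_gt0 // mulrC -ltr_pdivrMr // -/t.
  apply: lt_trans (archi_boundP t0) _.
  by rewrite -natrX ltr_nat ltn_expl.
have [h1 h2 h3 [h4 h5 h6 nPn]] := inv n; have [w1 w2] := width n.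
have p2 : 0 < 2 ^+ n :> R by rewrite exprn_gt0.
have wx : 0 <= (x1 - x0) / 2 ^+ n by apply: divr_ge0; lra.
have wy : 0 <= (y1 - y0) / 2 ^+ n by apply: divr_ge0; lra.
apply: nPn; apply: He => //; rewrite ?xP ?yP // ?w1 ?w2; move: nP'; rewrite mulrDl; lra.
Qed.

End Bisection.

(** * Neighbourhoods, continuity and derivatives in the complex plane *)

Section Calculus.
Variable R : realType.
Local Notation C := R[i].
Implicit Types (f g q : C -> C) (z w d : C).

(** The neighbourhood filter of [z] in terms of the real modulus; [nearcE] identifies it with the
    topological one. *)
Definition nearc z (P : C -> Prop) :=
  exists2 e : R, 0 < e & forall w, abs (w - z) < e -> P w.

Lemma nearcW z (P Q : C -> Prop) : (forall w, P w -> Q w) -> nearc z P -> nearc z Q.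
Proof. by move=> PQ [e e0 H]; exists e => // w /H /PQ. Qed.

Lemma nearc_and z (P Q : C -> Prop) :
  nearc z P -> nearc z Q -> nearc z (fun w => P w /\ Q w).
Proof.
move=> [e e0 He] [d d0 Hd]; exists (Num.min e d); first by rewrite lt_min e0.
by move=> w; rewrite lt_min => /andP[/He ? /Hd].
Qed.

Lemma nearc_id z (P : C -> Prop) : nearc z P -> P z.
Proof. by move=> [e e0]; apply; rewrite subrr abs0. Qed.

Lemma nearc_all z (P : C -> Prop) : (forall w, P w) -> nearc z P.
Proof. by move=> h; exists 1. Qed.

Lemma nearc_near z (P : C -> Prop) : nearc z P -> nearc z (fun w => nearc w P).
Proof.
move=> [e e0 He]; exists e => // w wz; exists (e - abs (w - z)); first by rewrite subr_gt0.
move=> u uw; apply: He; apply: le_lt_trans (abs_subD u w z) _.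
by rewrite -ltrBrDr.
Qed.

Lemma nearc_ball z w (e : R) : abs (w - z) < e -> nearc w (fun u => abs (u - z) < e).
Proof.
move=> h; have : nearc z (fun u => abs (u - z) < e).
  by exists e => //; apply: le_lt_trans h; exact: abs_ge0.
exists (e - abs (w - z)); first by rewrite subr_gt0.
by move=> u uw; apply: le_lt_trans (abs_subD u w z) _; rewrite -ltrBrDr.
Qed.

Lemma nearcE z (P : C -> Prop) : (\forall w \near (z : C^o), P w) <-> nearc z P.
Proof.
split => [/nbhs_ballP [e /= e0 H]|[e e0 H]].
  have eR : e = (Re e)%:C by apply/esym/RRe_real/gtr0_real.
  exists (Re e); first by move: e0; rewrite eR ltcR.
  move=> w wz; apply: H; rewrite -ball_normE /=.
  by rewrite distrC -abs_norm eR ltcR.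
apply/nbhs_ballP; exists e%:C; first by rewrite /= ltcR.
move=> w; rewrite -ball_normE /= distrC => h; apply: H.
by rewrite -ltcR abs_norm.
Qed.

Lemma dnearcE z (P : C -> Prop) :
  (\forall w \near (z : C^o)^', P w) <-> nearc z (fun w => w != z -> P w).
Proof. by rewrite -nearcE; split => h; exact: h. Qed.

Definition cont_at f z :=
  forall e : R, 0 < e -> nearc z (fun w => abs (f w - f z) < e).

Lemma cont_cst c z : cont_at (fun=> c) z.
Proof. by move=> e e0; apply: nearc_all => w; rewrite subrr abs0. Qed.

Lemma cont_id z : cont_at id z.
Proof. by move=> e e0; exists e. Qed.

Lemma cont_ext f g z : nearc z (fun w => f w = g w) -> cont_at f z -> cont_at g z.
Proof.
move=> fg cf e e0; have fz := nearc_id fg.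
by apply: nearcW (nearc_and fg (cf e e0)) => w [<-]; rewrite fz.
Qed.

Lemma contD f g z : cont_at f z -> cont_at g z -> cont_at (fun w => f w + g w) z.
Proof.
move=> cf cg e e0; have e2 : 0 < e / 2 by lra.
apply: nearcW (nearc_and (cf _ e2) (cg _ e2)) => w [h1 h2].
have -> : f w + g w - (f z + g z) = (f w - f z) + (g w - g z) by ring.
by apply: le_lt_trans (absD _ _) _; lra.
Qed.

Lemma cont_bounded f z : cont_at f z -> nearc z (fun w => abs (f w) <= abs (f z) + 1).
Proof.
move=> cf; apply: nearcW (cf 1 ltr01) => w h.
by have := abs_leB (f w) (f z); lra.
Qed.

Lemma contM f g z : cont_at f z -> cont_at g z -> cont_at (fun w => f w * g w) z.
Proof.
move=> cf cg e e0.
pose M := abs (f z) + abs (g z) + 1.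
have f0 := abs_ge0 (f z); have g0 := abs_ge0 (g z).
have M0 : 0 < M by rewrite /M; lra.
have e2 : 0 < e / 2 / M by rewrite !divr_gt0.
apply: nearcW (nearc_and (cont_bounded cf) (nearc_and (cf _ e2) (cg _ e2))) => w [b [h1 h2]].
have -> : f w * g w - f z * g z = f w * (g w - g z) + (f w - f z) * g z by ring.
apply: le_lt_trans (absD _ _) _; rewrite !absM.
have eM : e / 2 / M * M = e / 2 by rewrite divfK // gt_eqF.
have a1 : abs (f w) * abs (g w - g z) < e / 2.
  rewrite -eM mulrC; apply: le_lt_trans (_ : _ <= abs (g w - g z) * M) _.
    by apply: ler_wpM2l; [exact: abs_ge0|rewrite /M; lra].
  by rewrite ltr_pM2r.
have a2 : abs (f w - f z) * abs (g z) < e / 2.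
  rewrite -eM; apply: le_lt_trans (_ : _ <= abs (f w - f z) * M) _.
    by apply: ler_wpM2l; [exact: abs_ge0|rewrite /M; lra].
  by rewrite ltr_pM2r.
lra.
Qed.

Lemma contN f z : cont_at f z -> cont_at (fun w => - f w) z.
Proof.
move=> cf e e0; apply: nearcW (cf e e0) => w.
by rewrite -opprD absN.
Qed.

Lemma cont_neq0 f z : cont_at f z -> f z != 0 -> nearc z (fun w => abs (f z) / 2 < abs (f w)).
Proof.
move=> cf fz; have p : 0 < abs (f z) / 2 by rewrite divr_gt0 ?abs_gt0.
apply: nearcW (cf _ p) => w h.
by have := abs_leB (f z) (f w); rewrite absB; lra.
Qed.

Lemma nearc_neq0 f z : cont_at f z -> f z != 0 -> nearc z (fun w => f w != 0).
Proof.
move=> cf fz; apply: nearcW (cont_neq0 cf fz) => w h.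
by rewrite -abs_gt0; apply: le_lt_trans h; rewrite divr_ge0 ?abs_ge0.
Qed.

Lemma contV f z : f z != 0 -> cont_at f z -> cont_at (fun w => (f w)^-1) z.
Proof.
move=> fz cf e e0; have p : 0 < abs (f z) by rewrite abs_gt0.
have e2 : 0 < e * (abs (f z) * (abs (f z) / 2)) by rewrite !mulr_gt0 // invr_gt0.
apply: nearcW (nearc_and (cf _ e2) (nearc_and (cont_neq0 cf fz) (nearc_neq0 cf fz))) => w [h1 [h2 h3]].
have -> : (f w)^-1 - (f z)^-1 = (f z - f w) / (f w * f z) by field; rewrite fz h3.
rewrite absM absV absM absB ltr_pdivrMr; last by rewrite mulr_gt0 ?abs_gt0.
apply: lt_le_trans h1 _; rewrite ler_pM2l // mulrC ler_pM2r //; exact: ltW.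
Qed.

Lemma cont_comp f g z : cont_at f z -> cont_at g (f z) -> cont_at (fun w => g (f w)) z.
Proof.
move=> cf cg e e0; have [d d0 H] := cg _ e0.
by apply: nearcW (cf _ d0) => w /H.
Qed.

(** Caratheodory's form of the derivative: a slope function continuous at [z]. The sum, product,
    quotient and chain rules become identities between slopes; [cderivP] recovers the usual
    estimate. *)
Definition cderiv f z d :=
  exists q, [/\ cont_at q z, q z = d & forall w, f w = f z + q w * (w - z)].

Lemma cderiv_cont f z d : cderiv f z d -> cont_at f z.
Proof.
move=> [q [cq _ H]]; apply: (@cont_ext (fun w => f z + q w * (w - z))).
  by apply: nearc_all => w.
apply: contD; first exact: cont_cst.
by apply: contM => //; apply: contD; [exact: cont_id|exact: cont_cst].
Qed.

Lemma cderiv_cst c z : cderiv (fun=> c) z 0.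
Proof. by exists (fun=> 0); split=> [|//|w]; [exact: cont_cst|rewrite mul0r addr0]. Qed.

Lemma cderiv_id z : cderiv id z 1.
Proof. by exists (fun=> 1); split=> [|//|w]; [exact: cont_cst|rewrite mul1r addrC subrK]. Qed.

Lemma cderivD f g z d e : cderiv f z d -> cderiv g z e -> cderiv (fun w => f w + g w) z (d + e).
Proof.
move=> [q [cq qz fE]] [p [cp pz gE]]; exists (fun w => q w + p w).
by split=> [||w]; [exact: contD|rewrite qz pz|rewrite fE gE; ring].
Qed.

Lemma cderivN f z d : cderiv f z d -> cderiv (fun w => - f w) z (- d).
Proof.
move=> [q [cq qz fE]]; exists (fun w => - q w).
by split=> [||w]; [exact: contN|rewrite qz|rewrite fE; ring].
Qed.

Lemma cderivB f g z d e : cderiv f z d -> cderiv g z e -> cderiv (fun w => f w - g w) z (d - e).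
Proof. by move=> df dg; exact: cderivD df (cderivN dg). Qed.

Lemma cderivM f g z d e : cderiv f z d -> cderiv g z e ->
  cderiv (fun w => f w * g w) z (d * g z + f z * e).
Proof.
move=> [q [cq qz fE]] dg; have cg := cderiv_cont dg; case: dg => [p [cp pz gE]].
exists (fun w => q w * g w + f z * p w); split=> [||w]; last first.
- have -> : f z * g z + (q w * g w + f z * p w) * (w - z) =
    f z * (g z + p w * (w - z)) + q w * (w - z) * g w by ring.
  by rewrite -gE (fE w); ring.
- by rewrite qz pz.
by apply: contD; apply: contM => //; exact: cont_cst.
Qed.

Lemma cderivV f z d : f z != 0 -> cderiv f z d -> cderiv (fun w => (f w)^-1) z (- d / (f z ^+ 2)).
Proof.
move=> fz df; have cf := cderiv_cont df; case: df => [q [cq qz fE]].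
(* where [f w = 0] the slope of [1 / f] is the slope of the constant [- 1 / f z] *)
exists (fun w => if f w == 0 then - (f z)^-1 / (w - z) else - q w / (f w * f z)); split.
- apply: (@cont_ext (fun w => - q w * (f w * f z)^-1)); last first.
    apply: contM; first exact: contN.
    by apply: contV; [rewrite mulf_neq0|apply: contM => //; exact: cont_cst].
  by apply: nearcW (nearc_neq0 cf fz) => w /negbTE ->.
- by rewrite (negbTE fz) qz expr2.
move=> w; case: eqVneq => [fw|fw].
  have wz : w - z != 0.
    by rewrite subr_eq0; apply: contraNneq fz => <-; rewrite fw.
  by rewrite fw invr0 divfK // subrr.
have -> : - q w / (f w * f z) * (w - z) = (f z - (f z + q w * (w - z))) / (f w * f z) by ring.
by rewrite -(fE w); field; rewrite fz fw.
Qed.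

Lemma cderiv_comp f g z d e : cderiv f z d -> cderiv g (f z) e -> cderiv (fun w => g (f w)) z (e * d).
Proof.
move=> df; have cf := cderiv_cont df; case: df => [q [cq qz fE]] [p [cp pz gE]].
exists (fun w => p (f w) * q w); split=> [||w]; last first.
- by rewrite (gE (f w)) (fE w); ring.
- by rewrite pz qz.
by apply: contM => //; exact: cont_comp.
Qed.

Lemma cderiv_ext f g z d : nearc z (fun w => f w = g w) -> cderiv f z d -> cderiv g z d.
Proof.
move=> fg [q [cq qz fE]]; have fz := nearc_id fg.
exists (fun w => if w == z then d else (g w - g z) / (w - z)); split.
- apply: cont_ext cq; apply: nearcW fg => w fw; case: eqVneq => [->//|wz].
  by rewrite -fz -fw fE; field; rewrite subr_eq0.
- by rewrite eqxx.
move=> w; case: eqVneq => [->|wz]; first by rewrite subrr mulr0 addr0.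
by rewrite divfK ?subr_eq0 // addrC subrK.
Qed.

Lemma cderivP f z d : cderiv f z d <->
  (forall e : R, 0 < e ->
     nearc z (fun w => abs (f w - f z - d * (w - z)) <= e * abs (w - z))).
Proof.
split=> [[q [cq qz fE]] e e0|H].
  apply: nearcW (cq e e0) => w h.
  have -> : f w - f z - d * (w - z) = (q w - q z) * (w - z) by rewrite fE qz; ring.
  by rewrite absM ler_wpM2r ?abs_ge0 // ltW.
exists (fun w => if w == z then d else (f w - f z) / (w - z)); split.
- move=> e e0; have e2 : 0 < e / 2 by lra.
  apply: nearcW (H _ e2) => w h; rewrite eqxx; case: eqVneq => [_|wz].
    by rewrite subrr abs0.
  have wz' : w - z != 0 by rewrite subr_eq0.
  have -> : (f w - f z) / (w - z) - d = (f w - f z - d * (w - z)) / (w - z) by field.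
  rewrite absM absV ltr_pdivrMr ?abs_gt0 //; apply: le_lt_trans h _.
  by rewrite ltr_pM2r ?abs_gt0 //; lra.
- by rewrite eqxx.
move=> w; case: eqVneq => [->|wz]; first by rewrite subrr mulr0 addr0.
by rewrite divfK ?subr_eq0 // addrC subrK.
Qed.

Lemma cderiv_uniq f z d e : cderiv f z d -> cderiv f z e -> d = e.
Proof.
move=> /cderivP fd /cderivP fe; apply/eqP; rewrite -subr_eq0 -abs_eq0 eq_le abs_ge0 andbT.
apply/ler_addgt0Pl => r r0; rewrite addr0; have r2 : 0 < r / 2 by lra.
have [s s0 H] := nearc_and (fd _ r2) (fe _ r2).
have ss : abs (z + (s / 2)%:C - z) = s / 2.
  by rewrite addrC addKr absC ger0_norm //; lra.
have [|h1 h2] := H (z + (s / 2)%:C); first by rewrite ss; lra.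
move: h1 h2; rewrite ss; set u := f _ - f z => h1 h2.
suff : abs (d - e) * (s / 2) <= r * (s / 2) by rewrite ler_pM2r //; lra.
rewrite -{1}ss -absM.
have -> : (d - e) * (z + (s / 2)%:C - z) = (u - e * (z + (s / 2)%:C - z)) - (u - d * (z + (s / 2)%:C - z)) by ring.
by apply: le_trans (absD _ _) _; rewrite absN; lra.
Qed.

Definition diffc f z := exists d, cderiv f z d.

(** The value is 0 where no derivative exists. *)
Definition Dc f z : C := xget 0 [set d | cderiv f z d].

Lemma DcP f z : diffc f z -> cderiv f z (Dc f z).
Proof. by move=> df; exact: (@xgetPex _ 0 [set d | cderiv f z d]). Qed.

Lemma DcE f z d : cderiv f z d -> Dc f z = d.
Proof. by move=> df; exact: (cderiv_uniq (DcP (ex_intro _ d df)) df). Qed.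

Lemma diffc_cont f z : diffc f z -> cont_at f z.
Proof. by move=> [d /cderiv_cont]. Qed.

Lemma diffc_cst c z : diffc (fun=> c) z. Proof. by exists 0; exact: cderiv_cst. Qed.
Lemma diffc_id z : diffc id z. Proof. by exists 1; exact: cderiv_id. Qed.
Lemma diffcD f g z : diffc f z -> diffc g z -> diffc (fun w => f w + g w) z.
Proof. by move=> [d df] [e dg]; exists (d + e); exact: cderivD. Qed.
Lemma diffcN f z : diffc f z -> diffc (fun w => - f w) z.
Proof. by move=> [d df]; exists (- d); exact: cderivN. Qed.
Lemma diffcB f g z : diffc f z -> diffc g z -> diffc (fun w => f w - g w) z.
Proof. by move=> [d df] [e dg]; exists (d - e); exact: cderivB. Qed.
Lemma diffcM f g z : diffc f z -> diffc g z -> diffc (fun w => f w * g w) z.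
Proof. by move=> [d df] [e dg]; exists (d * g z + f z * e); exact: cderivM. Qed.
Lemma diffcV f z : f z != 0 -> diffc f z -> diffc (fun w => (f w)^-1) z.
Proof. by move=> fz [d df]; exists (- d / f z ^+ 2); exact: cderivV. Qed.
Lemma diffc_comp f g z : diffc f z -> diffc g (f z) -> diffc (fun w => g (f w)) z.
Proof. by move=> [d df] [e dg]; exists (e * d); exact: cderiv_comp df dg. Qed.
Lemma diffc_ext f g z : nearc z (fun w => f w = g w) -> diffc f z -> diffc g z.
Proof. by move=> fg [d df]; exists d; exact: cderiv_ext df. Qed.
Lemma diffcX f n z : diffc f z -> diffc (fun w => f w ^+ n) z.
Proof.
move=> df; elim: n => [|n IH]; first exact: diffc_cst.
apply: (@diffc_ext (fun w => f w * f w ^+ n)); last exact: diffcM.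
by apply: nearc_all => w; rewrite exprS.
Qed.
Lemma diffc_sum (I : Type) (r : seq I) (P : pred I) (F : I -> C -> C) z :
  (forall i, P i -> diffc (F i) z) -> diffc (fun w => \sum_(i <- r | P i) F i w) z.
Proof.
move=> H; elim: r => [|i r IH].
  by apply: diffc_ext (diffc_cst 0 z); apply: nearc_all => w; rewrite big_nil.
case Pi: (P i).
  apply: diffc_ext (diffcD (H i Pi) IH); apply: nearc_all => w.
  by rewrite big_cons Pi.
by apply: diffc_ext IH; apply: nearc_all => w; rewrite big_cons Pi.
Qed.

Lemma derivableE f z : derivable (f : C^o -> C^o) z 1 <-> diffc f z.
Proof.
rewrite /derivable; split.
  move=> /cvg_ex [/= l /cvgrPdist_le H]; exists l; apply/cderivP => e e0.
  have {}H := H e%:C; rewrite ltcR in H; have {H} := H e0.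
  move=> /dnearcE [d d0 H]; exists d => // w wz.
  have [->|nwz] := eqVneq w z; first by rewrite !subrr mulr0 subr0 abs0 mulr0.
  have wz0 : w - z != 0 by rewrite subr_eq0.
  have := H (w - z); rewrite subr0 => /(_ wz wz0); rewrite /= -abs_norm lecR.
  have -> : l - (w - z)^-1 *: (f ((w - z) *: 1 + z) - f z) =
     - ((f w - f z - l * (w - z)) / (w - z)).
    by rewrite /GRing.scale /= mulr1 subrK; field.
  by rewrite absN absM absV ler_pdivrMr ?abs_gt0.
move=> [l /cderivP H]; apply/cvg_ex; exists l; apply/cvgrPdist_le => /= e e0.
have eR : e = (Re e)%:C by apply/esym/RRe_real/gtr0_real.
have e0' : 0 < Re e by move: e0; rewrite eR ltcR.
apply/dnearcE; have [d d0 {}H] := H _ e0'; exists d => // w; rewrite subr0 => wd w0.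
have := H (z + w); rewrite addrAC subrr add0r => /(_ wd).
rewrite -abs_norm {2}eR lecR.
have -> : l - w^-1 *: (f (w *: 1 + z) - f z) =
     - ((f (z + w) - f z - l * w) / w).
  by rewrite /GRing.scale /= mulr1 [w + z]addrC; field.
by rewrite absN absM absV ler_pdivrMr ?abs_gt0.
Qed.

End Calculus.

(** * Cauchy's theorem and its consequences *)

Section ComplexIntegral.
Variable R : realType.
Local Notation C := R[i].
Local Notation mu := (@lebesgue_measure R).
Implicit Types (u v : R -> C) (a b c t : R) (z w k : C).

Lemma cReD z w : Re (z + w) = Re z + Re w. Proof. by case: z; case: w. Qed.
Lemma cImD z w : Im (z + w) = Im z + Im w. Proof. by case: z; case: w. Qed.
Lemma cReN z : Re (- z) = - Re z. Proof. by case: z. Qed.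
Lemma cImN z : Im (- z) = - Im z. Proof. by case: z. Qed.
Lemma cReM z w : Re (z * w) = Re z * Re w - Im z * Im w. Proof. by case: z; case: w. Qed.
Lemma cImM z w : Im (z * w) = Re z * Im w + Im z * Re w. Proof. by case: z; case: w. Qed.

(** The points [s] are not confined to [[a, b]], so continuity is two-sided even at the end points.
    The integrands are restrictions of functions on the plane and satisfy this. *)
Definition cts u a b := forall t, a <= t <= b -> forall e : R, 0 < e ->
  exists2 d : R, 0 < d & forall s, `|s - t| < d -> abs (u s - u t) < e.

Definition cint u a b : C :=
  (\int[mu]_(t in `[a, b]) Re (u t)) +i* (\int[mu]_(t in `[a, b]) Im (u t)).

Lemma integrable_proj (p : C -> R) u a b : (forall z w, `|p z - p w| <= abs (z - w)) ->
  cts u a b -> mu.-integrable `[a, b] (EFin \o (p \o u)).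
Proof.
move=> pL cu; apply: continuous_compact_integrable; first exact: segment_compact.
apply: continuous_in_subspaceT => t; rewrite inE /= in_itv /= => tab.
apply/cvgrPdist_lt => e e0; have [d d0 H] := cu _ tab _ e0.
near=> s; rewrite /= distrC; apply: le_lt_trans (pL _ _) _; apply: H.
by near: s; apply/nbhs_normP; exists d => // s /=; rewrite distrC.
Unshelve. all: by end_near.
Qed.

Lemma Re_lip z w : `|Re z - Re w| <= abs (z - w).
Proof. by rewrite -cReN -cReD abs_Re. Qed.

Lemma Im_lip z w : `|Im z - Im w| <= abs (z - w).
Proof. by rewrite -cImN -cImD abs_Im. Qed.

Lemma integrable_Re u a b : cts u a b -> mu.-integrable `[a, b] (EFin \o (fun t => Re (u t))).
Proof. exact: integrable_proj Re_lip. Qed.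

Lemma integrable_Im u a b : cts u a b -> mu.-integrable `[a, b] (EFin \o (fun t => Im (u t))).
Proof. exact: integrable_proj Im_lip. Qed.

Lemma eq_cint u v a b : (forall t, a <= t <= b -> u t = v t) -> cint u a b = cint v a b.
Proof.
move=> uv; apply: complexP => /=; apply: eq_Rintegral => t;
  by rewrite inE /= in_itv /= => /uv ->.
Qed.

Lemma Rint_cat (f : R -> R) a b c : a <= b -> b <= c ->
  mu.-integrable `[a, c] (EFin \o f) ->
  \int[mu]_(t in `[a, c]) f t = \int[mu]_(t in `[a, b]) f t + \int[mu]_(t in `[b, c]) f t.
Proof.
move=> ab bc fi.
have fbc : mu.-integrable `]b, c] (EFin \o f).
  apply: integrableS fi => //; apply: subset_itvr; rewrite bnd_simp //.
rewrite -(Rintegral_itv_obnd_cbnd (r := b)) //.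
by rewrite -(@Rintegral_itvB _ f (BLeft a) (BRight c) b) ?bnd_simp // addrC subrK.
Qed.

Lemma cint_cat u a b c : a <= b -> b <= c -> cts u a c ->
  cint u a c = cint u a b + cint u b c.
Proof.
move=> ab bc cu; apply: complexP => /=; apply: Rint_cat => //.
  exact: integrable_Re.
exact: integrable_Im.
Qed.

Lemma cintD u v a b : cts u a b -> cts v a b ->
  cint (fun t => u t + v t) a b = cint u a b + cint v a b.
Proof.
move=> cu cv; apply: complexP => /=.
  rewrite -RintegralD //; try exact: integrable_Re.
  by apply: eq_Rintegral => t _; rewrite cReD.
rewrite -RintegralD //; try exact: integrable_Im.
by apply: eq_Rintegral => t _; rewrite cImD.
Qed.

Lemma ctsZ k u a b : cts u a b -> cts (fun t => k * u t) a b.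
Proof.
move=> cu t tab e e0; have k0 := abs_ge0 k.
have [d d0 H] := cu t tab (e / (abs k + 1)) (divr_gt0 e0 (ltr_wpDl k0 ltr01)).
exists d => // s /H; rewrite ltr_pdivlMr ?ltr_wpDl // -mulrBr absM => h.
by have := abs_ge0 (u s - u t); lra.
Qed.

Lemma ctsD u v a b : cts u a b -> cts v a b -> cts (fun t => u t + v t) a b.
Proof.
move=> cu cv t tab e e0; have e2 : 0 < e / 2 by lra.
have [d d0 H] := cu t tab _ e2; have [d' d0' H'] := cv t tab _ e2.
exists (Num.min d d'); first by rewrite lt_min d0.
move=> s; rewrite lt_min => /andP[/H h1 /H' h2].
have -> : u s + v s - (u t + v t) = (u s - u t) + (v s - v t) by ring.
by apply: le_lt_trans (absD _ _) _; lra.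
Qed.

Lemma cts_cst k a b : cts (fun=> k) a b.
Proof. by move=> t _ e e0; exists 1 => // s _; rewrite subrr abs0. Qed.

Lemma ctsB u v a b : cts u a b -> cts v a b -> cts (fun t => u t - v t) a b.
Proof.
move=> cu /(ctsZ (-1)) /(ctsD cu) h t tab e e0.
have [d d0 H] := h t tab e e0; exists d => // s /H.
by rewrite !mulN1r.
Qed.

Lemma cintZ k u a b : cts u a b -> cint (fun t => k * u t) a b = k * cint u a b.
Proof.
move=> cu; have iR := integrable_Re cu; have iI := integrable_Im cu.
have iRZ r : mu.-integrable `[a, b] (EFin \o (fun t => r * Re (u t))).
  rewrite (_ : _ \o _ = (fun t => r%:E * (EFin \o (fun t => Re (u t))) t)%E); last by apply/funext => t /=; rewrite EFinM.
  exact: integrableZl.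
have iIZ r : mu.-integrable `[a, b] (EFin \o (fun t => r * Im (u t))).
  rewrite (_ : _ \o _ = (fun t => r%:E * (EFin \o (fun t => Im (u t))) t)%E); last by apply/funext => t /=; rewrite EFinM.
  exact: integrableZl.
apply: complexP.
  rewrite cReM /= -!RintegralZl // -RintegralB //.
  by apply: eq_Rintegral => t _; rewrite cReM.
rewrite cImM /= -!RintegralZl // -RintegralD //.
by apply: eq_Rintegral => t _; rewrite cImM.
Qed.

Lemma cintB u v a b : cts u a b -> cts v a b ->
  cint (fun t => u t - v t) a b = cint u a b - cint v a b.
Proof.
move=> cu cv; rewrite -[- cint v a b]mulN1r -cintZ // -cintD //; last exact: ctsZ.
by apply: eq_cint => t _; rewrite mulN1r.
Qed.

Lemma mu_itv a b : a <= b -> fine (mu `[a, b]) = b - a.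
Proof.
move=> ab; rewrite lebesgue_measure_itv /= lte_fin.
by case: ltgtP ab => //= ->; rewrite subrr.
Qed.

Lemma cint_cst k a b : a <= b -> cint (fun=> k) a b = k * (b - a)%:C.
Proof.
move=> ab; apply: complexP; rewrite ?cReM ?cImM /= Rintegral_cst // mu_itv //.
  by rewrite mulr0 subr0.
by rewrite mulr0 add0r.
Qed.

Lemma Rint_ge (f : R -> R) m a b : a <= b -> mu.-integrable `[a, b] (EFin \o f) ->
  (forall t, a <= t <= b -> m <= f t) -> m * (b - a) <= \int[mu]_(t in `[a, b]) f t.
Proof.
move=> ab fi H; rewrite -(mu_itv ab) -Rintegral_cst //.
apply: (le_Rintegral _ (integrable_Re (@cts_cst m%:C a b)) fi) => //.
Qed.

Lemma Rint_abs_le (f : R -> R) (m a b : R) : a <= b -> mu.-integrable `[a, b] (EFin \o f) ->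
  (forall t, a <= t <= b -> `|f t| <= m) -> `|\int[mu]_(t in `[a, b]) f t| <= m * (b - a).
Proof.
move=> ab fi H; apply: le_trans (le_normr_Rintegral _ fi) _ => //.
rewrite -(mu_itv ab) -Rintegral_cst //; have ci := integrable_Re (@cts_cst m%:C a b); have ni := integrable_norm fi.
exact: le_Rintegral.
Qed.

(* The factor 2 comes from bounding the real and imaginary parts separately. *)
Lemma cint_le u M a b : a <= b -> cts u a b -> (forall t, a <= t <= b -> abs (u t) <= M) ->
  abs (cint u a b) <= 2 * M * (b - a).
Proof.
move=> ab cu H; apply: le_trans (abs_le_ReIm _) _ => /=.
have h1 : `|\int[mu]_(t in `[a, b]) Re (u t)| <= M * (b - a).
  apply: Rint_abs_le => //; first exact: integrable_Re.
  by move=> t /H; apply: le_trans; exact: abs_Re.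
have h2 : `|\int[mu]_(t in `[a, b]) Im (u t)| <= M * (b - a).
  apply: Rint_abs_le => //; first exact: integrable_Im.
  by move=> t /H; apply: le_trans; exact: abs_Im.
lra.
Qed.

End ComplexIntegral.

(** * Goursat's theorem for rectangles *)

Section Goursat.
Variable R : realType.
Local Notation C := R[i].
Implicit Types (g h : C -> C) (x y a b c d : R) (z w k : C).

Lemma abs_pt x y x' y' : abs ((x +i* y) - (x' +i* y')) <= `|x - x'| + `|y - y'|.
Proof. exact: abs_le_ReIm. Qed.

Definition lineH g y x : C := g (x +i* y).
Definition lineV g x y : C := g (x +i* y).

Lemma cts_lineH g y a b : (forall x, a <= x <= b -> cont_at g (x +i* y)) -> cts (lineH g y) a b.
Proof.
move=> H t tab e e0; have [d d0 He] := H t tab e e0; exists d => // s sd; apply: He.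
by apply: le_lt_trans (abs_pt _ _ _ _) _; rewrite subrr normr0 addr0.
Qed.

Lemma cts_lineV g x a b : (forall y, a <= y <= b -> cont_at g (x +i* y)) -> cts (lineV g x) a b.
Proof.
move=> H t tab e e0; have [d d0 He] := H t tab e e0; exists d => // s sd; apply: He.
by apply: le_lt_trans (abs_pt _ _ _ _) _; rewrite subrr normr0 add0r.
Qed.

(** The integral of [g(z) dz] counterclockwise around the rectangle [[a, b] x [c, d]], with opposite
    sides paired into one integral. *)
Definition RI g a b c d : C :=
  cint (fun x => lineH g c x - lineH g d x) a b +
  'i * cint (fun y => lineV g b y - lineV g a y) c d.

Definition bdcont g a b c d :=
  [/\ forall x, a <= x <= b -> cont_at g (x +i* c),
      forall x, a <= x <= b -> cont_at g (x +i* d),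
      forall y, c <= y <= d -> cont_at g (a +i* y) &
      forall y, c <= y <= d -> cont_at g (b +i* y)].

Lemma RI_splitV g a m b c d : a <= m -> m <= b -> c <= d -> bdcont g a b c d ->
  (forall y, c <= y <= d -> cont_at g (m +i* y)) ->
  RI g a b c d = RI g a m c d + RI g m b c d.
Proof.
move=> am mb cd [h1 h2 h3 h4] h5; rewrite /RI.
have H1 := cts_lineH h1; have H2 := cts_lineH h2.
have V1 := cts_lineV h3; have V2 := cts_lineV h4; have V3 := cts_lineV h5.
rewrite (cint_cat am mb); last exact: ctsB.
by rewrite !(cintB V1, cintB V2, cintB V3) //; ring.
Qed.

Lemma RI_splitH g a b c m d : c <= m -> m <= d -> a <= b -> bdcont g a b c d ->
  (forall x, a <= x <= b -> cont_at g (x +i* m)) ->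
  RI g a b c d = RI g a b c m + RI g a b m d.
Proof.
move=> am mb cd [h1 h2 h3 h4] h5; rewrite /RI.
have H1 := cts_lineH h1; have H2 := cts_lineH h2; have H3 := cts_lineH h5.
have V1 := cts_lineV h3; have V2 := cts_lineV h4.
rewrite (@cint_cat _ (fun y => lineV g b y - lineV g a y) _ _ _ am mb); last exact: ctsB.
by rewrite !(cintB H1, cintB H2, cintB H3) //; ring.
Qed.

Lemma RI_le g a b c d (M : R) : a <= b -> c <= d -> bdcont g a b c d ->
  (forall x, a <= x <= b -> abs (g (x +i* c)) <= M /\ abs (g (x +i* d)) <= M) ->
  (forall y, c <= y <= d -> abs (g (a +i* y)) <= M /\ abs (g (b +i* y)) <= M) ->
  abs (RI g a b c d) <= 4 * M * (b - a + (d - c)).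
Proof.
move=> ab cd [h1 h2 h3 h4] bH bV.
have H1 := cts_lineH h1; have H2 := cts_lineH h2.
have V1 := cts_lineV h3; have V2 := cts_lineV h4.
apply: le_trans (absD _ _) _; rewrite absM absi mul1r.
have e1 : abs (cint (fun x => lineH g c x - lineH g d x) a b) <= 2 * (2 * M) * (b - a).
  apply: cint_le => //; first exact: ctsB.
  move=> t /bH [k1 k2]; apply: le_trans (absD _ _) _; rewrite absN /lineH; lra.
have e2 : abs (cint (fun y => lineV g b y - lineV g a y) c d) <= 2 * (2 * M) * (d - c).
  apply: cint_le => //; first exact: ctsB.
  move=> t /bV [k1 k2]; apply: le_trans (absD _ _) _; rewrite absN /lineV; lra.
lra.
Qed.

Lemma RI_lin g h k l a b c d : bdcont g a b c d -> bdcont h a b c d ->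
  RI (fun z => k * g z + l * h z) a b c d = k * RI g a b c d + l * RI h a b c d.
Proof.
move=> [g1 g2 g3 g4] [h1 h2 h3 h4]; rewrite /RI.
have A1 := cts_lineH g1; have A2 := cts_lineH g2; have A3 := cts_lineV g3; have A4 := cts_lineV g4.
have B1 := cts_lineH h1; have B2 := cts_lineH h2; have B3 := cts_lineV h3; have B4 := cts_lineV h4.
have -> : cint (fun x => lineH (fun z => k * g z + l * h z) c x - lineH (fun z => k * g z + l * h z) d x) a b =
    k * cint (fun x => lineH g c x - lineH g d x) a b + l * cint (fun x => lineH h c x - lineH h d x) a b.
  rewrite -!cintZ -?cintD; try by do ?[exact: ctsB|apply: ctsZ].
  by apply: eq_cint => t _; rewrite /lineH; ring.
have -> : cint (fun x => lineV (fun z => k * g z + l * h z) b x - lineV (fun z => k * g z + l * h z) a x) c d =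
    k * cint (fun x => lineV g b x - lineV g a x) c d + l * cint (fun x => lineV h b x - lineV h a x) c d.
  rewrite -!cintZ -?cintD; try by do ?[exact: ctsB|apply: ctsZ].
  by apply: eq_cint => t _; rewrite /lineV; ring.
ring.
Qed.

Definition onbd a b c d (z : C) := exists x y, [/\ z = x +i* y, a <= x <= b, c <= y <= d &
  [\/ x = a, x = b, y = c | y = d]].

Lemma bdcontP g a b c d : a <= b -> c <= d ->
  (forall z, onbd a b c d z -> cont_at g z) <-> bdcont g a b c d.
Proof.
move=> ab cd; split=> [H|[h1 h2 h3 h4] z [x [y [-> xab ycd]]]].
  have aa : a <= a <= b by rewrite lexx. have bb : a <= b <= b by rewrite lexx ab.
  have cc : c <= c <= d by rewrite lexx. have dd : c <= d <= d by rewrite lexx cd.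
  split=> t tt; apply: H.
  - by exists t, c; split=> //; apply: Or43.
  - by exists t, d; split=> //; apply: Or44.
  - by exists a, t; split=> //; apply: Or41.
  - by exists b, t; split=> //; apply: Or42.
case=> E; first by rewrite E; exact: h3.
- by rewrite E; exact: h4.
- by rewrite E; exact: h1.
- by rewrite E; exact: h2.
Qed.

Lemma eq_RI g h a b c d : a <= b -> c <= d -> (forall z, onbd a b c d z -> g z = h z) ->
  RI g a b c d = RI h a b c d.
Proof.
move=> ab cd H; rewrite /RI.
have aa : a <= a <= b by rewrite lexx. have bb : a <= b <= b by rewrite lexx ab.
have cc : c <= c <= d by rewrite lexx. have dd : c <= d <= d by rewrite lexx cd.
congr (_ + _ * _); apply: eq_cint => t tt; rewrite /lineH /lineV; congr (_ - _); apply: H.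
- by exists t, c; split=> //; apply: Or43.
- by exists t, d; split=> //; apply: Or44.
- by exists b, t; split=> //; apply: Or42.
- by exists a, t; split=> //; apply: Or41.
Qed.

Lemma RI_affine a b c d (p q : C) : a <= b -> c <= d -> RI (fun z => p + q * z) a b c d = 0.
Proof.
move=> ab cd; rewrite /RI.
rewrite (_ : cint _ a b = cint (fun=> q * (0 +i* (c - d))) a b); last first.
  apply: eq_cint => t _; rewrite /lineH.
  have -> : (0 +i* (c - d)) = (t +i* c) - (t +i* d) :> C by simpc.
  by ring.
rewrite (_ : cint _ c d = cint (fun=> q * ((b - a) +i* 0)) c d); last first.
  apply: eq_cint => t _; rewrite /lineV.
  have -> : ((b - a) +i* 0) = (b +i* t) - (a +i* t) :> C by simpc.
  by ring.
rewrite !cint_cst //.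
transitivity (q * ((0 +i* (c - d)) * (b - a)%:C + 'i * (((b - a) +i* 0) * (d - c)%:C))); first by ring.
suff -> : (0 +i* (c - d)) * (b - a)%:C + 'i * (((b - a) +i* 0) * (d - c)%:C) = 0 :> C by rewrite mulr0.
by apply: complexP; rewrite ?(cReD, cReM, cImD, cImM) /=; ring.
Qed.

Lemma bdcontS g a b c d a' b' c' d' : a <= a' -> b' <= b -> c <= c' -> d' <= d ->
  a' <= b' -> c' <= d' ->
  (forall x y, a <= x <= b -> c <= y <= d -> cont_at g (x +i* y)) -> bdcont g a' b' c' d'.
Proof.
move=> h1 h2 h3 h4 h5 h6 cg; split=> t /andP[t1 t2]; apply: cg; apply/andP; split => //.
all: by rewrite ?(le_trans h1) ?(le_trans h3) // ?(le_trans _ h2) ?(le_trans _ h4) // ?(le_trans h5) ?(le_trans h6).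
Qed.

Lemma RI_split4 g (a m b c k d : R) : a <= m -> m <= b -> c <= k -> k <= d ->
  (forall x y, a <= x <= b -> c <= y <= d -> cont_at g (x +i* y)) ->
  RI g a b c d = RI g a m c k + RI g a m k d + (RI g m b c k + RI g m b k d).
Proof.
move=> am mb ck kd cg; have ab := le_trans am mb; have cd := le_trans ck kd.
rewrite (RI_splitV am mb cd); last 2 first.
- exact: bdcontS cg.
- by move=> y hy; apply: cg => //; rewrite am.
congr (_ + _).
  apply: RI_splitH => //; first exact: bdcontS cg.
  by move=> x /andP[h1 h2]; apply: cg; rewrite ?ck // h1 (le_trans h2).
apply: RI_splitH => //; first exact: bdcontS cg.
by move=> x /andP[h1 h2]; apply: cg; rewrite ?ck // h2 andbT (le_trans am).
Qed.

Lemma half_facts a b : a <= b -> [/\ a <= (a + b) / 2, (a + b) / 2 <= b,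
  (a + b) / 2 - a = (b - a) / 2 & b - (a + b) / 2 = (b - a) / 2].
Proof. by move=> ab; split; lra. Qed.

(** The bound [r (b - a + (d - c))^2] is inherited from the quarters, because four squares of half
    the size add up to the whole. Near a point, subtracting the affine part of [g], which integrates
    to zero, leaves an integrand small compared with the size of the rectangle. *)
Lemma goursat g a b c d : a <= b -> c <= d ->
  (forall x y, a <= x <= b -> c <= y <= d -> diffc g (x +i* y)) -> RI g a b c d = 0.
Proof.
move=> ab cd dg; apply/eqP; rewrite -abs_eq0 eq_le abs_ge0 andbT.
apply/ler_addgt0Pl => e e0; rewrite addr0.
(* The summand 1 keeps [L] positive for degenerate rectangles. *)
pose L := b - a + (d - c) + 1; have L0 : 0 < L by rewrite /L; lra.
have L2 : 0 < L ^+ 2 by rewrite exprn_gt0.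
pose r := e / L ^+ 2; have r0 : 0 < r by rewrite divr_gt0.
suff H : abs (RI g a b c d) <= r * (b - a + (d - c)) ^+ 2.
  apply: le_trans H _; rewrite /r mulrAC ler_pdivrMr // ler_pM2l //.
  by rewrite ler_pXn2r ?nnegrE /L //; lra.
pose P a b c d := abs (RI g a b c d) <= r * (b - a + (d - c)) ^+ 2.
have cg x y : a <= x <= b -> c <= y <= d -> cont_at g (x +i* y).
  by move=> hx hy; exact/diffc_cont/dg.
apply: (rect_ind (P := P)) => // [a' b' c' d' h1 h2 h3 h4 h5 h6|x y xab ycd].
  rewrite /P; have [m1 m2 e1 e2] := half_facts h2; have [k1 k2 e3 e4] := half_facts h5.
  have cg' x y : a' <= x <= b' -> c' <= y <= d' -> cont_at g (x +i* y).
    move=> /andP[x1 x2] /andP[y1 y2]; apply: cg.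
      by rewrite (le_trans h1 x1) (le_trans x2 h3).
    by rewrite (le_trans h4 y1) (le_trans y2 h6).
  rewrite (RI_split4 m1 m2 k1 k2 cg') e1 e2 e3 e4.
  have -> : r * ((b' - a') / 2 + (d' - c') / 2) ^+ 2 = r * (b' - a' + (d' - c')) ^+ 2 / 4 by field.
  move=> p1 p2 p3 p4; apply: le_trans (absD _ _) _.
  apply: le_trans (lerD (absD _ _) (absD _ _)) _.
  move: p1 p2 p3 p4; clear; lra.
(* The divisor 4 compensates for the factor 4 in [RI_le]. *)
have r4 : 0 < r / 4 by lra.
have [q dq] := dg x y xab ycd; have [s s0 Hs] := (cderivP _ _ _).1 dq _ r4.
exists (s / 2); first by lra.
move=> a' b' c' d' h1 /andP[h2 h2'] h3 h4 /andP[h5 h5'] h6 wx wy; rewrite /P.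
have ab' : a' <= b' by lra. have cd' : c' <= d' by lra.
pose z0 := x +i* y; pose E z := g z - g z0 - q * (z - z0).
have BG := bdcontS h1 h3 h4 h6 ab' cd' cg.
have BA : bdcont (fun z => (g z0 - q * z0) + q * z) a' b' c' d'.
  apply/bdcontP => // z _; apply: contD; first exact: cont_cst.
  by apply: contM; [exact: cont_cst|exact: cont_id].
have eE z : E z = 1 * g z + -1 * ((g z0 - q * z0) + q * z) by rewrite /E; ring.
have -> : RI g a' b' c' d' = RI E a' b' c' d'.
  have := RI_lin 1 (-1) BG BA; rewrite RI_affine // mulr0 addr0 mul1r => <-.
  by apply: eq_RI => // z _; rewrite eE.
have BE : bdcont E a' b' c' d'.
  apply/bdcontP => // z zb; apply: (@cont_ext _ (fun z => g z + -1 * ((g z0 - q * z0) + q * z))).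
    by apply: nearc_all => w; rewrite eE mul1r.
  apply: contD; first by move/bdcontP : BG; apply.
  apply: contM; first exact: cont_cst.
  by move/bdcontP : BA; apply.
pose M := r / 4 * (b' - a' + (d' - c')).
have Eb t u : a' <= t <= b' -> c' <= u <= d' -> abs (E (t +i* u)) <= M.
  move=> /andP[t1 t2] /andP[u1 u2].
  have zz : abs (t +i* u - z0) <= b' - a' + (d' - c').
    apply: le_trans (abs_pt _ _ _ _) _; apply: lerD; rewrite ler_norml; apply/andP; split; lra.
  apply: le_trans (Hs _ _) _; first by apply: le_lt_trans zz _; lra.
  by rewrite /M ler_pM2l.
apply: le_trans (RI_le (M := M) ab' cd' BE _ _) _.
- by move=> t tt; split; apply: Eb => //; rewrite lexx ?cd'.
- by move=> t tt; split; apply: Eb => //; rewrite lexx ?ab'.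
- by rewrite /M expr2 le_eqVlt; apply/orP; left; apply/eqP; field.
Qed.

(* Only the complement of the inner rectangle matters. *)
Lemma RI_nested g x0 x1 y0 y1 a b c d :
  x0 <= a -> a <= b -> b <= x1 -> y0 <= c -> c <= d -> d <= y1 ->
  (forall x y, x0 <= x <= x1 -> y0 <= y <= y1 -> ~ (a < x < b /\ c < y < d) -> diffc g (x +i* y)) ->
  RI g x0 x1 y0 y1 = RI g a b c d.
Proof.
move=> h1 h2 h3 h4 h5 h6 dg.
have x0b := le_trans h1 h2; have ax1 := le_trans h2 h3; have x01 := le_trans x0b h3.
have y0d := le_trans h4 h5; have cy1 := le_trans h5 h6; have y01 := le_trans y0d h6.
have dg' x y : x0 <= x <= x1 -> y0 <= y <= y1 -> [\/ x <= a, b <= x, y <= c | d <= y] -> diffc g (x +i* y).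
  by move=> hx hy H; apply: dg => // -[/andP[k1 k2] /andP[k3 k4]]; by case: H; rewrite leNgt ?k1 ?k2 ?k3 ?k4.
have S (u v x y w : R) : u <= x <= v -> y <= u -> v <= w -> y <= x <= w.
  by move=> /andP[k1 k2] k3 k4; rewrite (le_trans k3 k1) (le_trans k2 k4).
have Sx u v x : u <= x <= v -> x0 <= u -> v <= x1 -> x0 <= x <= x1 by exact: S.
have Sy u v x : u <= x <= v -> y0 <= u -> v <= y1 -> y0 <= x <= y1 by exact: S.
have bx : x0 <= x0 <= x1 by rewrite lexx. have bx' : x0 <= x1 <= x1 by rewrite lexx x01.
have by_ : y0 <= y0 <= y1 by rewrite lexx. have by' : y0 <= y1 <= y1 by rewrite lexx y01.
have ba : x0 <= a <= x1 by rewrite h1. have bb : x0 <= b <= x1 by rewrite x0b.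
have bc : y0 <= c <= y1 by rewrite h4. have bd : y0 <= d <= y1 by rewrite y0d.
rewrite (RI_splitV (m := a) h1) //; first last.
- by move=> y hy; apply/diffc_cont/dg' => //; apply: Or41.
- split=> t tt; apply/diffc_cont/dg' => //; [exact: Or43|exact: Or44|exact: Or41|exact: Or42].
rewrite goursat ?add0r //; last first.
  move=> x y hx hy; apply: dg' => //; first exact: Sx hx _ _.
  by case/andP: hx => *; apply: Or41.
rewrite (RI_splitV (m := b) h2) //; first last.
- by move=> y hy; apply/diffc_cont/dg' => //; apply: Or42.
- split=> t tt; apply/diffc_cont/dg' => //; try exact: Sx tt _ _; [exact: Or43|exact: Or44|exact: Or41|exact: Or42].
rewrite [X in _ + X]goursat ?addr0 //; last first.
  move=> x y hx hy; apply: dg' => //; first exact: Sx hx _ _.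
  by case/andP: hx => *; apply: Or42.
rewrite (RI_splitH (m := c) h4) //; first last.
- by move=> x hx; apply/diffc_cont/dg' => //; [exact: Sx hx _ _|apply: Or43].
- split=> t tt; apply/diffc_cont/dg' => //; try exact: Sx tt _ _; [exact: Or43|exact: Or44|exact: Or41|exact: Or42].
rewrite goursat ?add0r //; last first.
  move=> x y hx hy; apply: dg' => //; [exact: Sx hx _ _|exact: Sy hy _ _|].
  by case/andP: hy => *; apply: Or43.
rewrite (RI_splitH (m := d) h5) //; first last.
- by move=> x hx; apply/diffc_cont/dg' => //; [exact: Sx hx _ _|apply: Or44].
- split=> t tt; apply/diffc_cont/dg' => //; try exact: Sx tt _ _; try exact: Sy tt _ _; [exact: Or43|exact: Or44|exact: Or41|exact: Or42].
rewrite [X in _ + X]goursat ?addr0 // => x y hx hy.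
apply: dg' => //; [exact: Sx hx _ _|exact: Sy hy _ _|].
by case/andP: hy => *; apply: Or44.
Qed.

End Goursat.

(** * Cauchy's formula and Taylor expansion, with squares as contours *)

Section Cauchy.
Variable R : realType.
Local Notation C := R[i].
Implicit Types (f g h : C -> C) (x y r : R) (z w : C) (k : nat).

Local Notation SQ g r := (RI g (- r) r (- r) r).
Local Notation bd r := (onbd (- r) r (- r) r).

Lemma onbd_ge r z : 0 < r -> bd r z -> r <= abs z.
Proof.
move=> r0 [x [y [-> _ _ H]]].
have hx : `|x| <= abs (x +i* y) by exact: (abs_Re (x +i* y)).
have hy : `|y| <= abs (x +i* y) by exact: (abs_Im (x +i* y)).
have rr : `|r| = r by rewrite gtr0_norm.
by case: H => E; [move: hx|move: hx|move: hy|move: hy]; rewrite E ?normrN rr.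
Qed.

Lemma bd_sub r z w : 0 < r -> bd r z -> abs w <= r / 2 -> r / 2 <= abs (z - w).
Proof.
move=> r0 /(onbd_ge r0) h hw; have := abs_leB z w; move: r0 h hw; clear; lra.
Qed.

Lemma SQ_le g r (M : R) : 0 < r -> (forall z, bd r z -> cont_at g z /\ abs (g z) <= M) ->
  abs (SQ g r) <= 16 * M * r.
Proof.
move=> r0 H; have rr : - r <= r by lra.
have b1 : - r <= - r <= r by rewrite lexx rr. have b2 : - r <= r <= r by rewrite lexx rr.
apply: le_trans (RI_le (M := M) rr rr _ _ _) _.
- by apply/bdcontP => // z /H [].
- move=> t tt; split; apply: (H _ _).2; [exists t, (- r)|exists t, r]; split=> //;
    [exact: Or43|exact: Or44].
- move=> t tt; split; apply: (H _ _).2; [exists (- r), t|exists r, t]; split=> //;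
    [exact: Or41|exact: Or42].
- by rewrite le_eqVlt; apply/orP; left; apply/eqP; ring.
Qed.

Lemma SQ_lin g h (p q : C) r : 0 < r -> (forall z, bd r z -> cont_at g z /\ cont_at h z) ->
  SQ (fun z => p * g z + q * h z) r = p * SQ g r + q * SQ h r.
Proof.
move=> r0 H; have rr : - r <= r by lra.
by rewrite RI_lin //; apply/bdcontP => // z /H [].
Qed.

Lemma SQ_eq g h r : 0 < r -> (forall z, bd r z -> g z = h z) -> SQ g r = SQ h r.
Proof. by move=> r0 H; apply: eq_RI => //; lra. Qed.

Lemma SQ_grow g r s : 0 < r -> r <= s ->
  (forall z, r <= abs z -> diffc g z) -> SQ g s = SQ g r.
Proof.
move=> r0 rs dg; apply: RI_nested; try lra.
move=> x y hx hy H; apply: dg.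
have [xr|xr] := ltP `|x| r; last exact: le_trans xr (abs_Re (x +i* y)).
have [yr|yr] := ltP `|y| r; last exact: le_trans yr (abs_Im (x +i* y)).
by case: H; rewrite -!ltr_norml.
Qed.

Lemma sub_neq0_abs z w : abs w < abs z -> z - w != 0.
Proof. by move=> h; rewrite subr_eq0; apply: contraTneq h => ->; rewrite ltxx. Qed.

Lemma diffc_pole (a z : C) : z - a != 0 -> diffc (fun w => (w - a)^-1) z.
Proof.
move=> h; apply: (diffcV (f := fun w => w - a)) => //.
by apply: diffcB; [exact: diffc_id|exact: diffc_cst].
Qed.

Lemma sqr_le_itv r x : - r <= x <= r -> x ^+ 2 <= r ^+ 2.
Proof.
rewrite -ler_norml => xr; rewrite -[x ^+ 2]real_normK ?num_real //.
by apply: lerXn2r; rewrite ?nnegrE // (le_trans _ xr).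
Qed.

Definition wind r := SQ (fun z => z^-1) r.

(* The exact value is [2 pi i]. *)
Lemma wind_ge r : 0 < r -> 4 <= abs (wind r).
Proof.
move=> r0; have rr : - r <= r by lra.
apply: le_trans (abs_Im _); apply: le_trans (ler_norm _).
rewrite /wind /RI cImD cImM /= !mul0r add0r mul1r.
have nz x y : x != 0 \/ y != 0 -> (x +i* y : C) != 0.
  by rewrite eq_complex /= negb_and => -[->|->]; rewrite ?orbT.
have rn : r != 0 by rewrite gt_eqF. have rn' : - r != 0 by rewrite oppr_eq0.
have ci z : z != 0 -> cont_at (fun w : C => w^-1) z.
  by move=> h; apply: (contV (f := id)) => //; exact: cont_id.
have H y : y != 0 -> cts (lineH (fun z => z^-1) y) (- r) r.
  by move=> h; apply: cts_lineH => x _; apply/ci/nz; right.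
have V x : x != 0 -> cts (lineV (fun z => z^-1) x) (- r) r.
  by move=> h; apply: cts_lineV => y _; apply/ci/nz; left.
have n2 x y : x ^+ 2 + y ^+ 2 = y ^+ 2 + x ^+ 2 by rewrite addrC.
(* Opposite sides together contribute [2 r / (r^2 + t^2) >= 1 / r], hence at least 2 over the length
   [2 r]; the two pairs of sides give 4. *)
have le1 t : - r <= t <= r -> r^-1 <= (r / (r ^+ 2 + t ^+ 2)) *+ 2.
  move=> tr; have t2 := sqr_le_itv tr.
  have p : 0 < r ^+ 2 + t ^+ 2 by rewrite ltr_wpDr ?sqr_ge0 ?exprn_gt0.
  rewrite -mulr_natl mulrA ler_pdivlMr // ler_pdivrMl //; move: t2; rewrite expr2; lra.
have e1 : 2 <= \int[@lebesgue_measure R]_(t in `[- r, r])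
   Im (lineH (fun z => z^-1) (- r) t - lineH (fun z => z^-1) r t).
  have -> : 2 = r^-1 * (r - - r) by rewrite opprK; field.
  apply: Rint_ge => //; first exact: (integrable_Im (ctsB (H _ rn') (H _ rn))).
  move=> t /le1; rewrite /lineH cImD cImN /= sqrrN opprK [t ^+ 2 + _]addrC; lra.
have e2 : 2 <= \int[@lebesgue_measure R]_(t in `[- r, r])
   Re (lineV (fun z => z^-1) r t - lineV (fun z => z^-1) (- r) t).
  have -> : 2 = r^-1 * (r - - r) by rewrite opprK; field.
  apply: Rint_ge => //; first exact: (integrable_Re (ctsB (V _ rn) (V _ rn'))).
  move=> t /le1; rewrite /lineV cReD cReN /= sqrrN; lra.
by move: e1 e2; clear; lra.
Qed.

Lemma wind_neq0 r : 0 < r -> wind r != 0.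
Proof. by move=> /wind_ge h; rewrite -abs_gt0; move: h; clear; lra. Qed.

(** The two integrands differ by [z / (w (w - z))]. The integral of this quotient does not change
    when the square grows, and over the square of size [s] it is [O(1 / s)]. *)
Lemma winding_shift r z : 0 < r -> abs z <= r / 2 -> SQ (fun w => (w - z)^-1) r = wind r.
Proof.
move=> r0 zr; have rr : r / 2 < r by lra.
pose g w := w^-1 * (w - z)^-1.
have zr' : abs z < r by exact: le_lt_trans zr rr.
have nz w : r <= abs w -> w != 0 by move=> h; rewrite -abs_gt0; exact: lt_le_trans h.
have nzz w : r <= abs w -> w - z != 0 by move=> h; apply: sub_neq0_abs; exact: lt_le_trans h.
have dg w : r <= abs w -> diffc g w.
  move=> h; apply: diffcM; last exact/diffc_pole/nzz.
  by apply: (diffcV (f := id)); [exact: nz|exact: diffc_id].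
suff S0 : SQ g r = 0.
  have -> : SQ (fun w => (w - z)^-1) r = SQ (fun w => z * g w + 1 * w^-1) r.
    by apply: SQ_eq => // w /(onbd_ge r0) h; rewrite /g; field; rewrite nz ?nzz.
  rewrite SQ_lin // ?S0 ?mulr0 ?add0r ?mul1r // => w /(onbd_ge r0) h; split; first exact/diffc_cont/dg.
  by apply: (contV (f := id)); [exact: nz|exact: cont_id].
apply/eqP; rewrite -abs_eq0 eq_le abs_ge0 andbT; apply/ler_addgt0Pl => e e0; rewrite addr0.
pose s := r + 32 / e; have s0 : 0 < 32 / e by rewrite divr_gt0.
have rs : r <= s by rewrite /s; move: s0; clear; lra.
have sp : 0 < s by exact: lt_le_trans rs.
rewrite -(SQ_grow r0 rs dg); apply: le_trans (SQ_le (M := 2 / s ^+ 2) sp _) _.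
  move=> w wb; have h := onbd_ge sp wb; split; first exact/diffc_cont/dg/(le_trans rs).
  have zs : abs z <= s / 2 by apply: le_trans zr _; rewrite ler_pM2r.
  have h2 := bd_sub sp wb zs.
  have a1 : (abs w)^-1 <= s^-1 by rewrite lef_pV2 ?posrE //; exact: lt_le_trans h.
  have a2 : (abs (w - z))^-1 <= (s / 2)^-1.
    by rewrite lef_pV2 ?posrE //; [apply: lt_le_trans h2|]; rewrite divr_gt0.
  rewrite /g absM !absV.
  apply: le_trans (ler_pM _ _ a1 a2) _; rewrite ?invr_ge0 ?abs_ge0 //.
  by rewrite le_eqVlt; apply/orP; left; apply/eqP; field; rewrite gt_eqF.
have -> : 16 * (2 / s ^+ 2) * s = 32 / s by field; rewrite gt_eqF.
rewrite ler_pdivrMr // mulrC -ler_pdivrMr //; move: r0; rewrite /s; clear; lra.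
Qed.

Lemma sq_lt2 r x y : 0 < r -> - r <= x <= r -> - r <= y <= r -> abs (x +i* y) < 2 * r.
Proof.
move=> r0 hx hy; have : abs (x +i* y) ^+ 2 < (2 * r) ^+ 2.
  rewrite /abs /= sqr_sqrtr ?addr_ge0 ?sqr_ge0 //.
  have := sqr_le_itv hx; have := sqr_le_itv hy; have : 0 < r ^+ 2 by rewrite exprn_gt0.
  by rewrite exprMn; clear; lra.
by rewrite ltr_pXn2r ?nnegrE ?abs_ge0 // mulr_ge0 // ltW.
Qed.

Lemma onbd_lt2 r z : 0 < r -> bd r z -> abs z < 2 * r.
Proof. by move=> r0 [x [y [-> hx hy _]]]; exact: sq_lt2. Qed.

Lemma diffc_slope f z w : w - z != 0 -> diffc f w -> diffc (fun w => (f w - f z) * (w - z)^-1) w.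
Proof.
move=> wz df; apply: diffcM; last exact: diffc_pole.
by apply: diffcB => //; exact: diffc_cst.
Qed.

(** It suffices that the slope [(f w - f z) / (w - z)] integrates to zero. It is holomorphic off [z]
    and bounded near [z], so the contour can be shrunk to an arbitrarily small square around [z]. *)
Lemma cauchy_formula f r z : 0 < r -> (forall w, abs w < 2 * r -> diffc f w) ->
  abs z <= r / 2 -> SQ (fun w => f w * (w - z)^-1) r = f z * wind r.
Proof.
move=> r0 df zr; pose k w := (f w - f z) * (w - z)^-1.
have bnz w : bd r w -> w - z != 0.
  move=> /(onbd_ge r0) h; apply: sub_neq0_abs; apply: le_lt_trans zr _.
  by apply: lt_le_trans h; move: r0; clear; lra.
have bdf w : bd r w -> diffc f w by move=> /(onbd_lt2 r0) /df.
suff S0 : SQ k r = 0.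
  have -> : SQ (fun w => f w * (w - z)^-1) r = SQ (fun w => 1 * k w + f z * (w - z)^-1) r.
    by apply: SQ_eq => // w _; rewrite /k; ring.
  rewrite SQ_lin // ?S0 ?mulr0 ?add0r ?winding_shift // => w wb; split; last exact/diffc_cont/diffc_pole/bnz.
  by apply: diffc_cont; apply: diffc_slope; [exact: bnz|exact: bdf].
apply/eqP; rewrite -abs_eq0 eq_le abs_ge0 andbT; apply/ler_addgt0Pl => e e0; rewrite addr0.
have [x [y zE]] : exists x y, z = x +i* y by case: (z) => x y; exists x, y.
have zr2 : abs z < 2 * r by move: zr r0; clear; lra.
have [d /cderivP/(_ 1 ltr01) [s s0 Hs]] := df _ zr2.
pose B := abs d + 1; have B0 : 0 < B by rewrite ltr_wpDl ?abs_ge0.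
(* Half the side of the small square: it must lie in the big one and within distance [s] of [z], and
   its integral, at most [16 B t], must not exceed [e]. *)
pose t := Num.min (r / 2) (Num.min (s / 3) (e / (16 * B))).
have [t0 tr ts te] : [/\ 0 < t, t <= r / 2, t <= s / 3 & t <= e / (16 * B)].
  rewrite /t !lt_min !ge_min !lexx !orbT; split=> //.
  by rewrite !divr_gt0 ?mulr_gt0.
have hx : `|x| <= r / 2 by apply: le_trans zr; rewrite zE; exact: (abs_Re (x +i* y)).
have hy : `|y| <= r / 2 by apply: le_trans zr; rewrite zE; exact: (abs_Im (x +i* y)).
have [x1 x2 x3] : [/\ - r <= x - t, x - t <= x + t & x + t <= r].
  by move: hx t0 tr; rewrite ler_norml => /andP[]; clear; split; lra.
have [y1 y2 y3] : [/\ - r <= y - t, y - t <= y + t & y + t <= r].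
  by move: hy t0 tr; rewrite ler_norml => /andP[]; clear; split; lra.
have dk w : abs w < 2 * r -> w != z -> diffc k w.
  by move=> h1 h2; apply: diffc_slope; [rewrite subr_eq0|exact: df].
rewrite (RI_nested x1 x2 x3 y1 y2 y3); last first.
  move=> x' y' hx' hy' H; apply: dk; first exact: sq_lt2.
  apply/eqP; rewrite zE => -[E1 E2]; apply: H; rewrite E1 E2.
  by move: t0; clear => t0; split; apply/andP; split; lra.
have ob w : onbd (x - t) (x + t) (y - t) (y + t) w -> [/\ abs w < 2 * r, w != z & abs (w - z) < s].
  move=> [x' [y' [-> /andP[a1 a2] /andP[b1 b2] H]]]; split.
  - by apply: sq_lt2; rewrite // ?(le_trans x1 a1) ?(le_trans a2 x3) ?(le_trans y1 b1) ?(le_trans b2 y3).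
  - rewrite zE; apply/eqP => -[E1 E2]; move: H t0; rewrite E1 E2; clear => H t0.
    by case: H => H; move: H t0; lra.
  rewrite zE; apply: le_lt_trans (abs_pt _ _ _ _) _.
  have h1 : `|x' - x| <= t by rewrite ler_norml; move: a1 a2; clear => *; apply/andP; split; lra.
  have h2 : `|y' - y| <= t by rewrite ler_norml; move: b1 b2; clear => *; apply/andP; split; lra.
  by move: h1 h2 ts s0; clear; lra.
have kB w : onbd (x - t) (x + t) (y - t) (y + t) w -> abs (k w) <= B.
  move=> /ob [_ wz ws]; have wz' : w - z != 0 by rewrite subr_eq0.
  rewrite /k absM absV ler_pdivrMr ?abs_gt0 //.
  have := Hs w ws; rewrite mul1r /B mulrDl mul1r -absM => h.
  have -> : f w - f z = d * (w - z) + (f w - f z - d * (w - z)) by ring.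
  by apply: le_trans (absD _ _) _; rewrite lerD2l.
apply: le_trans (RI_le (M := B) x2 y2 _ _ _) _.
- by apply/bdcontP => // w /ob [h1 h2 _]; exact/diffc_cont/dk.
- move=> u uu; split; apply: kB; [exists u, (y - t)|exists u, (y + t)]; split=> //;
    rewrite ?lexx ?y2 //; [exact: Or43|exact: Or44].
- move=> u uu; split; apply: kB; [exists (x - t), u|exists (x + t), u]; split=> //;
    rewrite ?lexx ?x2 //; [exact: Or41|exact: Or42].
have -> : 4 * B * (x + t - (x - t) + (y + t - (y - t))) = t * (16 * B) by ring.
by rewrite -ler_pdivlMr // mulr_gt0.
Qed.

(** Cauchy's kernel is expanded as a finite geometric sum, [1 / (w - z) = sum_(j < k) z^j / w^(j+1)
    + z^k / (w^k (w - z))]. The last integral is at most [32 M / r^k], and dividing by a winding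
    integral of modulus at least 4 leaves the constant 8. *)
Lemma taylor0 f r (M : R) : 0 < r ->
  (forall w, abs w < 2 * r -> diffc f w /\ abs (f w) <= M) ->
  exists a : nat -> C, forall (k : nat) z, abs z <= r / 2 ->
    abs (f z - \sum_(j < k) a j * z ^+ j) <= 8 * M * (abs z / r) ^+ k.
Proof.
move=> r0 H; have df w : abs w < 2 * r -> diffc f w by move=> /H [].
pose F j w := f w * (w ^+ j.+1)^-1; pose G z k w := f w * (w ^+ k * (w - z))^-1.
exists (fun j => SQ (F j) r / wind r) => k z zr.
have W0 := wind_neq0 r0; have W4 := wind_ge r0.
have bz w : bd r w -> w != 0.
  by move=> /(onbd_ge r0) h; rewrite -abs_gt0; exact: lt_le_trans h.
have bzz w : bd r w -> w - z != 0.
  move=> /(onbd_ge r0) h; apply: sub_neq0_abs; apply: le_lt_trans zr _.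
  by apply: lt_le_trans h; move: r0; clear; lra.
have bf w : bd r w -> diffc f w by move=> /(onbd_lt2 r0) /df.
have cF j w : bd r w -> cont_at (F j) w.
  move=> wb; apply/diffc_cont; apply: diffcM; first exact: bf.
  apply: (diffcV (f := fun w => w ^+ j.+1)); first by rewrite expf_neq0 ?bz.
  exact: diffcX (diffc_id w).
have cG j w : bd r w -> cont_at (G z j) w.
  move=> wb; apply/diffc_cont; apply: diffcM; first exact: bf.
  apply: (diffcV (f := fun w => w ^+ j * (w - z))); first by apply: mulf_neq0; [exact/expf_neq0/bz|exact: bzz].
  apply: diffcM; first exact: diffcX (diffc_id w).
  by apply: diffcB; [exact: diffc_id|exact: diffc_cst].
have E : f z * wind r = \sum_(j < k) SQ (F j) r * z ^+ j + z ^+ k * SQ (G z k) r.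
  elim: k => [|k ->].
    rewrite big_ord0 add0r expr0 mul1r -cauchy_formula //.
    by apply: SQ_eq => // w _; rewrite /G expr0 mul1r.
  rewrite big_ord_recr /= -addrA; congr (_ + _).
  have -> : SQ (G z k) r = 1 * SQ (F k) r + z * SQ (G z k.+1) r.
    rewrite -SQ_lin //; last by move=> w wb; split; [exact: cF|exact: cG].
    apply: SQ_eq => // w wb; rewrite /G /F !exprSr.
    have : w ^+ k != 0 by exact/expf_neq0/bz.
    by move: (w ^+ k) => u u0; field; rewrite ?u0 ?(bz _ wb) ?(bzz _ wb).
  by rewrite exprSr; ring.
have {E} -> : f z - \sum_(j < k) SQ (F j) r / wind r * z ^+ j = z ^+ k * SQ (G z k) r / wind r.
  have S : (\sum_(j < k) SQ (F j) r / wind r * z ^+ j) * wind r = \sum_(j < k) SQ (F j) r * z ^+ j.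
    by rewrite mulr_suml; apply: eq_bigr => j _; field.
  by apply: (mulIf W0); rewrite mulrBl S divfK // E; ring.
have GM : abs (SQ (G z k) r) <= 32 * M / r ^+ k.
  apply: le_trans (SQ_le (M := M * (r ^+ k * (r / 2))^-1) r0 _) _.
    move=> w wb; split; first exact: cG.
    have [_ fM] := H w (onbd_lt2 r0 wb).
    rewrite /G absM absV; apply: ler_pM => //; rewrite ?invr_ge0 ?abs_ge0 //.
    have r2 : 0 < r / 2 by rewrite divr_gt0.
    have h1 := onbd_ge r0 wb; have h2 := bd_sub r0 wb zr.
    have h3 : r ^+ k * (r / 2) <= abs w ^+ k * abs (w - z).
      apply: ler_pM h2; rewrite ?exprn_ge0 ?(ltW r0) ?(ltW r2) //.
      by apply: lerXn2r; rewrite ?nnegrE ?(ltW r0) ?abs_ge0.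
    have h4 : 0 < r ^+ k * (r / 2) by rewrite mulr_gt0 ?exprn_gt0.
    by rewrite absM absX lef_pV2 ?posrE // (lt_le_trans h4 h3).
  have rn : r != 0 by rewrite gt_eqF.
  rewrite le_eqVlt; apply/orP; left; apply/eqP.
  by have := expf_neq0 k rn; move: (r ^+ k) => u u0; field; rewrite ?u0 ?rn.
have -> : abs (z ^+ k * SQ (G z k) r / wind r) = abs z ^+ k * abs (SQ (G z k) r) * (abs (wind r))^-1.
  by rewrite !absM absX absV.
have W0' : 0 < abs (wind r) by apply: lt_le_trans W4.
rewrite ler_pdivrMr // expr_div_n.
apply: le_trans (ler_wpM2l (exprn_ge0 _ (abs_ge0 z)) GM) _.
have -> : abs z ^+ k * (32 * M / r ^+ k) = 8 * M * (abs z ^+ k / r ^+ k) * 4 by ring.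
rewrite ler_wpM2l // mulr_ge0 ?mulr_ge0 ?invr_ge0 ?exprn_ge0 ?abs_ge0 ?(ltW r0) //.
have [|_] := H 0; first by rewrite abs0 mulr_gt0.
by apply: le_trans; exact: abs_ge0.
Qed.

(* All later consequences of Cauchy's formula are drawn from this estimate, uniform in [k]. *)
Theorem taylor f z0 r (M : R) : 0 < r ->
  (forall w, abs (w - z0) < r -> diffc f w /\ abs (f w) <= M) ->
  exists a : nat -> C, forall (k : nat) z, abs z <= r / 4 ->
    abs (f (z0 + z) - \sum_(j < k) a j * z ^+ j) <= 8 * M * (abs z / (r / 2)) ^+ k.
Proof.
move=> r0 H; have r2 : 0 < r / 2 by rewrite divr_gt0.
have [|a Ha] := @taylor0 (fun z => f (z0 + z)) (r / 2) M r2.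
  move=> w wr; have [|df fM] := H (z0 + w); first by rewrite addrC addKr; move: wr; clear; lra.
  split=> //; apply: (diffc_comp (f := fun w => z0 + w)) => //.
  by apply: diffcD; [exact: diffc_cst|exact: diffc_id].
by exists a => k z zr; apply: Ha; move: zr; clear; lra.
Qed.

End Cauchy.

(** * Cauchy's estimate, isolated zeros and removable singularities *)

Section TaylorConsequences.
Variable R : realType.
Local Notation C := R[i].
Implicit Types (f g h : C -> C) (x y r : R) (z w : C) (k : nat).

Definition tayl f z0 r (M : R) (a : nat -> C) := forall k z, abs z <= r / 4 ->
    abs (f (z0 + z) - \sum_(j < k) a j * z ^+ j) <= 8 * M * (abs z / (r / 2)) ^+ k.

Lemma tayl0 f z0 r M a : 0 < r -> tayl f z0 r M a -> a 0%N = f z0.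
Proof.
move=> r0 /(_ 1%N 0); rewrite abs0 mul0r expr1 mulr0 big_ord1 expr0 mulr1 addr0.
move=> /(_ (divr_ge0 (ltW r0) (ler0n _ _))) h; apply/esym/eqP.
by rewrite -subr_eq0 -abs_eq0 eq_le h abs_ge0.
Qed.

Lemma tayl_quad f z0 r M a z : 0 < r -> tayl f z0 r M a -> abs z <= r / 4 ->
  abs (f (z0 + z) - f z0 - a 1%N * z) <= 32 * M / r ^+ 2 * abs z ^+ 2.
Proof.
move=> r0 T zr; have := T 2%N z zr; rewrite big_ord_recl big_ord1 /= (tayl0 r0 T) expr0 expr1 mulr1 opprD addrA.
move=> /le_trans; apply; rewrite le_eqVlt; apply/orP; left; apply/eqP; field; rewrite gt_eqF //.
Qed.

Lemma tayl_cderiv f z0 r M a : 0 < r -> tayl f z0 r M a -> cderiv f z0 (a 1%N).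
Proof.
move=> r0 T; apply/cderivP => e e0; set K := 32 * M / r ^+ 2.
have K1 : 0 < `|K| + 1 by rewrite ltr_wpDl.
exists (Num.min (r / 4) (e / (`|K| + 1))); first by rewrite lt_min !divr_gt0.
move=> w; rewrite lt_min => /andP[/ltW w1 w2].
have := tayl_quad r0 T w1; rewrite (addrC z0) subrK -/K => /le_trans; apply.
rewrite expr2 mulrA ler_wpM2r ?abs_ge0 //; apply: le_trans (ler_norm _) _.
rewrite normrM (ger0_norm (abs_ge0 _)); move: w2; rewrite ltr_pdivlMr // mulrDr mulr1 => /ltW.
by apply: le_trans; rewrite mulrC lerDl abs_ge0.
Qed.

(** At [z = r / 4] the remainders for [k = 1] and [k = 2] are at most [4 M] and [2 M]; their
    difference is [a_1 z], so [|a_1| <= 6 M / (r / 4)]. *)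
Lemma tayl_a1 f z0 r M a : 0 < r -> tayl f z0 r M a -> abs (a 1%N) <= 24 * M / r.
Proof.
move=> r0 T; pose z : C := (r / 4)%:C.
have r4 : 0 <= r / 4 by rewrite divr_ge0 // ltW.
have zE : abs z = r / 4 by rewrite absC ger0_norm.
have zle : abs z <= r / 4 by rewrite zE.
have h1 := T 1%N z zle; have h2 := T 2%N z zle.
have rn : r != 0 by rewrite gt_eqF.
have e1 : abs z / (r / 2) = 2^-1 by rewrite zE; field.
move: h1 h2; rewrite e1 !big_ord_recl !big_ord0 /= expr0 !mulr1 addr0 => h1 h2.
have : abs (a 1%N * z) <= 6 * M.
  have -> : a 1%N * z = (f (z0 + z) - a 0%N) - (f (z0 + z) - (a 0%N + (a 1%N * z ^+ 1 + 0))) by rewrite expr1; ring.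
  apply: le_trans (absD _ _) _; rewrite absN; move: h1 h2; rewrite expr1 expr2; clear; lra.
rewrite absM zE => h; rewrite ler_pdivlMr //; move: h; clear; lra.
Qed.

Lemma bounded_near f z : nearc z (diffc f) ->
  exists2 r : R, 0 < r & exists M, forall w, abs (w - z) < r -> diffc f w /\ abs (f w) <= M.
Proof.
move=> df; have cf := diffc_cont (nearc_id df).
have [r r0 H] := nearc_and df (cont_bounded cf).
by exists r => //; exists (abs (f z) + 1).
Qed.

Lemma cauchy_est f z r (M : R) : 0 < r ->
  (forall w, abs (w - z) < r -> diffc f w /\ abs (f w) <= M) -> abs (Dc f z) <= 24 * M / r.
Proof.
move=> r0 /(taylor r0) [a T]; rewrite (DcE (tayl_cderiv r0 T)); exact: tayl_a1 T.
Qed.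

(* The symmetric difference [f (z + 2w) - f z] around [z + w] has no quadratic
   term, so it determines [f' (z + w)] up to [O(w ^ 2)]. *)
Lemma Dc_diffc f z : nearc z (diffc f) -> diffc (Dc f) z.
Proof.
move=> /bounded_near [r r0 [M H]]; have [a T] := taylor r0 H.
have M0 : 0 <= M.
  by have [|_] := H z; [rewrite subrr abs0|apply: le_trans; exact: abs_ge0].
have a1 := DcE (tayl_cderiv r0 T).
have rn : r != 0 by rewrite gt_eqF.
pose K := 2 * (8 * M / (r / 4) ^+ 3).
have K0 : 0 <= K by rewrite mulr_ge0 // divr_ge0 ?mulr_ge0 ?exprn_ge0 ?divr_ge0 // ltW.
have main w : abs w <= r / 16 -> abs (Dc f (z + w) - Dc f z - 2 * a 2%N * w) <= K * abs w ^+ 2.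
  move=> wr; have [->|w0] := eqVneq w 0; first by rewrite addr0 subrr mulr0 subr0 abs0 expr0n /= mulr0.
  have r2 : 0 < r / 2 by rewrite divr_gt0.
  have [|b S] := @taylor _ f (z + w) (r / 2) M r2.
    move=> u ur; apply: H; apply: le_lt_trans (abs_subD u (z + w) z) _.
    by rewrite (addrC z w) addrK; move: ur wr r0; rewrite (addrC w z); clear; lra.
  rewrite (DcE (tayl_cderiv r2 S)) a1.
  have ww : 0 < abs w by rewrite abs_gt0.
  have s1 := S 3%N w; have s2 := S 3%N (- w).
  have s3 := T 3%N (2 * w).
  have w2 : abs (2 * w) = 2 * abs w by rewrite absM absn.
  rewrite w2 in s3; rewrite absN in s2.
  have {}s1 := s1 (_ : _); have {}s2 := s2 (_ : _); have {}s3 := s3 (_ : _).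
  have wr' : abs w <= r / 2 / 4 by move: wr r0; clear; lra.
  have wr'' : 2 * abs w <= r / 4 by move: wr r0; clear; lra.
  move: (s1 wr') (s2 wr') (s3 wr''); rewrite addrK -addrA -(mulr2n w) -(mulr_natl w 2) !big_ord_recl !big_ord0 /= /bump /= !expr0 !expr1 !addr0 !mulr1.
  rewrite !(tayl0 r2 S) !(tayl0 r0 T) => q1 q2 q3.
  have ck : 8 * M * (abs w / (r / 2 / 2)) ^+ 3 = K / 2 * abs w ^+ 3.
    by rewrite /K; field.
  have ck2 : 8 * M * (2 * abs w / (r / 2)) ^+ 3 = K / 2 * abs w ^+ 3.
    by rewrite /K; field.
  rewrite ck in q1 q2; rewrite ck2 in q3.
  have : abs (2 * w * (b 1%N - a 1%N - 2 * a 2%N * w)) <= 2 * abs w * (K * abs w ^+ 2).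
    (* Three second-order expansions are combined: at [z] evaluated in [2 w], and at [z + w]
       evaluated in [w] and in [- w]. All values of [f] and the coefficient [b_2] cancel. *)
    have -> : 2 * w * (b 1%N - a 1%N - 2 * a 2%N * w) =
      (f (z + 2 * w) - (f z + (a 1%N * (2 * w) + a 2%N * (2 * w) ^+ 2)))
      - (f (z + 2 * w) - (f (z + w) + (b 1%N * w + b 2%N * w ^+ 2)))
      + (f z - (f (z + w) + (b 1%N * - w + b 2%N * (- w) ^+ 2))).
      by ring.
    apply: le_trans (absD _ _) _; apply: le_trans (lerD (absD _ _) (lexx _)) _.
    rewrite absN; have -> : 2 * abs w * (K * abs w ^+ 2) = 4 * (K / 2 * abs w ^+ 3) by field.
    have : 0 <= K / 2 * abs w ^+ 3 by rewrite mulr_ge0 ?divr_ge0 ?exprn_ge0 ?abs_ge0.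
    move: q1 q2 q3; clear; lra.
  by rewrite absM absM absn ler_pM2l // mulr_gt0.
exists (2 * a 2%N); apply/cderivP => e e0.
have K1 : 0 < K + 1 by rewrite ltr_wpDl.
exists (Num.min (r / 16) (e / (K + 1))); first by rewrite lt_min !divr_gt0.
move=> w; rewrite lt_min => /andP[/ltW w1 w2].
have := main _ w1; rewrite (addrC z) subrK => /le_trans; apply.
rewrite expr2 mulrA ler_wpM2r ?abs_ge0 //.
move: w2; rewrite ltr_pdivlMr // mulrDr mulr1 => /ltW.
by apply: le_trans; rewrite mulrC lerDl abs_ge0.
Qed.

(** Either all Taylor coefficients vanish, and letting [k] grow in the remainder estimate gives
    [h = 0] near [z]; or the first nonzero coefficient dominates the remainder after it. *)
Lemma isolated_zeros h z : nearc z (diffc h) ->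
  nearc z (fun w => h w = 0) \/ nearc z (fun w => w != z -> h w != 0).
Proof.
move=> /bounded_near [r r0 [M H]]; have [a T] := taylor r0 H.
have M0 : 0 <= M.
  by have [|_] := H z; [rewrite subrr abs0|apply: le_trans; exact: abs_ge0].
have [[j aj]|aj] := pselect (exists j, a j != 0); last first.
  left; have {}aj j : a j = 0 by apply/eqP/negPn/negP => h0; apply: aj; exists j.
  exists (r / 4); first by rewrite divr_gt0.
  move=> w wr; apply/eqP; rewrite -abs_eq0 eq_le abs_ge0 andbT.
  apply/ler_addgt0Pl => e e0; rewrite addr0.
  have t2 : abs (w - z) / (r / 2) <= 2^-1.
    by rewrite ler_pdivrMr ?divr_gt0 //; move: wr; clear; lra.
  have [k ke] : exists k : nat, 8 * M / 2 ^+ k <= e.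
    exists (Num.bound (8 * M / e)); rewrite ler_pdivrMr ?exprn_gt0 // (mulrC e) -ler_pdivrMr //.
    have M8 : 0 <= 8 * M / e by rewrite divr_ge0 ?mulr_ge0 // ltW.
    by apply: ltW; apply: lt_trans (archi_boundP M8) _; rewrite -natrX ltr_nat ltn_expl.
  have := T k _ (ltW wr); rewrite (addrC z) subrK big1 ?subr0; last by move=> i _; rewrite aj mul0r.
  move=> /le_trans; apply; apply: le_trans ke; rewrite -exprVn.
  apply: ler_wpM2l; first by rewrite mulr_ge0.
  by apply: lerXn2r => //; rewrite nnegrE ?divr_ge0 ?abs_ge0 // ltW.
right; case: (ex_minnP (ex_intro (fun j => a j != 0) j aj)) => m am mmin.
have am0 : 0 < abs (a m) by rewrite abs_gt0.
pose K := 8 * M / (r / 2) ^+ m.+1.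
have K0 : 0 <= K by rewrite divr_ge0 ?mulr_ge0 ?exprn_ge0 ?divr_ge0 // ltW.
have K1 : 0 < K + 1 by rewrite ltr_wpDl.
exists (Num.min (r / 4) (abs (a m) / (K + 1))); first by rewrite lt_min !divr_gt0.
move=> w; rewrite lt_min => /andP[/ltW w1 w2] wz; apply/eqP => hw.
have wz' : 0 < abs (w - z) by rewrite abs_gt0 subr_eq0.
have := T m.+1 _ w1; rewrite (addrC z) subrK hw big_ord_recr big1 /= => [|i _]; last first.
  by apply/eqP; rewrite mulf_eq0; apply/orP; left; apply: contraTT (ltn_ord i) => /mmin; rewrite -leqNgt.
rewrite !add0r absN absM absX expr_div_n mulrA mulrAC -/K exprS mulrA.
rewrite ler_pM2r ?exprn_gt0 //; move: w2; rewrite ltr_pdivlMr // mulrDr mulr1 (mulrC K).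
by move: wz'; clear; lra.
Qed.

(** Riemann's argument: [(w - z)^2 h(w)], extended by 0, is differentiable at [z] with derivative 0.
    Its Taylor coefficients [a_0] and [a_1] vanish, [a_2] is the missing value of [h] and [a_3] the
    derivative there. *)
Lemma removable h z r (M : R) : 0 < r ->
  (forall w, abs (w - z) < r -> w != z -> diffc h w /\ abs (h w) <= M) ->
  exists v, diffc (fun w => if w == z then v else h w) z.
Proof.
move=> r0 H; pose u w := if w == z then 0 else (w - z) ^+ 2 * h w.
have off w : w != z -> nearc w (fun t => t != z).
  move=> wz; have cs : cont_at (fun t => t - z) w by apply: contD; [exact: cont_id|exact: cont_cst].
  by apply: nearcW (nearc_neq0 cs _) => [x|]; rewrite subr_eq0.
have du w : abs (w - z) < r -> diffc u w.
  move=> wr; have [->|wz] := eqVneq w z.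
    exists 0; apply/cderivP => e e0; have M1 : 0 < `|M| + 1 by rewrite ltr_wpDl.
    exists (Num.min r (e / (`|M| + 1))); first by rewrite lt_min r0 divr_gt0.
    move=> x; rewrite lt_min => /andP[x1 x2]; rewrite /u eqxx subr0 mul0r subr0.
    case: eqVneq => [_|xz]; first by rewrite abs0 mulr_ge0 ?abs_ge0 // ltW.
    rewrite absM absX expr2 mulrAC ler_wpM2r ?abs_ge0 //.
    move: x2; rewrite ltr_pdivlMr // => /ltW; apply: le_trans; rewrite ler_wpM2l ?abs_ge0 //.
    have [_ hM] := H x x1 xz; apply: le_trans hM _; apply: le_trans (ler_norm _) _.
    by rewrite lerDl.
  have [dh _] := H w wr wz.
  apply: (@diffc_ext _ (fun w => (w - z) ^+ 2 * h w)).
    by apply: nearcW (off _ wz) => x /negbTE; rewrite /u => ->.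
  by apply: diffcM => //; apply: diffcX; apply: diffcB; [exact: diffc_id|exact: diffc_cst].
have uz : u z = 0 by rewrite /u eqxx.
have [s s0 [L HL]] := bounded_near (ex_intro2 _ _ r r0 du : nearc z (diffc u)).
have [a T] := taylor s0 HL; have a0 := tayl0 s0 T; rewrite uz in a0.
have a1 : a 1%N = 0.
  apply: cderiv_uniq (tayl_cderiv s0 T) _.
  apply/cderivP => e e0; have M1 : 0 < `|M| + 1 by rewrite ltr_wpDl.
  exists (Num.min r (e / (`|M| + 1))); first by rewrite lt_min r0 divr_gt0.
  move=> x; rewrite lt_min => /andP[x1 x2]; rewrite /u eqxx subr0 mul0r subr0.
  case: eqVneq => [_|xz]; first by rewrite abs0 mulr_ge0 ?abs_ge0 // ltW.
  rewrite absM absX expr2 mulrAC ler_wpM2r ?abs_ge0 //.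
  move: x2; rewrite ltr_pdivlMr // => /ltW; apply: le_trans; rewrite ler_wpM2l ?abs_ge0 //.
  have [_ hM] := H x x1 xz; apply: le_trans hM _; apply: le_trans (ler_norm _) _.
  by rewrite lerDl.
exists (a 2%N), (a 3%N); apply/cderivP => e e0.
pose K := 8 * L / (s / 2) ^+ 4.
have L0 : 0 <= L.
  by have [|_] := HL z; [rewrite subrr abs0|apply: le_trans; exact: abs_ge0].
have K0 : 0 <= K by rewrite divr_ge0 ?mulr_ge0 ?exprn_ge0 ?divr_ge0 // ltW.
have K1 : 0 < K + 1 by rewrite ltr_wpDl.
exists (Num.min (s / 4) (e / (K + 1))); first by rewrite lt_min !divr_gt0.
move=> w; rewrite lt_min => /andP[/ltW w1 w2]; rewrite eqxx; case: eqVneq => [->|wz].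
  by rewrite !subrr mulr0 subr0 abs0 mulr0.
have wz' : 0 < abs (w - z) by rewrite abs_gt0 subr_eq0.
have := T 4%N _ w1; rewrite (addrC z) subrK !big_ord_recl big_ord0 /= a0 /bump /= a1 {1}/u (negbTE wz).
rewrite !mul0r !add0r addr0.
have -> : (w - z) ^+ 2 * h w - (a 2%N * (w - z) ^+ 2 + a 3%N * (w - z) ^+ 3) =
  (w - z) ^+ 2 * (h w - a 2%N - a 3%N * (w - z)) by ring.
have -> : 8 * L * (abs (w - z) / (s / 2)) ^+ 4 = abs (w - z) ^+ 2 * (K * abs (w - z) ^+ 2).
  by rewrite /K; field; rewrite gt_eqF.
rewrite absM absX.
rewrite ler_pM2l ?exprn_gt0 // => /le_trans; apply.
rewrite expr2 mulrA ler_wpM2r ?abs_ge0 //.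
move: w2; rewrite ltr_pdivlMr // mulrDr mulr1 => /ltW.
by apply: le_trans; rewrite mulrC lerDl abs_ge0.
Qed.

End TaylorConsequences.

(** * Compactness, connectedness and limits *)

Section Compactness.
Variable R : realType.
Local Notation C := R[i].
Implicit Types (f g : C -> C) (x y r : R) (z w h : C) (A B : C -> Prop).

Lemma near_rect z (P : C -> Prop) : nearc z P -> exists2 e : R, 0 < e &
  forall a b c d : R, a <= Re z <= b -> c <= Im z <= d -> b - a < e -> d - c < e ->
  forall x y, a <= x <= b -> c <= y <= d -> P (x +i* y).
Proof.
move=> [e e0 H]; exists (e / 2); first by rewrite divr_gt0.
move=> a b c d /andP[h1 h2] /andP[h3 h4] ab cd x y /andP[x1 x2] /andP[y1 y2]; apply: H.
apply: le_lt_trans (abs_le_ReIm _) _; rewrite cReD cReN cImD cImN /=.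
have e1 : `|x - Re z| <= b - a by rewrite ler_norml; move: h1 h2 x1 x2; clear => *; apply/andP; split; lra.
have e2 : `|y - Im z| <= d - c by rewrite ler_norml; move: h3 h4 y1 y2; clear => *; apply/andP; split; lra.
by move: e1 e2 ab cd; clear; lra.
Qed.

Lemma in_half (a b x : R) : a <= x <= b -> a <= x <= (a + b) / 2 \/ (a + b) / 2 <= x <= b.
Proof. by move=> /andP[h1 h2]; have [h|/ltW h] := leP x ((a + b) / 2); [left|right]; apply/andP. Qed.

(** The Heine-Borel theorem as an induction on sets: a property that passes to subsets and to unions
    of two sets, and holds for some neighbourhood of each point, holds for discs. This replaces
    finite subcovers in all later uniform bounds. *)
Lemma compact_ind (Q : (C -> Prop) -> Prop) r :
  (forall A B, (forall z, A z -> B z) -> Q B -> Q A) ->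
  (forall A B, Q A -> Q B -> Q (fun z => A z \/ B z)) ->
  (forall z, exists2 A, nearc z A & Q A) -> Q (fun z => abs z <= r).
Proof.
move=> mono union loc.
have [r0|r0] := leP 0 r; last first.
  have [A _ QA] := loc 0; apply: mono QA => z zr.
  by have := le_trans (abs_ge0 z) zr; rewrite leNgt r0.
pose box (a b c d : R) z := a <= Re z <= b /\ c <= Im z <= d.
have rr : - r <= r by move: r0; clear; lra.
suff H : Q (box (- r) r (- r) r).
  apply: mono H => z zr; split; rewrite -ler_norml; apply: le_trans zr; [exact: abs_Re|exact: abs_Im].
apply: (rect_ind (P := fun a b c d => Q (box a b c d))) => // [a b c d _ _ _ _ _ _ q1 q2 q3 q4|x y _ _].
  apply: mono (union _ _ (union _ _ q1 q2) (union _ _ q3 q4)) => z [/in_half[h1|h1] /in_half[h2|h2]].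
  - by left; left. - by right; left. - by left; right. - by right; right.
have [A nA QA] := loc (x +i* y); have [e e0 He] := near_rect nA.
exists e => // a b c d _ xab _ _ ycd _ ab cd; apply: mono QA => -[u v] [/= hu hv].
exact: (He a b c d).
Qed.

Lemma locally_bounded (S : C -> R) r : (forall z, exists M, nearc z (fun w => S w <= M)) ->
  exists M, forall z, abs z <= r -> S z <= M.
Proof.
move=> loc; apply: (compact_ind (Q := fun A => exists M, forall z, A z -> S z <= M)).
- by move=> A B AB [M H]; exists M => z /AB /H.
- move=> A B [M H] [N K]; exists (Num.max M N) => z.
  by rewrite le_max; case=> [/H|/K] ->; rewrite ?orbT.
- by move=> z; have [M H] := loc z; exists (fun w => S w <= M) => //; exists M.
Qed.

(** [compact_ind] is applied to the sets that the sequence eventually leaves. *)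
Lemma cluster_point (d : nat -> C) (M : R) : (forall n, abs (d n) <= M) ->
  exists z, forall e : R, 0 < e -> forall N, exists2 n, (N <= n)%N & abs (d n - z) < e.
Proof.
move=> dM; apply: contrapT => H.
suff [N HN] : exists N, forall n, (N <= n)%N -> ~ (abs (d n) <= M) by apply: (HN N).
apply: (compact_ind (Q := fun A => exists N, forall n, (N <= n)%N -> ~ A (d n))).
- by move=> A B AB [N K]; exists N => n /K nB /AB.
- move=> A B [N K] [N' K']; exists (maxn N N') => n; rewrite geq_max => /andP[/K h1 /K' h2].
  by case.
- move=> z; apply: contrapT => K; apply: H; exists z => e e0 N; apply: contrapT => L.
  apply: K; exists (fun w => abs (w - z) < e); first by exists e.
  by exists N => n Nn h; apply: L; exists n.
Qed.

(** Connectedness by bisection: on small rectangles [P] holds everywhere or nowhere, and the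
    alternatives on adjacent quarters agree because the quarters share an edge. *)
Lemma clopen_all (P : C -> Prop) : (forall z, nearc z P \/ nearc z (fun w => ~ P w)) ->
  forall z0, P z0 -> forall z, P z.
Proof.
move=> loc z0 P0 z1; pose r := abs z0 + abs z1.
have a0 := abs_ge0 z0; have a1 := abs_ge0 z1.
have rr : - r <= r by rewrite /r; move: a0 a1; clear; lra.
pose T (a b c d : R) := (forall x y, a <= x <= b -> c <= y <= d -> P (x +i* y)) \/
   (forall x y, a <= x <= b -> c <= y <= d -> ~ P (x +i* y)).
have TT : T (- r) r (- r) r.
  apply: rect_ind => // [a b c d _ ab _ _ cd _|x y _ _].
    have [m1 m2 _ _] := half_facts ab; have [k1 k2 _ _] := half_facts cd.
    have am : a <= (a + b) / 2 <= (a + b) / 2 by rewrite m1 lexx.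
    have mb : (a + b) / 2 <= (a + b) / 2 <= b by rewrite m2 lexx.
    have ck : c <= (c + d) / 2 <= (c + d) / 2 by rewrite k1 lexx.
    have kd : (c + d) / 2 <= (c + d) / 2 <= d by rewrite k2 lexx.
    move=> [q1|q1] [q2|q2] [q3|q3] [q4|q4]; try by
      [case: (q1 _ _ am ck); exact: q2|case: (q2 _ _ mb ck); exact: q1
      |case: (q1 _ _ am ck); exact: q3|case: (q3 _ _ am kd); exact: q1
      |case: (q1 _ _ am ck); exact: q4|case: (q4 _ _ mb kd); exact: q1].
      by left=> x y /in_half[hx|hx] /in_half[hy|hy]; [exact: q1|exact: q3|exact: q2|exact: q4].
    by right=> x y /in_half[hx|hx] /in_half[hy|hy]; [exact: q1|exact: q3|exact: q2|exact: q4].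
  have [/near_rect[e e0 H]|/near_rect[e e0 H]] := loc (x +i* y); exists e => // a b c d _ xab _ _ ycd _ ab cd.
    by left; exact: (H a b c d).
  by right; exact: (H a b c d).
have inr z : abs z <= r -> - r <= Re z <= r /\ - r <= Im z <= r.
  by rewrite -!ler_norml => h; split; apply: le_trans h; [exact: abs_Re|exact: abs_Im].
have [i1 i2] := inr z0 (ler_wpDr a1 (lexx _)).
have [j1 j2] := inr z1 (ler_wpDl a0 (lexx _)).
have ez z : Re z +i* Im z = z by case: z.
case: TT => [H|H]; first by have := H _ _ j1 j2; rewrite ez.
by case: (H _ _ i1 i2); rewrite ez.
Qed.

Lemma near_other z (P : C -> Prop) : nearc z P -> exists2 w, w != z & P w.
Proof.
move=> [e e0 H]; exists (z + (e / 2)%:C).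
  rewrite addrC -subr_eq0 addrK eq_complex /= negb_and gt_eqF //; by rewrite divr_gt0.
by apply: H; rewrite addrC addKr absC ger0_norm; move: e0; clear; lra.
Qed.

(** The abstract identity theorem. The set of points near which [E] holds is open, and by the local
    alternative so is its complement. *)
Lemma dichotomy_global (E : C -> Prop) :
  (forall z, nearc z E \/ nearc z (fun w => w != z -> ~ E w)) ->
  (forall z, E z) \/ (forall z, nearc z (fun w => w != z -> ~ E w)).
Proof.
move=> loc; have [[z0 H0]|H] := pselect (exists z, nearc z E); last first.
  by right => z; case: (loc z) => // h; case: H; exists z.
left=> z; apply: nearc_id; move: z; apply: (@clopen_all (fun z => nearc z E)) H0 => z.
case: (loc z) => [/nearc_near|H]; [by left|right].
have nz : ~ nearc z E.
  by move=> K; have [w wz [Ew /(_ wz)]] := near_other (nearc_and K H).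
apply: nearcW (nearc_near H) => w K nE.
have [wz|wz] := eqVneq w z; first by rewrite wz in nE.
have cs : cont_at (fun t => t - z) w by apply: contD; [exact: cont_id|exact: cont_cst].
have nwz : nearc w (fun t => t != z).
  by apply: nearcW (nearc_neq0 cs _) => [t|]; rewrite subr_eq0.
have := nearc_id (nearc_and nE (nearc_and K nwz)) => -[Ew [/(_ wz)]]; tauto.
Qed.

(** The segment from [z] to [w] is cut into [n] steps. Since the derivative vanishes, each step
    changes [f] by at most [L |w - z|^2 / n^2], so the total change is [O(1 / n)]. *)
Lemma deriv0_cst f z : nearc z (fun w => cderiv f w 0) -> nearc z (fun w => f w = f z).
Proof.
move=> df0; have [|r r0 [M H]] := @bounded_near _ f z.
  by apply: nearcW df0 => w; exists 0.
have [s s0 Hs] := nearc_and df0 (ex_intro2 _ _ r r0 H).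
have s2 : 0 < s / 2 by rewrite divr_gt0.
have M0 : 0 <= M.
  by have [|_] := H z; [rewrite subrr abs0|apply: le_trans; exact: abs_ge0].
pose L := 32 * M / (s / 2) ^+ 2.
have L0 : 0 <= L by rewrite divr_ge0 ?mulr_ge0 ?exprn_ge0 ?divr_ge0 // ltW.
have step w h : abs (w - z) <= s / 8 -> abs h <= s / 8 -> abs (f (w + h) - f w) <= L * abs h ^+ 2.
  move=> wz hs; have [|a T] := @taylor _ f w (s / 2) M s2.
    move=> u uw; suff /Hs[] : abs (u - z) < s by [].
    by apply: le_lt_trans (abs_subD u w z) _; move: uw wz s0; clear; lra.
  have d0 : cderiv f w 0 by apply: (Hs _ _).1; apply: le_lt_trans wz _; move: s0; clear; lra.
  have hs' : abs h <= s / 2 / 4 by move: hs; clear; lra.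
  have := tayl_quad s2 T hs'; rewrite (cderiv_uniq (tayl_cderiv s2 T) d0) mul0r subr0.
  exact.
exists (s / 8); first by rewrite divr_gt0.
move=> w /ltW wz; apply/eqP; rewrite -subr_eq0 -abs_eq0 eq_le abs_ge0 andbT.
apply/ler_addgt0Pl => e e0; rewrite addr0.
pose D := L * abs (w - z) ^+ 2; have D0 : 0 <= D by rewrite mulr_ge0 ?exprn_ge0 ?abs_ge0.
pose n := (Num.bound (D / e)).+1; have n0 : 0 < n%:R :> R by rewrite ltr0n.
pose h := (w - z) / n%:R.
have hE : abs h = abs (w - z) / n%:R by rewrite absM absV absn.
have wnz := abs_ge0 (w - z).
have jump (j : nat) : (j <= n)%N -> abs (f (z + j%:R * h) - f z) <= j%:R * (L * abs h ^+ 2).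
  elim: j => [|j IH] jn; first by rewrite !mul0r addr0 subrr abs0.
  have jle : j%:R <= n%:R :> R by rewrite ler_nat ltnW.
  have -> : f (z + j.+1%:R * h) - f z = (f (z + j%:R * h + h) - f (z + j%:R * h)) + (f (z + j%:R * h) - f z).
    have -> : z + j.+1%:R * h = z + j%:R * h + h by rewrite -natr1; ring.
    by ring.
  apply: le_trans (absD _ _) _; rewrite -natr1 [X in _ <= X]mulrDl mul1r addrC lerD ?IH ?(ltnW jn) //.
  apply: step.
    rewrite (addrC z) addrK absM absn hE; apply: le_trans wz.
    rewrite mulrA ler_pdivrMr // mulrC ler_wpM2l //.
  rewrite hE; apply: le_trans wz; rewrite ler_pdivrMr // ler_peMr // ler1n //.
have := jump n (leqnn n).
have -> : z + n%:R * h = w.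
  by rewrite /h mulrC divfK ?(addrC z) ?subrK // pnatr_eq0.
move=> /le_trans; apply; rewrite hE.
have -> : n%:R * (L * (abs (w - z) / n%:R) ^+ 2) = D / n%:R.
  by rewrite /D; field; rewrite gt_eqF.
rewrite ler_pdivrMr // mulrC -ler_pdivrMr //; apply: ltW.
have De : 0 <= D / e by rewrite divr_ge0 // ltW.
apply: lt_trans (archi_boundP De) _; by rewrite ltr_nat.
Qed.

(** The derivatives of the [f n] at [z] are bounded by Cauchy's estimate, so they have a cluster
    point along a subsequence. It is the derivative of [g], because the quadratic remainder estimate
    is uniform in [n] and passes to the limit. *)
Lemma unif_lim (f : nat -> C -> C) g z r (M : R) : 0 < r ->
  (forall n w, abs (w - z) < r -> diffc (f n) w /\ abs (f n w) <= M) ->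
  (forall e : R, 0 < e -> forall N, exists2 n, (N <= n)%N & forall w, abs (w - z) < r -> abs (f n w - g w) <= e) ->
  diffc g z.
Proof.
move=> r0 H lim.
have M0 : 0 <= M.
  by have [|_] := H 0%N z; [rewrite subrr abs0|apply: le_trans; exact: abs_ge0].
have quad n h : abs h <= r / 4 ->
    abs (f n (z + h) - f n z - Dc (f n) z * h) <= 32 * M / r ^+ 2 * abs h ^+ 2.
  have [a T] := taylor r0 (H n) => hr.
  by rewrite (DcE (tayl_cderiv r0 T)); exact: tayl_quad.
have sub e : 0 < e -> exists n, forall w, abs (w - z) < r -> abs (f n w - g w) <= e.
  by move=> /lim /(_ 0%N) [n _ Hn]; exists n.
pose inv (n : nat) : R := n.+1%:R^-1.
have inv0 n : 0 < inv n by rewrite invr_gt0 ltr0n.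
have [k Hk] := choice (fun n => sub (inv n) (inv0 n)).
have [|d Hd] := @cluster_point (fun n => Dc (f (k n)) z) (24 * M / r).
  by move=> n; exact: cauchy_est r0 (H _).
exists d; apply/cderivP => e e0.
pose K := 32 * M / r ^+ 2.
have K0 : 0 <= K by rewrite divr_ge0 ?mulr_ge0 ?exprn_ge0 // ltW.
have K1 : 0 < K + 1 by rewrite ltr_wpDl.
exists (Num.min (r / 4) (e / (K + 1))); first by rewrite lt_min !divr_gt0.
move=> w; rewrite lt_min => /andP[w1 w2]; set u := w - z.
have uE : z + u = w by rewrite /u (addrC z) subrK.
have main : abs (g w - g z - d * u) <= K * abs u ^+ 2.
  apply/ler_addgt0Pl => t t0; have u0 := abs_ge0 u.
  (* The errors add up to [s + s + s |u| = t - s]. *)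
  pose s := t / (3 + abs u); have s0 : 0 < s by rewrite divr_gt0 // ltr_wpDr.
  have [n Nn dn] := Hd s s0 (Num.bound s^-1).
  have ns : inv n <= s.
    rewrite /inv -[s]invrK lef_pV2 ?posrE ?invr_gt0 ?ltr0n //.
    have si : 0 <= s^-1 by rewrite invr_ge0 ltW.
    apply: ltW; apply: lt_le_trans (archi_boundP si) _; by rewrite ler_nat (leq_trans Nn).
  have zr : abs (z - z) < r by rewrite subrr abs0.
  have wr : abs (w - z) < r by move: w1 r0; clear; lra.
  have h1 := le_trans (Hk n w wr) ns; have h2 := le_trans (Hk n z zr) ns.
  have h3 := quad (k n) u (ltW w1); rewrite uE -/K in h3.
  have -> : g w - g z - d * u = (f (k n) w - f (k n) z - Dc (f (k n)) z * u)
     + (- (f (k n) w - g w) + ((f (k n) z - g z) + (Dc (f (k n)) z - d) * u)) by ring.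
  apply: le_trans (absD _ _) _; rewrite addrC lerD //.
  apply: le_trans (absD _ _) _; rewrite absN.
  apply: le_trans (lerD h1 (absD _ _)) _; rewrite absM.
  apply: le_trans (lerD (lexx _) (lerD h2 (ler_wpM2r u0 (ltW dn)))) _.
  have -> : s + (s + s * abs u) = t - s.
    by rewrite /s; field; rewrite gt_eqF // ltr_wpDr.
  by move: s0; clear; lra.
apply: le_trans main _; rewrite expr2 mulrA ler_wpM2r ?abs_ge0 //.
move: w2; rewrite -/u ltr_pdivlMr // mulrDr mulr1 => /ltW.
by apply: le_trans; rewrite mulrC lerDl abs_ge0.
Qed.

End Compactness.

(** * Rational maps in homogeneous coordinates *)

Section Lifts.
Variable R : realType.
Local Notation C := R[i].
Implicit Types (f g : C -> CP1 R) (a b c d : C -> C) (z w x y : C).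

Definition pt x y : CP1 R := if y == 0 then None else Some (x / y).

Lemma pt_eq x y z w : (x != 0) || (y != 0) -> (z != 0) || (w != 0) ->
  pt x y = pt z w <-> x * w = y * z.
Proof.
rewrite /pt; case: (eqVneq y 0) => [->|y0]; case: (eqVneq w 0) => [->|w0]; rewrite ?orbF.
- by rewrite mulr0 mul0r.
- by move=> x0 _; split=> // /eqP; rewrite mul0r mulf_eq0 (negbTE x0) (negbTE w0).
- by move=> _ z0; split=> // /esym/eqP; rewrite mulr0 mulf_eq0 (negbTE y0) (negbTE z0).
move=> _ _; split=> [[]/eqP|E].
  by rewrite eqr_div // => /eqP ->; rewrite mulrC.
by congr Some; apply/eqP; rewrite eqr_div // E mulrC.
Qed.

Lemma pt_scale (k : C) x y : k != 0 -> pt (k * x) (k * y) = pt x y.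
Proof.
move=> k0; rewrite /pt mulf_eq0 (negbTE k0) /=; case: eqVneq => // y0.
by congr Some; field; rewrite k0 y0.
Qed.

Definition coords (s : CP1 R) : C * C := if s is Some x then (x, 1) else (1, 0).

Lemma coordsP (s : CP1 R) : (((coords s).1 != 0) || ((coords s).2 != 0)) /\ s = pt (coords s).1 (coords s).2.
Proof.
case: s => [x|] /=; rewrite /pt ?eqxx ?oner_eq0 ?orbT ?divr1 //.
Qed.

Definition lift f z a b := nearc z (fun w =>
  [/\ diffc a w, diffc b w, (a w != 0) || (b w != 0) & f w = pt (a w) (b w)]).

(** Infinity is treated like any other point, and the constant function infinity is included, which
    [meromorphic] excludes. For nonconstant functions the two notions agree by [mero_lift] and
    [lift_mero]. *)
Definition liftable f := forall z, exists a b, lift f z a b.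

Lemma hol_nearc (h : C -> C) z : holomorphic_at h z <-> nearc z (diffc h).
Proof.
rewrite /holomorphic_at; split=> [/nearcE|H]; first by apply: nearcW => w /derivableE.
by apply/nearcE; apply: nearcW H => w /derivableE.
Qed.

Lemma mero_lift f : meromorphic f -> liftable f.
Proof.
move=> mf z; case: (mf z) => [[h /hol_nearc dh /nearcE fh]|[fz [h [/hol_nearc dh hz /dnearcE fh]]]].
  exists h, (fun=> 1); apply: nearcW (nearc_and dh fh) => w [dw fw]; split=> //.
  - exact: diffc_cst.
  - by rewrite oner_eq0 orbT.
  - by rewrite /pt oner_eq0 divr1.
exists (fun=> 1), h; apply: nearcW (nearc_and dh fh) => w [dw fw]; split=> //.
- exact: diffc_cst.
- by rewrite oner_eq0.
rewrite /pt; have [->|wz] := eqVneq w z; first by rewrite hz eqxx.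
by have [hw ->] := fw wz; rewrite (negbTE hw) div1r.
Qed.

Lemma liftable_cst (s : CP1 R) : liftable (fun=> s).
Proof.
move=> z; exists (fun=> (coords s).1), (fun=> (coords s).2); apply: nearc_all => w.
by have [h1 h2] := coordsP s; split => //; exact: diffc_cst.
Qed.

(** The determinant of local lifts is holomorphic and vanishes exactly where [f = g]. *)
Lemma liftable_eq f g : liftable f -> liftable g ->
  (forall z, f z = g z) \/ (forall z, nearc z (fun w => w != z -> f w <> g w)).
Proof.
move=> lf lg; apply: dichotomy_global => z.
have [a [b fab]] := lf z; have [c [d gcd]] := lg z; have L := nearc_and fab gcd.
have [|H|H] := @isolated_zeros _ (fun w => a w * d w - b w * c w) z.
- apply: nearcW L => w [[da db _ _] [dc dd _ _]].
  by apply: diffcB; exact: diffcM.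
- left; apply: nearcW (nearc_and L H) => w [[[_ _ ab ->] [_ _ cd ->]] /eqP].
  by rewrite subr_eq0 => /eqP E; apply/pt_eq.
right; apply: nearcW (nearc_and L H) => w [[[_ _ ab ->] [_ _ cd ->]] h] /h /eqP h' /pt_eq E.
by apply: h'; rewrite E ?subrr.
Qed.

Lemma level_discrete f (s : CP1 R) : liftable f -> nonconstant f ->
  forall z, nearc z (fun w => w != z -> f w <> s).
Proof.
move=> lf [z [w nfzw]]; have [H|//] := liftable_eq lf (liftable_cst s).
by case: nfzw; rewrite !H.
Qed.

(** Nonconstancy makes the points over infinity isolated, as the definition of a pole demands. *)
Lemma lift_mero f : liftable f -> nonconstant f -> meromorphic f.
Proof.
move=> lf nf z; have [a [b L]] := lf z.
have [da db ab fz] := nearc_id L.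
have db' : nearc z (diffc b) by apply: nearcW L => w [].
have da' : nearc z (diffc a) by apply: nearcW L => w [].
have [bz|bz] := eqVneq (b z) 0.
  right; rewrite /pole_at fz /pt bz eqxx; split=> //.
  have az : a z != 0 by move: ab; rewrite bz eqxx orbF.
  have an := nearc_neq0 (diffc_cont da) az.
  exists (fun w => b w * (a w)^-1); split; last 1 first.
  - apply/dnearcE; apply: nearcW (nearc_and L (nearc_and an (level_discrete None lf nf z))) => w.
    move=> [[_ _ _ fw] [aw H]] /H; rewrite fw /pt; case: eqVneq => // bw _.
    by rewrite mulf_neq0 ?invr_eq0 // invf_div.
  - apply/hol_nearc; apply: nearcW (nearc_and L an) => w [[daw dbw _ _] aw].
    by apply: diffcM => //; exact: diffcV.
  - by rewrite bz mul0r.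
left; have bn := nearc_neq0 (diffc_cont db) bz.
exists (fun w => a w * (b w)^-1).
  apply/hol_nearc; apply: nearcW (nearc_and L bn) => w [[daw dbw _ _] bw].
  by apply: diffcM => //; exact: diffcV.
by apply/nearcE; apply: nearcW (nearc_and L bn) => w [[_ _ _ ->] bw]; rewrite /pt (negbTE bw).
Qed.

(* Homogenization of [p] as a form of degree [n]; coefficients of index above [n] are ignored. *)
Definition hev (p : {poly C}) n x y := \sum_(i < n.+1) p`_i * x ^+ i * y ^+ (n - i).

Lemma hev_affine (p : {poly C}) n x y : (size p <= n.+1)%N -> y != 0 ->
  hev p n x y = y ^+ n * p.[x / y].
Proof.
move=> sp y0; rewrite (horner_coef_wide _ sp) /hev mulr_sumr; apply: eq_bigr => i _.
have le_i : (i <= n)%N by rewrite -ltnS ltn_ord.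
have -> : y ^+ n = y ^+ (n - i) * y ^+ i by rewrite -exprD subnK.
rewrite expr_div_n.
have := expf_neq0 i y0; move: (y ^+ i) => u u0; field; exact: u0.
Qed.

Lemma hev1 (p : {poly C}) n x : (size p <= n.+1)%N -> hev p n x 1 = p.[x].
Proof. by move=> sp; rewrite hev_affine ?oner_eq0 // expr1n mul1r divr1. Qed.

Lemma hev_inf (p : {poly C}) n x : hev p n x 0 = p`_n * x ^+ n.
Proof.
rewrite /hev big_ord_recr big1 /= ?add0r ?subnn ?expr0 ?mulr1 // => i _.
by rewrite expr0n subn_eq0 leqNgt ltn_ord mulr0.
Qed.

Lemma hev_scale (p : {poly C}) n (k : C) x y : hev p n (k * x) (k * y) = k ^+ n * hev p n x y.
Proof.
rewrite /hev mulr_sumr; apply: eq_bigr => i _.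
have le_i : (i <= n)%N by rewrite -ltnS ltn_ord.
have -> : k ^+ n = k ^+ (n - i) * k ^+ i by rewrite -exprD subnK.
by rewrite !exprMn; ring.
Qed.

Variable P : ratfun R.
Let n := ratdeg P.
Let p := ratnum P.
Let q := ratden P.

Lemma ratdegE : n.+1 = maxn (size p) (size q).
Proof.
rewrite /n /ratdeg prednK // leq_max orbC size_poly_gt0.
by rewrite (ratden_neq0 P).
Qed.

Lemma size_num : (size p <= n.+1)%N. Proof. by rewrite ratdegE leq_maxl. Qed.
Lemma size_den : (size q <= n.+1)%N. Proof. by rewrite ratdegE leq_maxr. Qed.

Lemma lead_neq0 : (p`_n != 0) || (q`_n != 0).
Proof.
have [|] := leqP (size p) (size q) => h.
  have : n.+1 = size q by rewrite ratdegE; apply/maxn_idPr.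
  move=> E; have := ratden_neq0 P; rewrite -lead_coef_eq0 lead_coefE -/q -E => ->.
  by rewrite orbT.
have E : n.+1 = size p by rewrite ratdegE; apply/maxn_idPl/ltnW.
have : p != 0 by rewrite -size_poly_gt0 -E.
by rewrite -lead_coef_eq0 lead_coefE -E => ->.
Qed.

Lemma horner_neq0 x : (p.[x] != 0) || (q.[x] != 0).
Proof.
have := coprimep_root (rat_coprime P) (_ : root _ x); rewrite -/p -/q /root.
by case: eqVneq => // _ /(_ isT) ->.
Qed.

Lemma hev_neq0 x y : (x != 0) || (y != 0) -> (hev p n x y != 0) || (hev q n x y != 0).
Proof.
have [->|y0 _] := eqVneq y 0.
  by rewrite orbF => x0; rewrite !hev_inf !mulf_eq0 (negbTE (expf_neq0 _ x0)) !orbF lead_neq0.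
rewrite !hev_affine ?size_num ?size_den // !mulf_eq0 (negbTE (expf_neq0 _ y0)) /=.
exact: horner_neq0.
Qed.

Lemma ratmap_pt x y : (x != 0) || (y != 0) -> ratmap P (pt x y) = pt (hev p n x y) (hev q n x y).
Proof.
rewrite {1}/pt; have [->|y0 _] := eqVneq y 0.
  rewrite orbF => x0; rewrite !hev_inf /ratmap -/n -/p -/q.
  by rewrite -[LHS](pt_scale _ _ (expf_neq0 n x0)) !(mulrC (x ^+ n)).
rewrite /ratmap -/p -/q !hev_affine ?size_num ?size_den // pt_scale //.
exact: expf_neq0.
Qed.

Lemma ratmap_eq x y z w : (x != 0) || (y != 0) -> (z != 0) || (w != 0) ->
  ratmap P (pt x y) = ratmap P (pt z w) <->
  hev p n x y * hev q n z w = hev q n x y * hev p n z w.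
Proof. by move=> xy zw; rewrite !ratmap_pt //; apply: pt_eq; exact: hev_neq0. Qed.

End Lifts.

(** * Multiplicities in the fibres *)

Section Multiplicities.
Variable R : realType.
Local Notation C := R[i].
Implicit Types (N p q : {poly C}) (x y : CP1 R) (n k : nat) (u v : C).

Lemma card_seq (T : eqType) (l : seq T) : uniq l -> [set x | x \in l] #= `I_(size l).
Proof.
case: l => [|x0 l] ul.
  by rewrite (_ : [set x | _] = set0) ?II0 //; apply/seteqP; split.
set s := x0 :: l; have -> : [set x | x \in s] = nth x0 s @` `I_(size s).
  apply/seteqP; split=> [x xs|_ [i ilt <-]]; last exact: mem_nth.
  have xs' : x \in s := xs; exists (index x s); last by rewrite nth_index.
  by have : (index x s < size s)%N by rewrite index_mem.
apply: inj_card_eq => i j; rewrite !inE /= => il jl /eqP.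
by rewrite nth_uniq // => /eqP.
Qed.

(** The surplus copies of two distinct elements are removed independently. *)
Lemma size_undup_count (T : eqType) (l : seq T) (x y : T) : x != y ->
  (size (undup l) + (count_mem x l).-1 + (count_mem y l).-1 <= size l)%N.
Proof.
move=> xy; elim: l => //= h t IH; case: ifP => ht.
  have : ~~ ((h == x) && (h == y)).
    by apply: contra xy => /andP[/eqP <- /eqP <-].
  by case: (h == x); case: (h == y) => //=; lia.
have c0 z : h == z -> count_mem z t = 0%N.
  by move=> /eqP <-; apply/count_memPn; rewrite ht.
move: (c0 x) (c0 y); case: (h == x); case: (h == y) => //= cx cy; lia.
Qed.

Lemma size_undup_count1 (T : eqType) (l : seq T) (x : T) :
  (size (undup l) + (count_mem x l).-1 <= size l)%N.
Proof.
elim: l => //= h t IH; case: ifP => ht; first by case: (h == x) => //=; lia.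
have c0 z : h == z -> count_mem z t = 0%N.
  by move=> /eqP <-; apply/count_memPn; rewrite ht.
move: (c0 x); case: (h == x) => //= cx; lia.
Qed.

Definition proots N : seq C := sval (closed_field_poly_normal N).

Lemma prootsE N : N = lead_coef N *: \prod_(z <- proots N) ('X - z%:P).
Proof. exact: svalP (closed_field_poly_normal N). Qed.

Lemma size_proots N : N != 0 -> size N = (size (proots N)).+1.
Proof. by move=> N0; rewrite {1}(prootsE N) size_scale ?lead_coef_eq0 // size_prod_XsubC. Qed.

Lemma mem_proots N (a : C) : N != 0 -> (a \in proots N) = (N.[a] == 0).
Proof.
move=> N0; rewrite -root_prod_XsubC [in RHS](prootsE N).
by rewrite hornerZ mulf_eq0 lead_coef_eq0 (negbTE N0).
Qed.

Lemma mup_proots N (a : C) : N != 0 -> mup a N = count_mem a (proots N).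
Proof.
move=> N0; rewrite {1}(prootsE N) -mul_polyC mupMr; last by rewrite rootC lead_coef_eq0.
elim: (proots N) => [|z s IH] /=.
  by rewrite big_nil mupNroot // -[1]/(1%:P) rootC oner_neq0.
rewrite big_cons mupM ?IH ?polyXsubC_eq0 //; last first.
  by rewrite prodf_seq_neq0; apply/allP => w _ /=; rewrite polyXsubC_eq0.
by rewrite -['X - z%:P]expr1 mup_XsubCX; case: eqP.
Qed.

(* Roots of the degree [n] form with dehomogenization [N], with multiplicity. *)
Definition extroots N n : seq (CP1 R) :=
  map Some (proots N) ++ nseq (n - size (proots N)) None.

(** At infinity the multiplicity of the form of degree [n] is the amount by which the degree of [N]
    falls short of [n]. *)
Definition mult_ge N n x k : bool :=
  if x is Some a then ('X - a%:P) ^+ k %| N else (size N + k <= n.+1)%N.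

Lemma mult_count N n x k : N != 0 -> (size N <= n.+1)%N -> mult_ge N n x k ->
  (k <= count_mem x (extroots N n))%N.
Proof.
move=> N0 sN; rewrite /extroots count_cat; case: x => [a|] /=.
  move=> h; have -> : count_mem (Some a) (map Some (proots N)) = count_mem a (proots N).
    by rewrite count_map; apply: eq_count => z /=.
  by rewrite -(mup_proots _ N0); apply: leq_trans (leq_addr _ _); rewrite mup_geq.
rewrite size_proots // => h; rewrite count_nseq /= mul1n.
by apply: leq_trans (leq_addl _ _); lia.
Qed.

Lemma dvdp_deriv2 N (a : C) : N.[a] = 0 -> N^`().[a] = 0 -> ('X - a%:P) ^+ 2 %| N.
Proof.
move=> /eqP/factor_theorem [N1 ->]; rewrite derivM derivXsubC mulr1 hornerD hornerM !hornerXsubC subrr mulr0 add0r.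
by move=> /eqP/factor_theorem [N2 ->]; rewrite -mulrA -expr2 dvdp_mull.
Qed.

Lemma dvdp_deriv3 N (a : C) : N.[a] = 0 -> N^`().[a] = 0 -> N^`()^`().[a] = 0 ->
  ('X - a%:P) ^+ 3 %| N.
Proof.
move=> n0 n1; have := dvdp_deriv2 n0 n1 => /dvdpP [M ->].
have -> : (M * ('X - a%:P) ^+ 2)^`()^`() = 2 *: M + ('X - a%:P) * (4 *: M^`() + ('X - a%:P) * M^`()^`()).
  rewrite !(derivM, derivXn, derivD, derivMn, derivX, derivC, derivB, derivXsubC, derivN, expr2) -!mul_polyC.
  by rewrite -[4%:P]/(4%:R%:P) -[2%:P]/(2%:R%:P) !polyC_natr; ring.
rewrite hornerD hornerM hornerXsubC subrr mul0r addr0 hornerZ => /eqP.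
rewrite mulf_eq0 pnatr_eq0 /= => /factor_theorem [K ->].
by rewrite -mulrA -exprS dvdp_mull.
Qed.

Variable P : ratfun R.
Hypothesis simpleP : forall s, critical_value P s -> simple_critical_value P s.
Let n := ratdeg P.
Let p := ratnum P.
Let q := ratden P.
Hypothesis n_gt0 : (0 < n)%N.

(** The associated form of degree [n] vanishes exactly on the fibre over [[u : v]], see
    [ratmap_pencil]. *)
Definition pencil (u v : C) : {poly C} := v *: p - u *: q.

Lemma size_pencil u v : (size (pencil u v) <= n.+1)%N.
Proof.
apply: leq_trans (size_polyD _ _) _; rewrite size_polyN geq_max.
by rewrite !(leq_trans (size_scale_leq _ _)) ?size_num ?size_den.
Qed.

(** Otherwise numerator and denominator, being coprime, would be proportional constants, and the
    degree would be 0. *)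
Lemma pencil_neq0 u v : (u != 0) || (v != 0) -> pencil u v != 0.
Proof.
move=> uv; apply: contraTneq n_gt0 => E.
have {}E : v *: p = u *: q by apply/eqP; rewrite -subr_eq0 -[_ - _]/(pencil u v) E.
have cop : coprimep p q := rat_coprime P.
have q0 : q != 0 := ratden_neq0 P.
have [v0|v0] := eqVneq v 0.
  by move: E uv; rewrite v0 scale0r eqxx orbF => /esym/eqP; rewrite scaler_eq0 (negbTE q0) orbF => ->.
have pE : p = (u / v) *: q by rewrite mulrC -scalerA -E scalerA mulVf // scale1r.
have sq : size q = 1%N.
  have [c0|c0] := eqVneq (u / v) 0.
    by move: cop; rewrite pE c0 scale0r coprime0p => /eqp_size; rewrite size_poly1.
  by move: cop; rewrite pE coprimepZl // coprimepp => /eqP.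
have := ratdegE P; rewrite -/n -/p -/q pE sq => nE.
have := size_scale_leq (u / v) q; rewrite sq => /maxn_idPr m1.
by move: nE; rewrite m1 => -[->].
Qed.

Lemma ratmap_pencil x u v : (u != 0) || (v != 0) ->
  ratmap P x = pt u v <-> x \in extroots (pencil u v) n.
Proof.
move=> uv; have N0 := pencil_neq0 uv; have sN := size_pencil u v.
rewrite /extroots mem_cat; have [x12 {1}->] := coordsP x.
rewrite ratmap_pt // pt_eq //; last exact: hev_neq0.
rewrite -/n -/p -/q; case: x x12 => [a|] /= _.
  rewrite !hev1 ?size_num ?size_den // mem_map; last by move=> ? ? [].
  rewrite mem_proots // /pencil hornerD hornerN !hornerZ mem_nseq andbF orbF subr_eq0.
  by rewrite mulrC [q.[a] * u]mulrC; split=> /eqP.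
rewrite !hev_inf !expr1n !mulr1 (_ : None \in map Some _ = false); last by apply/mapP => -[].
rewrite mem_nseq eqxx andbT /= subn_gt0 -ltnS -(size_proots N0).
have -> : (p`_n * v = q`_n * u) <-> (pencil u v)`_n == 0.
  rewrite /pencil coefB !coefZ subr_eq0 mulrC [q`_n * u]mulrC; by split=> [->|/eqP]; rewrite ?eqxx.
split=> [Nn|h]; last by rewrite nth_default.
rewrite ltn_neqAle sN andbT; apply: contraTneq Nn => E.
by rewrite -[n]/(n.+1.-1) -E -lead_coefE lead_coef_eq0.
Qed.

(** With fewer than [n - 1] distinct roots, [[u : v]] would be a critical value that is not
    simple. *)
Lemma simple_extroots u v : (u != 0) || (v != 0) ->
  (n <= (size (undup (extroots (pencil u v) n))).+1)%N.
Proof.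
move=> uv; set l := extroots _ _; rewrite leqNgt; apply/negP => h.
have E : ratmap P @^-1` [set pt u v] #= `I_(size (undup l)).
  have -> : ratmap P @^-1` [set pt u v] = [set x | x \in undup l].
    apply/seteqP; split=> x /=; rewrite mem_undup; by move=> /(ratmap_pencil _ uv).
  by apply: card_seq; exact: undup_uniq.
have [|m mn F] := @simpleP (pt u v); first by exists (size (undup l)) => //; rewrite -/n; lia.
have : `I_m #= `I_(size (undup l)) by apply: card_eq_trans E; rewrite card_eq_sym.
move=> /card_eq_II mE; move: mn; rewrite mE -/n; lia.
Qed.

Lemma size_extroots N : N != 0 -> (size N <= n.+1)%N -> size (extroots N n) = n.
Proof.
by move=> N0; rewrite size_cat size_map size_nseq size_proots // ltnS => /subnKC.
Qed.

(** A triple root costs two of the [n] points of the fibre, but a simple critical value loses only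
    one. Two double roots cost as much. *)
Lemma no_triple u v x : (u != 0) || (v != 0) -> ~ mult_ge (pencil u v) n x 3.
Proof.
move=> uv; have N0 := pencil_neq0 uv; have sN := size_pencil u v.
move=> /(mult_count N0 sN) c3; have := simple_extroots uv.
have := size_undup_count1 (extroots (pencil u v) n) x.
rewrite size_extroots //; lia.
Qed.

Lemma no_two_double u v x y : (u != 0) || (v != 0) -> x != y ->
  mult_ge (pencil u v) n x 2 -> ~ mult_ge (pencil u v) n y 2.
Proof.
move=> uv xy; have N0 := pencil_neq0 uv; have sN := size_pencil u v.
move=> /(mult_count N0 sN) cx /(mult_count N0 sN) cy; have := simple_extroots uv.
have := size_undup_count (extroots (pencil u v) n) xy.
rewrite size_extroots //; lia.
Qed.

End Multiplicities.

(** * Partial derivatives of forms and the local separation estimate *)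

Section HomogeneousDerivatives.
Variable R : realType.
Local Notation C := R[i].
Implicit Types (p q : {poly C}) (x y z w u v : C) (n k : nat).

Lemma cderivX (f : C -> C) z d k : cderiv f z d ->
  cderiv (fun w => f w ^+ k) z (k%:R * f z ^+ k.-1 * d).
Proof.
move=> df; elim: k => [|k IH]; first by rewrite !mul0r; exact: cderiv_cst.
have := cderivM df IH; have -> : d * f z ^+ k + f z * (k%:R * f z ^+ k.-1 * d) = k.+1%:R * f z ^+ k * d.
  by case: k {IH} => [|k] /=; rewrite ?expr0 ?(exprS _ k) -?natr1; ring.
by apply: cderiv_ext; apply: nearc_all => w; rewrite exprS.
Qed.

Lemma cderiv_sum (I : Type) (r : seq I) (F : I -> C -> C) (D : I -> C) z :
  (forall i, cderiv (F i) z (D i)) ->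
  cderiv (fun w => \sum_(i <- r) F i w) z (\sum_(i <- r) D i).
Proof.
move=> H; elim: r => [|i r IH].
  rewrite big_nil; apply: cderiv_ext (cderiv_cst 0 z).
  by apply: nearc_all => w; rewrite big_nil.
rewrite big_cons; apply: cderiv_ext (cderivD (H i) IH).
by apply: nearc_all => w; rewrite big_cons.
Qed.

(** The partial derivatives of the form of degree [n]. By Euler's identity [n p - X p'] is the
    dehomogenization of the one in [y]. *)
Definition hevx p n x y := hev p^`() n.-1 x y.
Definition hevy p n x y := hev (n%:R *: p - 'X * p^`()) n.-1 x y.

Lemma hevxE p n x y : (0 < n)%N ->
  hevx p n x y = \sum_(i < n.+1) p`_i * (i%:R * x ^+ i.-1) * y ^+ (n - i).
Proof.
case: n => // n _; rewrite /hevx /hev [in RHS]big_ord_recl /= !mul0r mulr0 mul0r add0r; apply: eq_bigr => i _.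
by rewrite coef_deriv /= /bump /= add1n subSS -mulr_natr; ring.
Qed.

Lemma coef_hevy p n i : (i <= n)%N -> (n%:R *: p - 'X * p^`())`_i = (n - i)%:R * p`_i.
Proof.
move=> le_in; rewrite coefB coefZ coefXM coef_deriv natrB //.
by case: i le_in => [|i] _ /=; rewrite ?mul0r -1?(mulr_natr p`_i.+1); ring.
Qed.

Lemma hevyE p n x y : (0 < n)%N ->
  hevy p n x y = \sum_(i < n.+1) p`_i * x ^+ i * ((n - i)%:R * y ^+ (n - i).-1).
Proof.
case: n => // n _; rewrite /hevy /hev [in RHS]big_ord_recr /= subnn mul0r mulr0 addr0; apply: eq_bigr => i _.
rewrite coef_hevy; last exact: ltnW (ltn_ord i).
have -> : ((n.+1 - i).-1 = n - i)%N by move: (ltn_ord i); lia.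
ring.
Qed.

Lemma euler p n x y : (0 < n)%N -> n%:R * hev p n x y = x * hevx p n x y + y * hevy p n x y.
Proof.
move=> n0; rewrite hevxE // hevyE // /hev !mulr_sumr -big_split; apply: eq_bigr => i _ /=.
have le_in : (i <= n)%N by rewrite -ltnS ltn_ord.
have -> : n%:R = i%:R + (n - i)%:R :> C by rewrite -natrD subnKC.
have e1 : i%:R * x ^+ i = x * (i%:R * x ^+ i.-1) :> C.
  by case: (nat_of_ord i) => [|k] /=; rewrite ?mul0r ?mulr0 // exprS; ring.
have e2 : (n - i)%:R * y ^+ (n - i) = y * ((n - i)%:R * y ^+ (n - i).-1) :> C.
  by case: (n - i)%N => [|k] /=; rewrite ?mul0r ?mulr0 // exprS; ring.
transitivity (p`_i * (i%:R * x ^+ i) * y ^+ (n - i) + p`_i * x ^+ i * ((n - i)%:R * y ^+ (n - i))); first by ring.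
by rewrite e1 e2; ring.
Qed.

Lemma cderiv_hev p n (a b : C -> C) z da db : (0 < n)%N -> cderiv a z da -> cderiv b z db ->
  cderiv (fun w => hev p n (a w) (b w)) z (hevx p n (a z) (b z) * da + hevy p n (a z) (b z) * db).
Proof.
move=> n0 dfa dfb; rewrite hevxE // hevyE // !mulr_suml -big_split /=.
apply: cderiv_sum => i.
have := cderivM (cderivM (cderiv_cst p`_i z) (cderivX i dfa)) (cderivX (n - i) dfb).
by congr (cderiv _ _ _); ring.
Qed.

Lemma diffc_hev p n (a b : C -> C) z : diffc a z -> diffc b z ->
  diffc (fun w => hev p n (a w) (b w)) z.
Proof.
move=> da db; apply: diffc_sum => i _; apply: diffcM; last exact: diffcX.
by apply: diffcM; [exact: diffc_cst|exact: diffcX].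
Qed.

(* The hypothesis says that the second derivative of [p / q] does not vanish at [t0] if the first one does. *)
Lemma local_simple p q t0 : (p^`N(2) * q - p * q^`N(2)).[t0] != 0 ->
  exists2 e : R, 0 < e & exists2 c : R, 0 <= c & forall x y, abs (x - t0) < e -> abs (y - t0) < e ->
    p.[x] * q.[y] = q.[x] * p.[y] -> abs (x - y) <= c * abs (p^`() * q - p * q^`()).[y].
Proof.
set w2 := _ - _ => w20.
pose m := maxn (size p) (size q).
pose co i := p^`N(i) * q - p * q^`N(i).
have dp (f : {poly C}) z : diffc (horner f) z.
  apply: (@diffc_ext _ (fun w => \sum_(i < size f) f`_i * w ^+ i)).
    by apply: nearc_all => w; rewrite horner_coef.
  apply: diffc_sum => i _; apply: diffcM; [exact: diffc_cst|exact: diffcX (diffc_id z)].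
(* The Taylor expansion in [h] has no constant term, and its linear coefficient is the Wronskian at
   [y]. On a common fibre the left side is 0, which expresses the Wronskian as [- h (w2 + O(h))]. *)
have expand y h : p.[y + h] * q.[y] - q.[y + h] * p.[y] =
    h * (p^`() * q - p * q^`()).[y] + h ^+ 2 * (w2.[y] + h * \sum_(i < m) (co i.+3).[y] * h ^+ i).
  have T (f : {poly C}) : (size f <= m)%N -> f.[y + h] = \sum_(i < m.+3) f^`N(i).[y] * h ^+ i.
    by move=> sf; apply: nderiv_taylor_wide; [exact: mulrC|lia].
  rewrite !T ?leq_maxl ?leq_maxr // !mulr_suml -sumrB.
  rewrite (eq_bigr (fun i : 'I_m.+3 => (co i).[y] * h ^+ i)); last first.
    by move=> i _; rewrite /co hornerD hornerN !hornerM; ring.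
  have c0 : co 0%N = 0 by rewrite /co !nderivn0 subrr.
  have c1 : co 1%N = p^`() * q - p * q^`() by rewrite /co !nderivn1.
  have c2 : co 2%N = w2 by [].
  clearbody co w2; rewrite 3!big_ord_recl /= /bump /= c0 c1 c2 horner0 mul0r add0r expr1.
  set w1 := p^`() * q - _; transitivity (w1.[y] * h + (w2.[y] * h ^+ 2 +
    h ^+ 2 * (h * \sum_(i < m) (co i.+3).[y] * h ^+ i))); last by ring.
  congr (_ + (_ + _)).
  by rewrite !mulr_sumr; apply: eq_bigr => i _; rewrite !exprS; ring.
have [K HK] : exists K, nearc t0 (fun y => \sum_(i < m) abs (co i.+3).[y] <= K).
  elim: (m) => [|k [K HK]]; first by exists 0; apply: nearc_all => y; rewrite big_ord0.
  have cb := cont_bounded (diffc_cont (dp (co k.+3) t0)).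
  exists (K + (abs (co k.+3).[t0] + 1)); apply: nearcW (nearc_and HK cb) => y [h1 h2].
  by rewrite big_ord_recr /= lerD.
have [d d0 Hd] := nearc_and HK (cont_neq0 (diffc_cont (dp w2 t0)) w20).
have K0 : 0 <= K.
  by have [|h _] := Hd t0; [rewrite subrr abs0|apply: le_trans h; apply: sumr_ge0 => i _; exact: abs_ge0].
have K1 : 0 < K + 1 by rewrite ltr_wpDl.
set W := abs w2.[t0] in Hd *; have W0 : 0 < W by rewrite abs_gt0.
(* With this [e] the error [h T] stays below [W / 4] while [|w2(y)| > W / 2], so that
   [|w2 + h T| >= W / 4]. *)
pose e := Num.min d (Num.min (1 / 2) (W / 8 / (K + 1))).
exists e; first by rewrite !lt_min d0 !divr_gt0.
exists (4 / W); first by rewrite divr_ge0 // ltW.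
move=> x y; rewrite !lt_min => /andP[_ /andP[x1 x2]] /andP[y0 /andP[y1 y2]] E.
have [S1 S2] := Hd y y0.
have [->|xy] := eqVneq x y; first by rewrite subrr abs0 mulr_ge0 ?abs_ge0 // divr_ge0 // ltW.
pose h := x - y; have h0 : h != 0 by rewrite subr_eq0.
have xE : x = y + h by rewrite /h (addrC y) subrK.
have h1 : abs h <= abs (x - t0) + abs (y - t0) by rewrite (absB y); exact: abs_subD.
have hle : abs h <= 1 by move: h1 x1 y1; clear; lra.
have hW : abs h * (K + 1) <= W / 4.
  rewrite -ler_pdivlMr //; apply: le_trans h1 _.
  have -> : W / 4 / (K + 1) = W / 8 / (K + 1) + W / 8 / (K + 1) by field; rewrite gt_eqF.
  by apply: lerD; exact: ltW.
set T := \sum_(i < m) (co i.+3).[y] * h ^+ i.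
have TK : abs T <= K.
  apply: le_trans (abs_sum _ _ _) _; apply: le_trans S1; apply: ler_sum => i _.
  by rewrite absM absX ler_piMr ?abs_ge0 // exprn_ile1 ?abs_ge0.
have E0 : (p^`() * q - p * q^`()).[y] = - (h * (w2.[y] + h * T)).
  apply: (mulfI h0); apply/eqP; rewrite -subr_eq0.
  have := expand y h; rewrite -xE E -/T => e1.
  have e2 : h * (p^`() * q - p * q^`()).[y] + h ^+ 2 * (w2.[y] + h * T) = 0 by rewrite -e1 mulrC subrr.
  by rewrite -e2; apply/eqP; ring.
have low : W / 4 <= abs (w2.[y] + h * T).
  have := abs_leB w2.[y] (- (h * T)); rewrite opprK absN absM => L.
  have : abs h * abs T <= abs h * (K + 1) by apply: ler_wpM2l; rewrite ?abs_ge0 //; move: TK; clear; lra.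
  by move: hW S2 L; clear; lra.
have one : 1 <= 4 / W * abs (w2.[y] + h * T).
  by rewrite mulrAC ler_pdivlMr // mul1r; move: low; clear; lra.
by rewrite E0 absN absM -/h mulrCA; exact: ler_peMr (abs_ge0 h) one.
Qed.

End HomogeneousDerivatives.

(** * The Jacobian form and its zeros *)

Section Jacobian.
Variable R : realType.
Local Notation C := R[i].
Variable P : ratfun R.
Hypothesis simpleP : forall s, critical_value P s -> simple_critical_value P s.
Let n := ratdeg P.
Let p := ratnum P.
Let q := ratden P.
Hypothesis n_ge3 : (2 < n)%N.
Implicit Types (x y z w u v t : C) (b c : bool) (k : nat).

Let n_gt0 : (0 < n)%N. Proof. by apply: leq_trans n_ge3. Qed.
Let nn0 : n%:R != 0 :> C. Proof. by rewrite pnatr_eq0 -lt0n. Qed.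
Let sp : (size p <= n.+1)%N. Proof. exact: size_num. Qed.
Let sq : (size q <= n.+1)%N. Proof. exact: size_den. Qed.

Definition numf x y := hev p n x y.
Definition denf x y := hev q n x y.
Definition Jac x y := hevx p n x y * hevy q n x y - hevy p n x y * hevx q n x y.
Definition wr := p^`() * q - p * q^`().

Lemma Jac_scale (l x y : C) : Jac (l * x) (l * y) = l ^+ (2 * n.-1) * Jac x y.
Proof.
rewrite /Jac /hevx /hevy !hev_scale mul2n -addnn exprD.
move: (l ^+ n.-1) (hev p^`() _ x y) (hev q^`() _ x y) (hev (_ *: p - _) _ x y) (hev (_ *: q - _) _ x y).
by move=> L a b c d; ring.
Qed.

Lemma size_deriv_le (f : {poly C}) k : (size f <= k.+1)%N -> (size f^`() <= k)%N.
Proof.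
move=> sf; apply/leq_sizeP => j kj; rewrite coef_deriv nth_default ?mul0rn //.
exact: leq_trans sf _.
Qed.

Lemma Jac1 t : Jac t 1 = n%:R * wr.[t].
Proof.
have hx (f : {poly C}) : (size f <= n.+1)%N -> hevx f n t 1 = f^`().[t].
  by move=> sf; rewrite /hevx hev1 // prednK //; exact: size_deriv_le.
have hy (f : {poly C}) : (size f <= n.+1)%N -> hevy f n t 1 = n%:R * f.[t] - t * f^`().[t].
  by move=> sf; have := euler f t 1 n_gt0; rewrite hev1 // hx // => ->; ring.
by rewrite /Jac !hx // !hy // /wr hornerD hornerN !hornerM; ring.
Qed.

Lemma Jac_affine x y : y != 0 -> Jac x y = y ^+ (2 * n.-1) * (n%:R * wr.[x / y]).
Proof.
by move=> y0; rewrite -Jac1 -Jac_scale; congr Jac; field.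
Qed.

Lemma Jac_inf : Jac 1 0 = n%:R * (p`_n * q`_n.-1 - p`_n.-1 * q`_n).
Proof.
have hx (f : {poly C}) : hevx f n 1 0 = n%:R * f`_n.
  by rewrite /hevx hev_inf expr1n mulr1 coef_deriv prednK // mulr_natl.
have hy (f : {poly C}) : hevy f n 1 0 = f`_n.-1.
  rewrite /hevy hev_inf expr1n mulr1 coef_hevy ?leq_pred //.
  have -> : (n - n.-1 = 1)%N by move: n_gt0; lia.
  by rewrite mul1r.
by rewrite /Jac !hx !hy; ring.
Qed.

Lemma Jac_infx x : Jac x 0 = x ^+ (2 * n.-1) * Jac 1 0.
Proof. by rewrite -Jac_scale mulr1 mulr0. Qed.

(** The form of degree [n] in the chart [[1 : t]] around infinity. *)
Definition rv (f : {poly C}) : {poly C} := \poly_(i < n.+1) f`_(n - i).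

Lemma hev_rv f t : hev f n 1 t = (rv f).[t].
Proof.
rewrite /hev (horner_coef_wide _ (size_poly _ _)) (reindex_inj rev_ord_inj) /=; apply: eq_bigr => i _.
have le_in : (i <= n)%N by rewrite -ltnS ltn_ord.
by rewrite expr1n mulr1 coef_poly ltn_ord !subSS subKn.
Qed.

Lemma hevy_rv f t : hevy f n 1 t = (rv f)^`().[t].
Proof.
rewrite hevyE // (horner_coef_wide (n := n)); last first.
  exact/size_deriv_le/size_poly.
rewrite big_ord_recr /= subnn mul0r mulr0 addr0 (reindex_inj rev_ord_inj) /=; apply: eq_bigr => i _.
have lt_in := ltn_ord i.
rewrite expr1n mulr1 coef_deriv coef_poly ltnS lt_in -mulr_natr.
have -> : (n - (n - i.+1) = i.+1)%N by lia.
by rewrite /=; ring.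
Qed.

Lemma Jac_rv t : Jac 1 t = - (n%:R * ((rv p)^`() * rv q - rv p * (rv q)^`()).[t]).
Proof.
have hx f : hevx f n 1 t = n%:R * (rv f).[t] - t * (rv f)^`().[t].
  by have := euler f 1 t n_gt0; rewrite hev_rv hevy_rv => ->; ring.
by rewrite /Jac !hx !hevy_rv hornerD hornerN !hornerM; ring.
Qed.

Lemma deriv2_nderivn (f : {poly C}) : f^`()^`() = f^`N(2) *+ 2.
Proof. by rewrite -[LHS]/(f^`(2)) nderivn_def. Qed.

Lemma AB_neq0 x y : (x != 0) || (y != 0) -> (numf x y != 0) || (denf x y != 0).
Proof. exact: hev_neq0. Qed.

(** The pencil vanishes at the point. Its derivative there, multiplied by whichever of numerator and
    denominator is nonzero, is a multiple of the Wronskian. *)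
Lemma crit_double x y u v : (x != 0) || (y != 0) -> Jac x y = 0 -> numf x y * v = denf x y * u ->
  mult_ge (pencil P u v) n (pt x y) 2.
Proof.
move=> xy J0 E; have AB := AB_neq0 xy; rewrite /pt; have [y0|y0] := eqVneq y 0 => /=.
  move: xy J0 E AB; rewrite y0 eqxx orbF => x0; rewrite /numf /denf !hev_inf Jac_infx Jac_inf.
  move=> /eqP; rewrite !mulf_eq0 !(negbTE (expf_neq0 _ x0)) (negbTE nn0) /= !orbF => /eqP J0 E AB.
  have {}E : p`_n * v = q`_n * u by apply: (mulIf (expf_neq0 n x0)); rewrite mulrAC E mulrAC.
  have c0 : (pencil P u v)`_n = 0 by rewrite /pencil coefB !coefZ -/p -/q mulrC E mulrC subrr.
  have c1 : (pencil P u v)`_n.-1 = 0.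
    rewrite /pencil coefB !coefZ -/p -/q; case/orP: AB => h.
      apply: (mulfI h); rewrite mulr0; transitivity (p`_n.-1 * (p`_n * v) - p`_n * q`_n.-1 * u); first by ring.
      by rewrite E; transitivity (- u * (p`_n * q`_n.-1 - p`_n.-1 * q`_n)); [ring|rewrite J0 mulr0].
    apply: (mulfI h); rewrite mulr0; transitivity (q`_n * p`_n.-1 * v - q`_n.-1 * (q`_n * u)); first by ring.
    by rewrite -E; transitivity (- v * (p`_n * q`_n.-1 - p`_n.-1 * q`_n)); [ring|rewrite J0 mulr0].
  suff h : (size (pencil P u v) <= n.-1)%N by rewrite addn2 ltnS; apply: leq_ltn_trans h _; rewrite prednK.
  apply/leq_sizeP => j nj; have [jn|jn] := ltnP j n.
    by have -> : j = n.-1 by lia.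
  have [->//|jn'] := eqVneq j n.
  by apply: (leq_sizeP (pencil P u v) n.+1 (size_pencil P u v)); rewrite ltn_neqAle eq_sym jn'.
move: xy J0 E AB; rewrite Jac_affine // /numf /denf !hev_affine // !mulf_eq0 (negbTE (expf_neq0 _ y0)) /=.
move: (x / y) => t _ /eqP; rewrite !mulf_eq0 (negbTE (expf_neq0 _ y0)) (negbTE nn0) /= => /eqP w0 E AB.
have {}E : p.[t] * v = q.[t] * u by apply: (mulfI (expf_neq0 n y0)); rewrite mulrA E mulrA.
move: w0; rewrite /wr hornerD hornerN !hornerM => w0.
apply: dvdp_deriv2; rewrite /pencil ?derivB ?derivZ hornerD hornerN !hornerZ -/p -/q.
  by rewrite mulrC E mulrC subrr.
case/orP: AB => h; apply: (mulfI h); rewrite mulr0.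
  transitivity (p^`().[t] * (p.[t] * v) - p.[t] * q^`().[t] * u); first by ring.
  by rewrite E; transitivity (u * (p^`().[t] * q.[t] - p.[t] * q^`().[t])); [ring|rewrite w0 mulr0].
transitivity (q.[t] * p^`().[t] * v - q^`().[t] * (q.[t] * u)); first by ring.
by rewrite -E; transitivity (v * (p^`().[t] * q.[t] - p.[t] * q^`().[t])); [ring|rewrite w0 mulr0].
Qed.

(** Otherwise [q(t) p - p(t) q] would have a triple root at [t]. *)
Lemma crit_simple_fin t : wr.[t] = 0 -> (p^`N(2) * q - p * q^`N(2)).[t] != 0.
Proof.
move=> w0; apply/eqP => w2.
have uv : (p.[t] != 0) || (q.[t] != 0) by exact: horner_neq0.
apply: (no_triple simpleP n_gt0 (x := Some t) uv).
apply: dvdp_deriv3; rewrite /pencil ?derivB ?derivZ ?deriv2_nderivn hornerD hornerN !hornerZ -/p -/q.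
- by rewrite mulrC subrr.
- by move: w0; rewrite /wr hornerD hornerN !hornerM => <-; ring.
- move: w2; rewrite hornerD hornerN !hornerM !hornerMn => w2.
  transitivity ((p^`N(2).[t] * q.[t] - p.[t] * q^`N(2).[t]) *+ 2); last by rewrite w2 mul0rn.
  by move: (p^`N(2).[t]) (q^`N(2).[t]) (p.[t]) (q.[t]) => a b c d; ring.
Qed.

Lemma crit_simple_inf : Jac 1 0 = 0 -> ((rv p)^`N(2) * rv q - rv p * (rv q)^`N(2)).[0] != 0.
Proof.
rewrite Jac_inf => /eqP; rewrite mulf_eq0 (negbTE nn0) /= => /eqP J0; apply/eqP.
rewrite hornerD hornerN !hornerM !horner_coef0 !coef_nderivn !coef_poly /= ?addn0 ?subn0 ?binn ?mulr1n => w2.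
have n2 : (2 < n.+1)%N by lia.
rewrite n2 in w2.
have uv : (p`_n != 0) || (q`_n != 0) by exact: lead_neq0.
apply: (no_triple simpleP n_gt0 (x := None) uv) => /=.
rewrite -/n; suff h : (size (pencil P (p`_n)%R (q`_n)%R) <= n - 2)%N.
  by apply: leq_trans (leq_add h (leqnn 3)) _; lia.
apply/leq_sizeP => j nj.
have [->|j1] := eqVneq j n; first by rewrite /pencil coefB !coefZ -/p -/q mulrC subrr.
have [->|j2] := eqVneq j n.-1.
  rewrite /pencil coefB !coefZ -/p -/q.
  by transitivity (- (p`_n * q`_n.-1 - p`_n.-1 * q`_n)); [ring|rewrite J0 oppr0].
have [->|j3] := eqVneq j (n - 2)%N.
  by rewrite /pencil coefB !coefZ -/p -/q -[RHS]w2; ring.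
apply: (leq_sizeP (pencil P (p`_n)%R (q`_n)%R) n.+1 (size_pencil P _ _)); lia.
Qed.

End Jacobian.

Section Charts.
Variable R : realType.
Local Notation C := R[i].
Implicit Types (x y z w u v t : C) (b c : bool) (k : nat).

Definition chart b t : C * C := if b then (t, 1) else (1, t).

Lemma chart_neq0 b t : ((chart b t).1 != 0) || ((chart b t).2 != 0).
Proof. by case: b; rewrite /= oner_eq0 ?orbT. Qed.

Lemma diffc_chart b t : diffc (fun t => (chart b t).1) t /\ diffc (fun t => (chart b t).2) t.
Proof. by case: b; split; rewrite /=; try exact: diffc_id; exact: diffc_cst. Qed.

Lemma chart_le b t : abs (chart b t).1 <= 1 + abs t /\ abs (chart b t).2 <= 1 + abs t.
Proof. by have := abs_ge0 t; case: b => /= h; rewrite abs1; split; move: h; clear; lra. Qed.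

Definition wedge (x y : C * C) := x.1 * y.2 - x.2 * y.1.

Lemma wedge_le b c t u : abs (wedge (chart b t) (chart c u)) <= 2 * ((1 + abs t) * (1 + abs u)).
Proof.
have [t1 t2] := chart_le b t; have [u1 u2] := chart_le c u.
apply: le_trans (absD _ _) _; rewrite absN !absM.
have := ler_pM (abs_ge0 _) (abs_ge0 _) t1 u2; have := ler_pM (abs_ge0 _) (abs_ge0 _) t2 u1.
by clear; lra.
Qed.

(** Continuity in two variables jointly, for the bilinear shape taken by the condition that two
    points lie in different fibres. *)
Lemma cont2_neq0 (f1 f2 g1 g2 : C -> C) t u : cont_at f1 t -> cont_at f2 t -> cont_at g1 u -> cont_at g2 u ->
  f1 t * g1 u - f2 t * g2 u != 0 ->
  exists2 e : R, 0 < e & forall x y, abs (x - t) < e -> abs (y - u) < e -> f1 x * g1 y - f2 x * g2 y != 0.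
Proof.
move=> c1 c2 d1 d2 h; pose D := abs (f1 t * g1 u - f2 t * g2 u).
have D0 : 0 < D by rewrite abs_gt0.
pose M := abs (f1 t) + abs (f2 t) + abs (g1 u) + abs (g2 u) + 2.
have [a1 a2 a3 a4] : [/\ 0 <= abs (f1 t), 0 <= abs (f2 t), 0 <= abs (g1 u) & 0 <= abs (g2 u)].
  by split; exact: abs_ge0.
have M0 : 0 < M by rewrite /M; move: a1 a2 a3 a4; clear; lra.
pose r := Num.min 1 (D / (8 * M)); have r0 : 0 < r by rewrite lt_min ltr01 divr_gt0 // mulr_gt0.
have rM : r * M <= D / 8.
  have rle : r <= D / (8 * M) by rewrite /r ge_min lexx orbT.
  by apply: le_trans (ler_wpM2r (ltW M0) rle) _; rewrite le_eqVlt; apply/orP; left; apply/eqP; field; rewrite gt_eqF.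
have r1 : r <= 1 by rewrite /r ge_min lexx.
have [e e0 He] := nearc_and (c1 _ r0) (c2 _ r0); have [s s0 Hs] := nearc_and (d1 _ r0) (d2 _ r0).
exists (Num.min e s); first by rewrite lt_min e0.
move=> x y; rewrite !lt_min => /andP[/He [x1 x2] _] /andP[_ /Hs [y1 y2]].
have prod (f g : C -> C) : abs (f x - f t) < r -> abs (g y - g u) < r -> abs (f t) + abs (g u) + 1 <= M ->
    abs (f x * g y - f t * g u) <= D / 8.
  move=> hf hg hM.
  have -> : f x * g y - f t * g u = (f x - f t) * (g y - g u) + (f t * (g y - g u) + (f x - f t) * g u) by ring.
  apply: le_trans (absD _ _) _; apply: le_trans (lerD (lexx _) (absD _ _)) _; rewrite !absM.
  apply: le_trans rM; have := abs_ge0 (f x - f t); have := abs_ge0 (g y - g u).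
  have := abs_ge0 (f t); have := abs_ge0 (g u) => k1 k2 k3 k4.
  have m1 : abs (f x - f t) * abs (g y - g u) <= r * 1.
    by apply: ler_pM => //; [exact: ltW|apply: le_trans r1; exact: ltW].
  have m2 : abs (f t) * abs (g y - g u) <= abs (f t) * r by rewrite ler_wpM2l // ltW.
  have m3 : abs (f x - f t) * abs (g u) <= r * abs (g u) by rewrite ler_wpM2r // ltW.
  have m4 : r * (abs (f t) + abs (g u) + 1) <= r * M by rewrite ler_wpM2l // ltW.
  by move: m1 m2 m3 m4; clear; lra.
have b1 : abs (f1 t) + abs (g1 u) + 1 <= M by rewrite /M; move: a2 a4; clear; lra.
have b2 : abs (f2 t) + abs (g2 u) + 1 <= M by rewrite /M; move: a1 a3; clear; lra.
have q1 := prod f1 g1 x1 y1 b1; have q2 := prod f2 g2 x2 y2 b2.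
apply/eqP => E; have : D <= D / 4.
  have E2 : D = abs ((f2 x * g2 y - f2 t * g2 u) - (f1 x * g1 y - f1 t * g1 u)).
    rewrite /D; congr abs; transitivity (f1 t * g1 u - f2 t * g2 u - (f1 x * g1 y - f2 x * g2 y)); last by ring.
    by rewrite E subr0.
  by rewrite {1}E2; apply: le_trans (absD _ _) _; rewrite absN; move: q1 q2; clear; lra.
by move: D0; clear; lra.
Qed.

End Charts.

(** * Separation of the points of a fibre *)

Section FibreSeparation.
Variable R : realType.
Local Notation C := R[i].
Variable P : ratfun R.
Hypothesis simpleP : forall s, critical_value P s -> simple_critical_value P s.
Hypothesis n_ge3 : (2 < ratdeg P)%N.
Implicit Types (x y z w u v t : C) (b c : bool) (k : nat).

Local Notation n := (ratdeg P).
Local Notation p := (ratnum P).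
Local Notation q := (ratden P).
Local Notation Nf := (numf P).
Local Notation Df := (denf P).
Local Notation Jf := (Jac P).

Definition samefib (x y : C * C) := Nf x.1 x.2 * Df y.1 y.2 = Df x.1 x.2 * Nf y.1 y.2.

Definition sep (K : R) b c t u := samefib (chart b t) (chart c u) ->
  abs (wedge (chart b t) (chart c u)) <= K * (abs (Jf (chart b t).1 (chart b t).2) + abs (Jf (chart c u).1 (chart c u).2)).

Lemma sepS (K L : R) b c t u : K <= L -> sep K b c t u -> sep L b c t u.
Proof.
by move=> KL H /H /le_trans; apply; rewrite ler_wpM2r // addr_ge0 ?abs_ge0.
Qed.

Lemma diffc_num b t : diffc (fun t => Nf (chart b t).1 (chart b t).2) t.
Proof. by have [] := diffc_chart b t; exact: diffc_hev. Qed.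

Lemma diffc_den b t : diffc (fun t => Df (chart b t).1 (chart b t).2) t.
Proof. by have [] := diffc_chart b t; exact: diffc_hev. Qed.

Lemma diffc_Jac_comp (f g : C -> C) t : diffc f t -> diffc g t -> diffc (fun t => Jf (f t) (g t)) t.
Proof. by move=> df dg; apply: diffcB; apply: diffcM; exact: diffc_hev. Qed.

Lemma diffc_Jac b t : diffc (fun t => Jf (chart b t).1 (chart b t).2) t.
Proof. by have [] := diffc_chart b t; exact: diffc_Jac_comp. Qed.

Lemma chart2_neq0 b t : (chart b t).2 != 0 ->
  nearc t (fun t => (chart b t).2 != 0) /\ cont_at (fun t => (chart b t).1 / (chart b t).2) t.
Proof.
move=> h; have [d1 d2] := diffc_chart b t; split; first exact: nearc_neq0 (diffc_cont d2) h.
by apply: diffc_cont; apply: diffcM => //; exact: diffcV.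
Qed.

(** Both charts describe the same finite critical point. In the common coordinate [T] this is
    [local_simple]; the second coordinates of the charts enter as factors, bounded above, and below
    where they are divided by. *)
Lemma sep_parallel_fin b c t u : (chart b t).2 != 0 -> (chart c u).2 != 0 ->
  wedge (chart b t) (chart c u) = 0 -> Jf (chart b t).1 (chart b t).2 = 0 ->
  exists K, exists2 e : R, 0 < e & forall x y, abs (x - t) < e -> abs (y - u) < e -> sep K b c x y.
Proof.
move=> b2 c2 W J0; pose T b t := (chart b t).1 / (chart b t).2.
have TE : T b t = T c u.
  apply/eqP; rewrite /T eqr_div //; move/eqP: W; rewrite /wedge subr_eq0 => /eqP ->.
  by rewrite mulrC.
have [nb cb] := chart2_neq0 b2; have [nc cc] := chart2_neq0 c2.
have n0 : n%:R != 0 :> C by rewrite pnatr_eq0 -lt0n (leq_trans _ n_ge3).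
have w0 : (wr P).[T b t] = 0.
  move/eqP: J0; rewrite Jac_affine // !mulf_eq0 (negbTE (expf_neq0 _ b2)) (negbTE n0) /=.
  by move/eqP.
have [e e0 [k k0 sepk]] := local_simple (crit_simple_fin simpleP n_ge3 w0).
have dc2 := diffc_cont (diffc_chart c u).2.
have low := cont_neq0 dc2 c2.
pose m := abs (chart c u).2 / 2; have m0 : 0 < m by rewrite divr_gt0 ?abs_gt0.
have [r r0 H] : nearc t (fun x => [/\ (chart b x).2 != 0, abs (T b x - T b t) < e & abs (x - t) < 1]).
  apply: nearcW (nearc_and nb (nearc_and (cb _ e0) (ex_intro2 _ _ 1 ltr01 (fun w h => h)))) => x.
  by move=> [h1 [h2 h3]]; split.
have [s s0 L] : nearc u (fun y => [/\ (chart c y).2 != 0, abs (T c y - T b t) < e, abs (y - u) < 1 & m < abs (chart c y).2]).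
  apply: nearcW (nearc_and nc (nearc_and (cc _ e0) (nearc_and low (ex_intro2 _ _ 1 ltr01 (fun w h => h))))) => y.
  by rewrite -/(T c u) -TE => -[h1 [h2 [h3 h4]]]; split.
pose B := (2 + abs t) * (2 + abs u).
have a0 := abs_ge0 t; have a1 := abs_ge0 u.
have B0 : 0 <= B by rewrite mulr_ge0 // addr_ge0.
exists (B * (k * ((m ^+ (2 * n.-1))^-1))); exists (Num.min r s); first by rewrite lt_min r0.
move=> x y; rewrite !lt_min => /andP[/H [x1 x2 x3] _] /andP[_ /L [y1 y2 y3 y4]] F.
have F' : p.[T b x] * q.[T c y] = q.[T b x] * p.[T c y].
  move: F; rewrite /samefib /numf /denf !hev_affine ?size_num ?size_den // -/(T b x) -/(T c y) => F.
  apply: (mulfI (mulf_neq0 (expf_neq0 n x1) (expf_neq0 n y1))).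
  move: F; move: (_ ^+ n) (_ ^+ n) p.[_] q.[_] q.[_] p.[_] => Y X p2 q2 q1 p1 F.
  by transitivity (X * p1 * (Y * q1)); [ring|rewrite F; ring].
have S := sepk _ _ x2 y2 F'.
have wE : wedge (chart b x) (chart c y) = (chart b x).2 * (chart c y).2 * (T b x - T c y).
  by rewrite /wedge /T; move: (chart b x) (chart c y) x1 y1 => [x' x''] [y' y''] /= h1 h2; field; rewrite h1 h2.
have y2p : 0 < abs (chart c y).2 by rewrite abs_gt0.
have wJ : abs (wr P).[T c y] <= (m ^+ (2 * n.-1))^-1 * abs (Jf (chart c y).1 (chart c y).2).
  rewrite Jac_affine // -/(T c y) absM absX (absM n%:R) absn.
  have mm : 0 < m ^+ (2 * n.-1) by rewrite exprn_gt0.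
  rewrite ler_pdivlMl // ler_pM ?exprn_ge0 ?abs_ge0 ?(ltW m0) //.
    by apply: lerXn2r; rewrite ?nnegrE ?abs_ge0 ?(ltW m0) ?(ltW y4).
  by rewrite ler_peMl ?abs_ge0 // ler1n (leq_trans _ n_ge3).
have xB : abs (chart b x).2 * abs (chart c y).2 <= B.
  have [_ h1] := chart_le b x; have [_ h2] := chart_le c y.
  have t1 := abs_leB x t; have t2 := abs_leB y u.
  apply: ler_pM; rewrite ?abs_ge0 //; [apply: le_trans h1 _|apply: le_trans h2 _].
    by move: t1 x3; clear -simpleP n_ge3; lra.
  by move: t2 y3; clear -simpleP n_ge3; lra.
rewrite wE absM absM.
apply: le_trans (ler_pM _ _ xB S) _; rewrite ?mulr_ge0 ?abs_ge0 //.
rewrite -[X in _ <= X]mulrA; apply: ler_wpM2l => //; rewrite -[X in _ <= X]mulrA; apply: ler_wpM2l => //.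
apply: le_trans wJ _; rewrite ler_wpM2l ?invr_ge0 ?exprn_ge0 ?(ltW m0) //.
by rewrite lerDr abs_ge0.
Qed.

Lemma sep_parallel_inf : Jf 1 0 = 0 ->
  exists K, exists2 e : R, 0 < e & forall x y, abs (x - 0) < e -> abs (y - 0) < e -> sep K false false x y.
Proof.
move=> J0; have [e e0 [k k0 sepk]] := local_simple (crit_simple_inf simpleP n_ge3 J0).
exists k; exists e => // x y xe ye; rewrite /sep /samefib /wedge /= /numf /denf !hev_rv // => F.
have S := sepk x y xe ye F; rewrite (Jac_rv n_ge3 y) absN (absM n%:R) absn mul1r mulr1 absB.
apply: le_trans S _; rewrite ler_wpM2l //; set w := abs _.[y].
have : w <= n%:R * w by rewrite ler_peMl ?abs_ge0 // ler1n (leq_trans _ n_ge3).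
by move=> /le_trans; apply; rewrite lerDr abs_ge0.
Qed.

(** If [J] is nonzero at one of the points, the right side is bounded below nearby. If both points
    are critical and distinct, they lie in different fibres, as two double points in one fibre are
    excluded, and nearby the condition is void. If they coincide, [local_simple] applies. *)
Lemma sep_local b c t u :
  exists K, exists2 e : R, 0 < e & forall x y, abs (x - t) < e -> abs (y - u) < e -> sep K b c x y.
Proof.
have tdist (K : R) x y : abs (x - t) < 1 -> abs (y - u) < 1 -> 0 <= K ->
    abs (wedge (chart b x) (chart c y)) <= 2 * ((2 + abs t) * (2 + abs u)).
  move=> h1 h2 _; apply: le_trans (wedge_le _ _ _ _) _.
  have k1 := abs_leB x t; have k2 := abs_leB y u; have k3 := abs_ge0 x; have k4 := abs_ge0 y.
  rewrite ler_pM2l // ler_pM ?addr_ge0 //.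
    by move: k1 h1; clear -simpleP n_ge3; lra.
  by move: k2 h2; clear -simpleP n_ge3; lra.
pose B := 2 * ((2 + abs t) * (2 + abs u)).
have B0 : 0 <= B by rewrite !mulr_ge0 // addr_ge0 ?abs_ge0.
have [Jt|Jt] := eqVneq (Jf (chart b t).1 (chart b t).2) 0; last first.
  have low := cont_neq0 (diffc_cont (diffc_Jac b t)) Jt; set m := abs _ / 2 in low.
  have m0 : 0 < m by rewrite divr_gt0 ?abs_gt0.
  have [e e0 H] := low; exists (B / m); exists (Num.min 1 e); first by rewrite lt_min ltr01.
  move=> x y; rewrite !lt_min => /andP[x1 /H x2] /andP[y1 _] _.
  apply: le_trans (tdist 0 x y x1 y1 (lexx _)) _; rewrite -/B mulrAC ler_pdivlMr // ler_wpM2l //.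
  by apply: le_trans (ltW x2) _; rewrite lerDl abs_ge0.
have [Ju|Ju] := eqVneq (Jf (chart c u).1 (chart c u).2) 0; last first.
  have low := cont_neq0 (diffc_cont (diffc_Jac c u)) Ju; set m := abs _ / 2 in low.
  have m0 : 0 < m by rewrite divr_gt0 ?abs_gt0.
  have [e e0 H] := low; exists (B / m); exists (Num.min 1 e); first by rewrite lt_min ltr01.
  move=> x y; rewrite !lt_min => /andP[x1 _] /andP[y1 /H y2] _.
  apply: le_trans (tdist 0 x y x1 y1 (lexx _)) _; rewrite -/B mulrAC ler_pdivlMr // ler_wpM2l //.
  by apply: le_trans (ltW y2) _; rewrite lerDr abs_ge0.
have [W|W] := eqVneq (wedge (chart b t) (chart c u)) 0.
  have [b2|b2] := eqVneq (chart b t).2 0; last first.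
    have [c2|c2] := eqVneq (chart c u).2 0; last exact: sep_parallel_fin.
    move/eqP: W; rewrite /wedge c2 mulr0 sub0r oppr_eq0 mulf_eq0 (negbTE b2) /=.
    by move/negPn; have := chart_neq0 c u; rewrite c2 eqxx orbF => ->.
  have c2 : (chart c u).2 = 0.
    have := chart_neq0 b t; rewrite b2 eqxx orbF => b1.
    by move/eqP: W; rewrite /wedge b2 mul0r subr0 mulf_eq0 (negbTE b1) /= => /eqP.
  case: b b2 {W} Jt tdist => /= b2; first by move/eqP: b2; rewrite oner_eq0.
  case: c c2 Ju => /= c2; first by move/eqP: c2; rewrite oner_eq0.
  by rewrite b2 c2 => _ Jt _; exact: sep_parallel_inf.
have F : ~ samefib (chart b t) (chart c u).
  move=> F; have tn := chart_neq0 b t; have un := chart_neq0 c u.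
  have n0 : (0 < n)%N by exact: leq_trans n_ge3.
  pose U := Nf (chart b t).1 (chart b t).2; pose V := Df (chart b t).1 (chart b t).2.
  have UV : (U != 0) || (V != 0) by exact: hev_neq0.
  have m1 := crit_double n_ge3 tn Jt (_ : Nf _ _ * V = Df _ _ * U).
  have m2 := crit_double n_ge3 un Ju (_ : Nf _ _ * V = Df _ _ * U).
  apply: (no_two_double simpleP n0 UV _ (m1 _) (m2 _)).
  - by apply/eqP => /(pt_eq tn un) E; move/eqP: W; apply; rewrite /wedge E subrr.
  - by rewrite /U /V mulrC.
  - by move: F; rewrite /samefib -/U -/V mulrC [RHS]mulrC => ->.
have [d1 d2] := (diffc_cont (diffc_num b t), diffc_cont (diffc_den b t)).
have [d3 d4] := (diffc_cont (diffc_num c u), diffc_cont (diffc_den c u)).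
have [|e e0 H] := cont2_neq0 d1 d2 d4 d3; first by apply/eqP => /eqP; rewrite subr_eq0 => /eqP.
exists 0; exists e => // x y xe ye F'; have := H x y xe ye.
by move: F'; rewrite /samefib => ->; rewrite subrr eqxx.
Qed.

(* By compactness this is local, and only the critical points, handled by [local_simple], matter. *)
Lemma separation : exists2 K : R, 0 <= K &
  forall b c t u, abs t <= 2 -> abs u <= 2 -> sep K b c t u.
Proof.
have one b c : exists2 K : R, 0 <= K & forall t u, abs t <= 2 -> abs u <= 2 -> sep K b c t u.
  apply: (compact_ind (Q := fun A => exists2 K : R, 0 <= K & forall t u, A t -> abs u <= 2 -> sep K b c t u)).
  - by move=> A B AB [K K0 H]; exists K => // t u /AB; exact: H.
  - move=> A B [K K0 HK] [L L0 HL]; exists (Num.max K L); first by rewrite le_max K0.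
    move=> t u [/HK h|/HL h] /h; apply: sepS; by rewrite le_max lexx ?orbT.
  move=> t.
  suff [K [K0 [e e0 H]]] : exists K : R, 0 <= K /\ exists2 e : R, 0 < e & forall x u, abs (x - t) < e -> abs u <= 2 -> sep K b c x u.
    by exists (fun x => abs (x - t) < e); [exists e|exists K].
  apply: (compact_ind (Q := fun A => exists K : R, 0 <= K /\ exists2 e : R, 0 < e & forall x u, abs (x - t) < e -> A u -> sep K b c x u)).
  - by move=> A B AB [K [K0 [e e0 H]]]; exists K; split=> //; exists e => // x u xe /AB; exact: H.
  - move=> A B [K [K0 [e e0 HK]]] [L [L0 [s s0 HL]]]; exists (Num.max K L); split; first by rewrite le_max K0.
    exists (Num.min e s); first by rewrite lt_min e0.
    move=> x u; rewrite lt_min => /andP[/HK h1 /HL h2] [/h1|/h2]; apply: sepS; by rewrite le_max lexx ?orbT.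
  move=> u; have [K [e e0 H]] := sep_local b c t u.
  exists (fun y => abs (y - u) < e); first by exists e.
  exists (Num.max 0 K); split; first by rewrite le_max lexx.
  by exists e => // x y xe ye; apply: sepS (H x y xe ye); rewrite le_max lexx orbT.
have [K1 k1 H1] := one true true; have [K2 k2 H2] := one true false.
have [K3 k3 H3] := one false true; have [K4 k4 H4] := one false false.
exists (K1 + K2 + K3 + K4); first by rewrite !addr_ge0.
move=> b c t u tt uu; case: b; case: c.
- by apply: sepS (H1 _ _ tt uu); move: k1 k2 k3 k4; clear -simpleP n_ge3; lra.
- by apply: sepS (H2 _ _ tt uu); move: k1 k2 k3 k4; clear -simpleP n_ge3; lra.
- by apply: sepS (H3 _ _ tt uu); move: k1 k2 k3 k4; clear -simpleP n_ge3; lra.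
- by apply: sepS (H4 _ _ tt uu); move: k1 k2 k3 k4; clear -simpleP n_ge3; lra.
Qed.

End FibreSeparation.

(** * Entire quadratic differentials for degree at least 4 *)

Section QuadraticDifferential.
Variable R : realType.
Local Notation C := R[i].
Variable P : ratfun R.
Hypothesis simpleP : forall s, critical_value P s -> simple_critical_value P s.
Hypothesis n_ge3 : (2 < ratdeg P)%N.
Implicit Types (z w u v t : C) (b c : bool) (x y : C * C) (i : bool * bool * bool * bool).

Local Notation n := (ratdeg P).
Local Notation J x := (Jac P x.1 x.2).

(** The squared length of the lift of the value of [P], the denominator of a spherical
    derivative. *)
Definition fnorm x : R := abs (numf P x.1 x.2) ^+ 2 + abs (denf P x.1 x.2) ^+ 2.

Lemma fnorm_gt0 x : (x.1 != 0) || (x.2 != 0) -> 0 < fnorm x.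
Proof.
move=> /(hev_neq0 P)/orP[h|h]; rewrite /fnorm.
  by rewrite ltr_wpDr ?exprn_ge0 ?abs_ge0 // exprn_gt0 // abs_gt0.
by rewrite ltr_wpDl ?exprn_ge0 ?abs_ge0 // exprn_gt0 // abs_gt0.
Qed.

Lemma sqr_ler (a b : R) : 0 <= a -> a <= b -> a ^+ 2 <= b ^+ 2.
Proof. by move=> a0 ab; apply: lerXn2r; rewrite ?nnegrE // (le_trans a0). Qed.

Lemma fnorm_ratio : exists2 L : R, 0 <= L & forall b c t u, abs t <= 2 -> abs u <= 2 ->
  fnorm (chart c u) <= L * fnorm (chart b t).
Proof.
have up b : exists M : R, forall t, abs t <= 2 -> fnorm (chart b t) <= M.
  apply: locally_bounded => t.
  have h1 := cont_bounded (diffc_cont (diffc_num P b t)).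
  have h2 := cont_bounded (diffc_cont (diffc_den P b t)).
  exists ((abs (numf P (chart b t).1 (chart b t).2) + 1) ^+ 2 + (abs (denf P (chart b t).1 (chart b t).2) + 1) ^+ 2).
  by apply: nearcW (nearc_and h1 h2) => w [k1 k2]; rewrite lerD // sqr_ler ?abs_ge0.
have low b : exists M : R, forall t, abs t <= 2 -> (fnorm (chart b t))^-1 <= M.
  apply: locally_bounded => t; have fp w := fnorm_gt0 (chart_neq0 b w).
  have key (h : C -> C) : cont_at h t -> h t != 0 -> (forall w, abs (h w) ^+ 2 <= fnorm (chart b w)) ->
      exists M : R, nearc t (fun w => (fnorm (chart b w))^-1 <= M).
    move=> ch h0 hf; exists (((abs (h t) / 2) ^+ 2)^-1).
    apply: nearcW (cont_neq0 ch h0) => w hw.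
    have p0 : 0 < abs (h t) / 2 by rewrite divr_gt0 ?abs_gt0.
    rewrite lef_pV2 ?posrE ?exprn_gt0 //; apply: le_trans (hf w).
    by rewrite sqr_ler // ltW.
  have := hev_neq0 P (chart_neq0 b t) => /orP[h|h].
    apply: (key _ (diffc_cont (diffc_num P b t)) h) => w.
    by rewrite lerDl exprn_ge0 ?abs_ge0.
  apply: (key _ (diffc_cont (diffc_den P b t)) h) => w.
  by rewrite lerDr exprn_ge0 ?abs_ge0.
have [M1 H1] := up true; have [M2 H2] := up false.
have [L1 K1] := low true; have [L2 K2] := low false.
exists ((`|M1| + `|M2|) * (`|L1| + `|L2|)); first by rewrite mulr_ge0 // addr_ge0.
move=> b c t u tt uu; have fp := fnorm_gt0 (chart_neq0 b t).
have e1 : fnorm (chart c u) <= `|M1| + `|M2|.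
  case: c; [apply: le_trans (H1 _ uu) _|apply: le_trans (H2 _ uu) _]; apply: le_trans (ler_norm _) _.
    by rewrite lerDl.
  by rewrite lerDr.
have e2 : (fnorm (chart b t))^-1 <= `|L1| + `|L2|.
  case: (b); [apply: le_trans (K1 _ tt) _|apply: le_trans (K2 _ tt) _]; apply: le_trans (ler_norm _) _.
    by rewrite lerDl.
  by rewrite lerDr.
rewrite -ler_pdivrMr //; apply: ler_pM => //; first exact/ltW/fnorm_gt0/chart_neq0.
by rewrite invr_ge0 ltW.
Qed.

(** Up to the factor [n], [|J(f) W(f)| / fnorm] is the spherical derivative of [P(f)]. The two sides
    compare this quantity for the same function [P(f) = P(g)], with denominators cleared. *)
Lemma fibre_wronskian (a1 a2 c1 c2 : C -> C) z (a1' a2' c1' c2' : C) :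
  cderiv a1 z a1' -> cderiv a2 z a2' -> cderiv c1 z c1' -> cderiv c2 z c2' ->
  nearc z (fun w => samefib P (a1 w, a2 w) (c1 w, c2 w)) ->
  abs (Jac P (a1 z) (a2 z)) * abs (a1' * a2 z - a1 z * a2') * fnorm (c1 z, c2 z) =
  abs (Jac P (c1 z) (c2 z)) * abs (c1' * c2 z - c1 z * c2') * fnorm (a1 z, a2 z).
Proof.
move=> d1 d2 e1 e2 F.
have n0 : (0 < n)%N by exact: leq_trans n_ge3.
have dA := cderiv_hev (ratnum P) n0 d1 d2; have dB := cderiv_hev (ratden P) n0 d1 d2.
have dC := cderiv_hev (ratnum P) n0 e1 e2; have dD := cderiv_hev (ratden P) n0 e1 e2.
have E := nearc_id F; rewrite /samefib /= in E.
have D1 := cderivM dA dD; have D2 := cderivM dB dC.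
have {D1 D2}DE := cderiv_uniq (cderiv_ext F D1) D2.
have EA := euler (ratnum P) (a1 z) (a2 z) n0; have EB := euler (ratden P) (a1 z) (a2 z) n0.
have EC := euler (ratnum P) (c1 z) (c2 z) n0; have ED := euler (ratden P) (c1 z) (c2 z) n0.
have nn : n%:R != 0 :> C by rewrite pnatr_eq0 -lt0n.
move: DE E; rewrite /fnorm /= /Jac /numf /denf.
move: EA EB EC ED.
move: (hev (ratnum P) _ (a1 z) _) (hevx (ratnum P) _ (a1 z) _) (hevy (ratnum P) _ (a1 z) _) => A Ax Ay.
move: (hev (ratden P) _ (a1 z) _) (hevx (ratden P) _ (a1 z) _) (hevy (ratden P) _ (a1 z) _) => B Bx By.
move: (hev (ratnum P) _ (c1 z) _) (hevx (ratnum P) _ (c1 z) _) (hevy (ratnum P) _ (c1 z) _) => D Dx Dy.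
move: (hev (ratden P) _ (c1 z) _) (hevx (ratden P) _ (c1 z) _) (hevy (ratden P) _ (c1 z) _) => E Ex Ey.
move: (a1 z) (a2 z) (c1 z) (c2 z) => x1 x2 y1 y2 EA EB ED EE DE F0.
pose A' := Ax * a1' + Ay * a2'; pose B' := Bx * a1' + By * a2'.
pose D' := Dx * c1' + Dy * c2'; pose E' := Ex * c1' + Ey * c2'.
have WA : (Ax * By - Ay * Bx) * (a1' * x2 - x1 * a2') = n%:R * (A' * B - A * B').
  transitivity (A' * (n%:R * B) - (n%:R * A) * B'); last by ring.
  by rewrite EA EB /A' /B'; ring.
have WD : (Dx * Ey - Dy * Ex) * (c1' * y2 - y1 * c2') = n%:R * (D' * E - D * E').
  transitivity (D' * (n%:R * E) - (n%:R * D) * E'); last by ring.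
  by rewrite ED EE /D' /E'; ring.
have G : A' * E + A * E' = B' * D + B * D' by exact: DE.
have q1 : (A' * B - A * B') * E ^+ 2 = (D' * E - D * E') * B ^+ 2.
  apply/eqP; rewrite -subr_eq0; apply/eqP.
  transitivity (B * E * ((A' * E + A * E') - (B' * D + B * D')) - (B * E' + B' * E) * (A * E - B * D)); first by ring.
  by rewrite G F0 !subrr !mulr0 subrr.
have q2 : (A' * B - A * B') * D ^+ 2 = (D' * E - D * E') * A ^+ 2.
  apply/eqP; rewrite -subr_eq0; apply/eqP.
  transitivity (A * D * ((A' * E + A * E') - (B' * D + B * D')) - (A * D' + A' * D) * (A * E - B * D)); first by ring.
  by rewrite G F0 !subrr !mulr0 subrr.
rewrite -!absM WA WD (mulrDr (abs _)) [RHS](mulrDr (abs _)) -!absX -!absM.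
congr (_ + _); congr abs.
  by rewrite -mulrA q2 mulrA.
by rewrite -mulrA q1 mulrA.
Qed.

(** Let [j], [k] be the moduli of [J] and [a], [d] those of the derivatives. Separation bounds the
    square of the wedge by [K^2 (j + k)^2]. Since [j a] and [k d] are comparable, [j^2 a d] and
    [k^2 a d] are bounded by multiples of [j k d^2] and [j k a^2]. *)
Lemma wedge_bound : exists2 K : R, 0 <= K & forall b c t u (dt du : C),
  abs t <= 2 -> abs u <= 2 -> samefib P (chart b t) (chart c u) ->
  J (chart b t) != 0 -> J (chart c u) != 0 ->
  abs (J (chart b t)) * abs dt * fnorm (chart c u) = abs (J (chart c u)) * abs du * fnorm (chart b t) ->
  abs (wedge (chart b t) (chart c u)) ^+ 2 * abs dt * abs du / (abs (J (chart b t)) * abs (J (chart c u)))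
    <= K * (abs dt ^+ 2 + abs du ^+ 2).
Proof.
have [K K0 sepK] := separation simpleP n_ge3; have [L L0 HL] := fnorm_ratio.
exists (K ^+ 2 * (L + 1)); first by rewrite mulr_ge0 ?exprn_ge0 // addr_ge0.
move=> b c t u dt du tt uu F J1 J2 E.
have S := sepK b c t u tt uu F; have S0 := abs_ge0 (wedge (chart b t) (chart c u)).
have N1 := fnorm_gt0 (chart_neq0 b t); have N2 := fnorm_gt0 (chart_neq0 c u).
have L1 := HL b c t u tt uu; have L2 := HL c b u t uu tt.
move: J1 J2 E S N1 N2 L1 L2; rewrite -!abs_gt0.
move: (fnorm (chart b t)) (fnorm (chart c u)) S0 => X Y.
move: (abs (J _)) (abs (J _)) (abs (wedge _ _)) (abs_ge0 dt) (abs_ge0 du).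
move: (abs dt) (abs du) => a d k j W a0 d0 W0 j0 k0 E S X0 Y0 L1 L2.
have e1 : j * a <= L * (k * d).
  rewrite -(ler_pM2r Y0) E; apply: le_trans (ler_wpM2l (mulr_ge0 (ltW k0) d0) L2) _.
  by rewrite le_eqVlt; apply/orP; left; apply/eqP; ring.
have e2 : k * d <= L * (j * a).
  rewrite -(ler_pM2r X0) -E; apply: le_trans (ler_wpM2l (mulr_ge0 (ltW j0) a0) L1) _.
  by rewrite le_eqVlt; apply/orP; left; apply/eqP; ring.
have S2 : W ^+ 2 <= K ^+ 2 * (j + k) ^+ 2 by rewrite -exprMn; exact: sqr_ler.
rewrite ler_pdivrMr ?mulr_gt0 //.
apply: le_trans (_ : _ <= K ^+ 2 * (j + k) ^+ 2 * (a * d)) _.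
  by rewrite -mulrA ler_wpM2r // mulr_ge0.
have m1 : j * a * (j * d) <= L * (k * d) * (j * d) by rewrite ler_wpM2r // mulr_ge0 // ltW.
have m2 : k * d * (k * a) <= L * (j * a) * (k * a) by rewrite ler_wpM2r // mulr_ge0 // ltW.
have m3 : 0 <= j * k * (a - d) ^+ 2 by rewrite mulr_ge0 ?sqr_ge0 // mulr_ge0 // ltW.
have main : (j + k) ^+ 2 * (a * d) <= (L + 1) * ((a ^+ 2 + d ^+ 2) * (j * k)).
  have -> : (j + k) ^+ 2 * (a * d) = j * a * (j * d) + k * d * (k * a) + 2 * (j * k * (a * d)) by ring.
  have -> : (L + 1) * ((a ^+ 2 + d ^+ 2) * (j * k)) = L * (k * d) * (j * d) + L * (j * a) * (k * a)
     + (j * k * (a - d) ^+ 2 + 2 * (j * k * (a * d))) by ring.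
  by rewrite lerD //; [rewrite lerD|rewrite lerDr].
have K2 : 0 <= K ^+ 2 by exact: exprn_ge0.
apply: le_trans (_ : _ <= K ^+ 2 * ((L + 1) * ((a ^+ 2 + d ^+ 2) * (j * k)))) _.
  have := ler_wpM2l K2 main; apply: le_trans.
  by rewrite le_eqVlt; apply/orP; left; apply/eqP; ring.
by rewrite le_eqVlt; apply/orP; left; apply/eqP; ring.
Qed.

(** [sel b] is the coordinate that equals 1 in [chart b], and [oth b] is the chart coordinate. *)
Definition sel b x := if b then x.2 else x.1.
Definition oth b x := if b then x.1 else x.2.
(* The degree of the monomials for which [theta] is invariant under rescaling of [x] and [y]. *)
Definition deg2 := (2 * n - 6)%N.
(** Of all monomials only the pure powers of a coordinate and their neighbours are kept. In
    [chart b] they read 1 and [t], which is enough to recover [t] as a quotient. *)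
Definition mono b (k : bool) x := sel b x ^+ (deg2 - k) * oth b x ^+ k.

Definition theta i x wx y wy : C := let: (b, c, k, l) := i in
  mono b k x * mono c l y * wedge x y ^+ 2 * wx * wy / (J x * J y).

End QuadraticDifferential.

(** * Lifts, charts and invariance of the differential *)

Section LiftedDifferential.
Variable R : realType.
Local Notation C := R[i].
Implicit Types (f g : C -> CP1 R) (z w u v t : C) (b c : bool) (x y : C * C).

Definition wrd (a1 a2 : C -> C) z : C := Dc a1 z * a2 z - a1 z * Dc a2 z.

(** Two lifts differ by a unit, of which only the value at [z] is produced; differentiating the
    proportionality of the lifts gives the factor [u^2] of the Wronskians. *)
Lemma lift_scale f z (a1 a2 b1 b2 : C -> C) : lift f z a1 a2 -> lift f z b1 b2 ->
  exists u, [/\ u != 0, a1 z = u * b1 z, a2 z = u * b2 z & wrd a1 a2 z = u ^+ 2 * wrd b1 b2 z].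
Proof.
move=> La Lb; have [da1 da2 an fa] := nearc_id La; have [db1 db2 bn fb] := nearc_id Lb.
have E : nearc z (fun w => a1 w * b2 w = a2 w * b1 w).
  by apply: nearcW (nearc_and La Lb) => w [[_ _ ha ->] [_ _ hb]] /pt_eq; apply.
have D1 := cderivM (DcP da1) (DcP db2); have D2 := cderivM (DcP da2) (DcP db1).
have := cderiv_uniq (cderiv_ext E D1) D2; have := nearc_id E.
rewrite /wrd; move: (Dc a1 z) (Dc a2 z) (Dc b1 z) (Dc b2 z) => x1 x2 y1 y2.
move: (a1 z) (a2 z) (b1 z) (b2 z) an bn => p1 p2 q1 q2 an bn E0 E1.
have [q20|q20] := eqVneq q2 0.
  have q10 : q1 != 0 by move: bn; rewrite q20 eqxx orbF.
  have p20 : p2 = 0 by apply/eqP; move/eqP: E0; rewrite q20 mulr0 eq_sym mulf_eq0 (negbTE q10) orbF.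
  have p10 : p1 != 0 by move: an; rewrite p20 eqxx orbF.
  exists (p1 / q1); split; first by rewrite mulf_neq0 ?invr_eq0.
  - by rewrite divfK.
  - by rewrite p20 q20 mulr0.
  move: E1; rewrite p20 q20 !mulr0 mul0r add0r addr0 !sub0r => E1.
  apply: (mulIf q10); rewrite mulNr -mulrA -E1; field; exact: q10.
have p20 : p2 != 0.
  apply: contraTneq an => p20; move/eqP: E0; rewrite p20 mul0r mulf_eq0 (negbTE q20) orbF => /eqP ->.
  by rewrite eqxx.
exists (p2 / q2); split; first by rewrite mulf_neq0 ?invr_eq0.
- by apply: (mulIf q20); rewrite E0; field.
- by rewrite divfK.
have pE : p1 = p2 * q1 / q2 by rewrite -E0 mulfK.
have xE : x1 = (x2 * q1 + p2 * y1 - p1 * y2) / q2 by rewrite -E1 addrK mulfK.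
by rewrite xE pE; field.
Qed.

Definition on_chart b (phi : C -> C) f z := nearc z (fun w => [/\ diffc phi w &
  f w = pt (chart b (phi w)).1 (chart b (phi w)).2]).

Lemma chart_lift f z : liftable f -> exists b phi, on_chart b phi f z /\ abs (phi z) <= 1.
Proof.
move=> /(_ z) [a1 [a2 L]]; have [da1 da2 an fz] := nearc_id L.
have main b (d e : C -> C) : diffc d z -> diffc e z -> abs (d z) <= abs (e z) -> (d z != 0) || (e z != 0) ->
    nearc z (fun w => [/\ diffc d w, diffc e w & e w != 0 ->
       f w = pt (chart b (d w * (e w)^-1)).1 (chart b (d w * (e w)^-1)).2]) ->
    exists b phi, on_chart b phi f z /\ abs (phi z) <= 1.
  move=> dd de le0 nz H; have ez : e z != 0.
    apply: contraTneq nz => e0; rewrite e0 eqxx orbF negbK -abs_eq0 eq_le abs_ge0 andbT.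
    by move: le0; rewrite e0 abs0.
  exists b, (fun w => d w * (e w)^-1); split.
    apply: nearcW (nearc_and H (nearc_neq0 (diffc_cont de) ez)) => w [[dw ew fw] e0].
    by split; [apply: diffcM => //; exact: diffcV|exact: fw].
  by rewrite absM absV ler_pdivrMr ?abs_gt0 // mul1r.
have [le12|/ltW le21] := leP (abs (a1 z)) (abs (a2 z)).
  apply: (main true a1 a2) => //; apply: nearcW L => w [d1 d2 nn ->]; split=> // e0 /=.
  by rewrite -[LHS](pt_scale _ _ (_ : (a2 w)^-1 != 0)) ?invr_eq0 // mulrC mulVf.
apply: (main false a2 a1) => //; first by rewrite orbC.
apply: nearcW L => w [d1 d2 nn ->]; split=> // e0 /=.
by rewrite -[LHS](pt_scale _ _ (_ : (a1 w)^-1 != 0)) ?invr_eq0 // mulVf // mulrC.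
Qed.

(** The Wronskian of a lift is [t'] for [(t, 1)] and [- t'] for [(1, t)]. *)
Definition csign b : C := if b then 1 else -1.

Lemma chart_on b phi f z : on_chart b phi f z ->
  lift f z (fun w => (chart b (phi w)).1) (fun w => (chart b (phi w)).2) /\
  wrd (fun w => (chart b (phi w)).1) (fun w => (chart b (phi w)).2) z = csign b * Dc phi z.
Proof.
move=> H; have [dphi _] := nearc_id H; split.
  apply: nearcW H => w [dw fw]; split; [| |exact: chart_neq0|exact: fw].
    by case: (b) => /=; [exact: dw|exact: diffc_cst].
  by case: (b) => /=; [exact: diffc_cst|exact: dw].
have D1 z0 : Dc (fun=> 1 : C) z0 = 0 by apply: DcE; exact: cderiv_cst.
by rewrite /wrd /csign; case: (b) => /=; rewrite D1; ring.
Qed.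

Lemma on_chart_near b phi f z : on_chart b phi f z -> nearc z (on_chart b phi f).
Proof. exact: nearc_near. Qed.

Definition vscale u x : C * C := (u * x.1, u * x.2).

Variable P : ratfun R.
Hypothesis simpleP : forall s, critical_value P s -> simple_critical_value P s.
Hypothesis n_ge4 : (3 < ratdeg P)%N.
Implicit Types (i : bool * bool * bool * bool).

Let n_ge3 : (2 < ratdeg P)%N. Proof. exact: ltnW. Qed.
Local Notation n := (ratdeg P).
Local Notation J x := (Jac P x.1 x.2).
Local Notation N := (deg2 P).

Lemma deg2_ge2 : (1 < N)%N. Proof. by rewrite /deg2; lia. Qed.

Lemma mono_scale u b k x : mono P b k (vscale u x) = u ^+ N * mono P b k x.
Proof.
have kN : (k <= N)%N by have := deg2_ge2; case: k => //; lia.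
have -> : u ^+ N = u ^+ (N - k) * u ^+ k by rewrite -exprD subnK.
by rewrite /mono /vscale /sel /oth; case: (b) => /=; rewrite !exprMn mulrACA.
Qed.

(** The exponents of [u] balance: [N] from the monomial, 2 from the squared wedge and 2 from the
    Wronskian add up to the degree [2 n - 2] of [J]; likewise for [v]. *)
Lemma theta_scale i u v x y wx wy : u != 0 -> v != 0 ->
  theta P i (vscale u x) (u ^+ 2 * wx) (vscale v y) (v ^+ 2 * wy) = theta P i x wx y wy.
Proof.
case: i => [[[b c] k] l] u0 v0; rewrite /theta !mono_scale {3}/vscale {3}/vscale /= !Jac_scale.
have -> : wedge (vscale u x) (vscale v y) = u * v * wedge x y by rewrite /wedge /=; ring.
have -> : (2 * n.-1 = N + 4)%N by rewrite /deg2; lia.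
rewrite !exprD.
have [uN vN] : u ^+ N != 0 /\ v ^+ N != 0 by rewrite !expf_neq0.
move: (mono P b k x) (mono P c l y) (J x) (J y) (wedge x y) (u ^+ N) (v ^+ N) uN vN => m1 m2 j1 j2 w U V U0 V0.
have [->|j10] := eqVneq j1 0; first by rewrite !(mulr0, mul0r, invr0).
have [->|j20] := eqVneq j2 0; first by rewrite !(mulr0, mul0r, invr0).
by field; rewrite u0 v0 U0 V0 j10 j20.
Qed.

Lemma mono_le b b' (k : bool) t (M : R) : 1 <= M -> abs t <= M -> abs (mono P b k (chart b' t)) <= M ^+ N.
Proof.
move=> M1 tM; have kN : (k <= N)%N by have := deg2_ge2; case: k => //; lia.
have M0 : 0 <= M by exact: le_trans M1.
have -> : M ^+ N = M ^+ (N - k) * M ^+ k by rewrite -exprD subnK.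
have s : abs (sel b (chart b' t)) <= M /\ abs (oth b (chart b' t)) <= M.
  by rewrite /sel /oth; case: (b); case: b' => /=; rewrite ?abs1.
rewrite /mono absM !absX; apply: ler_pM; rewrite ?exprn_ge0 ?abs_ge0 //.
  by apply: lerXn2r; rewrite ?nnegrE ?abs_ge0 //; case: s.
by apply: lerXn2r; rewrite ?nnegrE ?abs_ge0 //; case: s.
Qed.

Lemma theta_bound : exists2 K : R, 0 <= K & forall i b c t u (dt du : C) (M : R),
  1 <= M -> M <= 2 -> abs t <= M -> abs u <= M -> samefib P (chart b t) (chart c u) ->
  J (chart b t) != 0 -> J (chart c u) != 0 ->
  abs (J (chart b t)) * abs dt * fnorm P (chart c u) = abs (J (chart c u)) * abs du * fnorm P (chart b t) ->
  abs (theta P i (chart b t) dt (chart c u) du) <= K * (abs dt ^+ 2 + abs du ^+ 2).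
Proof.
have [K K0 H] := wedge_bound simpleP n_ge3.
exists (2 ^+ N * 2 ^+ N * K); first by rewrite !mulr_ge0 ?exprn_ge0.
move=> [[[b0 c0] k] l] b c t u dt du M M1 M2 tM uM F J1 J2 E.
have t2 := le_trans tM M2; have u2 := le_trans uM M2.
have S := H b c t u dt du t2 u2 F J1 J2 E.
have m1 : abs (mono P b0 k (chart b t)) <= 2 ^+ N by apply: mono_le t2; rewrite ler1n.
have m2 : abs (mono P c0 l (chart c u)) <= 2 ^+ N by apply: mono_le u2; rewrite ler1n.
rewrite /theta -(mulrA _ dt) -!(mulrA (_ * _) (wedge _ _ ^+ 2)) -(mulrA (mono _ _ _ _ * _)) absM.
set X := wedge _ _ ^+ 2 * _ / _.
have XE : abs X = abs (wedge (chart b t) (chart c u)) ^+ 2 * abs dt * abs du / (abs (J (chart b t)) * abs (J (chart c u))).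
  by rewrite /X (absM _ (_)^-1) absV (absM (J _)) (absM (_ ^+ 2)) (absM dt) absX mulrA.
rewrite -XE in S; rewrite (absM (mono _ _ _ _)) -(mulrA _ K).
apply: ler_pM S; rewrite ?mulr_ge0 ?abs_ge0 //.
by apply: ler_pM; rewrite ?abs_ge0.
Qed.

Lemma diffc_theta i (x1 x2 wx y1 y2 wy : C -> C) z :
  diffc x1 z -> diffc x2 z -> diffc wx z -> diffc y1 z -> diffc y2 z -> diffc wy z ->
  Jac P (x1 z) (x2 z) != 0 -> Jac P (y1 z) (y2 z) != 0 ->
  diffc (fun w => theta P i (x1 w, x2 w) (wx w) (y1 w, y2 w) (wy w)) z.
Proof.
case: i => [[[b c] k] l] dx1 dx2 dwx dy1 dy2 dwy J1 J2; rewrite /theta /=.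
have dm b' (k' : bool) a1 a2 : diffc a1 z -> diffc a2 z -> diffc (fun w => mono P b' k' (a1 w, a2 w)) z.
  by move=> d1 d2; rewrite /mono /sel /oth; case: b' => /=; apply: diffcM; exact: diffcX.
have dw : diffc (fun w => wedge (x1 w, x2 w) (y1 w, y2 w)) z.
  by rewrite /wedge /=; apply: diffcB; exact: diffcM.
have dJ : diffc (fun w => Jac P (x1 w) (x2 w) * Jac P (y1 w) (y2 w)) z.
  by apply: diffcM; exact: diffc_Jac_comp.
apply: diffcM; last by apply: (diffcV _ dJ); rewrite mulf_neq0.
do 2 (apply: diffcM => //); apply: diffcM; last exact: (diffcX 2 dw).
by apply: diffcM; exact: dm.
Qed.

End LiftedDifferential.

(** * Extension of the differentials to entire functions *)

Section EntireDifferential.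
Variable R : realType.
Local Notation C := R[i].
Variable P : ratfun R.
Hypothesis simpleP : forall s, critical_value P s -> simple_critical_value P s.
Hypothesis n_ge4 : (3 < ratdeg P)%N.
Variables (f g : C -> CP1 R) (F1 F2 G1 G2 : C -> C -> C).
Hypothesis LF : forall z, lift f z (F1 z) (F2 z).
Hypothesis LG : forall z, lift g z (G1 z) (G2 z).
Hypotheses (nf : nonconstant f) (ng : nonconstant g).
Hypothesis fg_neq : exists z, f z <> g z.
Hypothesis fg_fib : forall z, ratmap P (f z) = ratmap P (g z).
Implicit Types (z w u v t : C) (b c : bool) (x y : C * C) (i : bool * bool * bool * bool).

Let n_ge3 : (2 < ratdeg P)%N. Proof. exact: ltnW. Qed.
Local Notation J x := (Jac P x.1 x.2).

Let lf : liftable f. Proof. by move=> z; exists (F1 z), (F2 z). Qed.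
Let lg : liftable g. Proof. by move=> z; exists (G1 z), (G2 z). Qed.

(* The section's quadratic differentials along the pair [(f, g)]; independent of the choice of the lifts. *)
Definition th i z := theta P i (F1 z z, F2 z z) (wrd (F1 z) (F2 z) z) (G1 z z, G2 z z) (wrd (G1 z) (G2 z) z).
Definition good z := (Jac P (F1 z z) (F2 z z) != 0) && (Jac P (G1 z z) (G2 z z) != 0).

Lemma th_lift i z (a1 a2 c1 c2 : C -> C) : lift f z a1 a2 -> lift g z c1 c2 ->
  th i z = theta P i (a1 z, a2 z) (wrd a1 a2 z) (c1 z, c2 z) (wrd c1 c2 z).
Proof.
move=> La Lc; have [u [u0 e1 e2 e3]] := lift_scale (LF z) La.
have [v [v0 e4 e5 e6]] := lift_scale (LG z) Lc.
by rewrite /th e1 e2 e3 e4 e5 e6; exact: (theta_scale n_ge4 i (a1 z, a2 z) (c1 z, c2 z) _ _ u0 v0).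
Qed.

Lemma good_lift z (a1 a2 c1 c2 : C -> C) : lift f z a1 a2 -> lift g z c1 c2 ->
  good z = (Jac P (a1 z) (a2 z) != 0) && (Jac P (c1 z) (c2 z) != 0).
Proof.
move=> La Lc; have [u [u0 e1 e2 _]] := lift_scale (LF z) La.
have [v [v0 e4 e5 _]] := lift_scale (LG z) Lc.
by rewrite /good e1 e2 e4 e5 !Jac_scale !mulf_eq0 !negb_or !expf_neq0.
Qed.

Lemma lift_samefib z (a1 a2 c1 c2 : C -> C) : lift f z a1 a2 -> lift g z c1 c2 ->
  nearc z (fun w => samefib P (a1 w, a2 w) (c1 w, c2 w)).
Proof.
move=> La Lc; apply: nearcW (nearc_and La Lc) => w [[_ _ an fw] [_ _ cn gw]].
by rewrite /samefib /=; apply/ratmap_eq => //; rewrite -fw -gw.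
Qed.

(** If the Wronskian were the zero polynomial, so would be its derivative, which is twice the
    expression shown to be nonzero at critical points by [crit_simple_fin]. *)
Lemma wr_neq0 : wr P != 0.
Proof.
apply/eqP => w0; have := crit_simple_fin simpleP n_ge3 (_ : (wr P).[0] = 0).
rewrite w0 horner0 => /(_ erefl) /eqP; apply.
have : (wr P)^`() = 0 by rewrite w0 deriv0.
rewrite /wr derivB !derivM !deriv2_nderivn => E.
have : ((ratnum P)^`N(2) * ratden P - ratnum P * (ratden P)^`N(2)) *+ 2 = 0.
  rewrite -E; move: (ratnum P)^`N(2) (ratden P)^`N(2) (ratnum P) (ratden P) (ratnum P)^`() (ratden P)^`().
  by move=> a b c d a' b'; ring.
move=> /(congr1 (fun h : {poly C} => h.[0])); rewrite hornerMn horner0 => /eqP.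
by rewrite mulrn_eq0 /= => /eqP.
Qed.

(** Infinity is listed whether it is critical or not; only finiteness of the list matters. *)
Lemma crit_finite x : (x.1 != 0) || (x.2 != 0) -> J x = 0 ->
  pt x.1 x.2 \in None :: map Some (proots (wr P)).
Proof.
move=> xn J0; rewrite /pt; case: eqVneq => [_|x2]; first by rewrite inE eqxx.
rewrite inE /= mem_map; last by move=> ? ? [].
rewrite mem_proots ?wr_neq0 //; move/eqP: J0; rewrite Jac_affine // !mulf_eq0 (negbTE (expf_neq0 _ x2)) /=.
by rewrite pnatr_eq0 -[(_ == _)%N]negbK -lt0n (leq_trans _ n_ge4).
Qed.

Lemma avoid_seq h (s : seq (CP1 R)) z : liftable h -> nonconstant h ->
  nearc z (fun w => w != z -> h w \notin s).
Proof.
move=> lh nh; elim: s => [|a s IH]; first by apply: nearc_all.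
apply: nearcW (nearc_and (level_discrete a lh nh z) IH) => w [h1 h2] wz.
by rewrite inE negb_or h2 // andbT; apply/eqP; exact: h1.
Qed.

Lemma generic z : nearc z (fun w => w != z -> good w /\ f w <> g w).
Proof.
have [fgE|dfg] := liftable_eq lf lg; first by case: fg_neq => w; rewrite fgE.
pose s := None :: map Some (proots (wr P)).
have Af := @avoid_seq f s z lf nf; have Ag := @avoid_seq g s z lg ng.
apply: nearcW (nearc_and (dfg z) (nearc_and Af Ag)) => w [h1 [h2 h3]] wz.
split; last exact: h1.
have [_ _ fn fE] := nearc_id (LF w); have [_ _ gn gE] := nearc_id (LG w).
rewrite /good; apply/andP; split; apply/eqP => J0.
  by move/negP: (h2 wz); apply; rewrite fE; exact: (crit_finite (x := (_, _)) fn J0).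
by move/negP: (h3 wz); apply; rewrite gE; exact: (crit_finite (x := (_, _)) gn J0).
Qed.

Lemma th_chart i z b c phi gam : on_chart b phi f z -> on_chart c gam g z ->
  th i z = theta P i (chart b (phi z)) (csign R b * Dc phi z) (chart c (gam z)) (csign R c * Dc gam z).
Proof.
move=> Hf Hg; have [Lf Wf] := chart_on Hf; have [Lg Wg] := chart_on Hg.
by rewrite (th_lift i Lf Lg) Wf Wg; case: (b); case: (c).
Qed.

Lemma good_chart z b c phi gam : on_chart b phi f z -> on_chart c gam g z ->
  good z = (J (chart b (phi z)) != 0) && (J (chart c (gam z)) != 0).
Proof.
by move=> /chart_on [Lf _] /chart_on [Lg _]; rewrite (good_lift Lf Lg).
Qed.

Lemma chart_relation z b c phi gam : on_chart b phi f z -> on_chart c gam g z ->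
  samefib P (chart b (phi z)) (chart c (gam z)) /\
  abs (J (chart b (phi z))) * abs (csign R b * Dc phi z) * fnorm P (chart c (gam z)) =
  abs (J (chart c (gam z))) * abs (csign R c * Dc gam z) * fnorm P (chart b (phi z)).
Proof.
move=> Hf Hg; have [Lf Wf] := chart_on Hf; have [Lg Wg] := chart_on Hg.
have S := lift_samefib Lf Lg.
have [df1 df2 _ _] := nearc_id Lf; have [dg1 dg2 _ _] := nearc_id Lg.
split; first by have := nearc_id S; case: (b); case: (c).
have := fibre_wronskian n_ge3 (DcP df1) (DcP df2) (DcP dg1) (DcP dg2) S.
rewrite -/(wrd _ _ z) -/(wrd (fun w => (chart c (gam w)).1) _ z) Wf Wg.
by case: (b); case: (c).
Qed.

Lemma diffc_th i z : good z -> diffc (th i) z /\ nearc z good.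
Proof.
move=> gz; have [b [phi [Hf _]]] := chart_lift z lf; have [c [gam [Hg _]]] := chart_lift z lg.
have [[Lf _] [Lg _]] := (chart_on Hf, chart_on Hg).
have Nn := nearc_and (on_chart_near Hf) (on_chart_near Hg).
move: (gz); rewrite (good_chart Hf Hg) => /andP[J1 J2].
have dphi : nearc z (diffc phi) by apply: nearcW Hf => w [].
have dgam : nearc z (diffc gam) by apply: nearcW Hg => w [].
have [df1 df2 _ _] := nearc_id Lf; have [dg1 dg2 _ _] := nearc_id Lg.
split.
  apply: (@diffc_ext _ (fun w => theta P i ((chart b (phi w)).1, (chart b (phi w)).2) (csign R b * Dc phi w) ((chart c (gam w)).1, (chart c (gam w)).2) (csign R c * Dc gam w))).
    by apply: nearcW Nn => w [h1 h2]; rewrite (th_chart i h1 h2); case: (b); case: (c).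
  apply: diffc_theta => //; apply: diffcM; try exact: diffc_cst; exact: Dc_diffc.
have n1 := nearc_neq0 (diffc_cont (diffc_Jac_comp P df1 df2)) J1.
have n2 := nearc_neq0 (diffc_cont (diffc_Jac_comp P dg1 dg2)) J2.
by apply: nearcW (nearc_and Nn (nearc_and n1 n2)) => w [[h1 h2] [h3 h4]]; rewrite (good_chart h1 h2) h3.
Qed.

(** The chart coordinates have modulus at most 1 at [z], hence at most 2 nearby; this is why the
    estimates in charts are made for radius 2. *)
Lemma th_bounded i z : exists2 r : R, 0 < r & exists M, forall w, abs (w - z) < r -> w != z ->
  [/\ good w, diffc (th i) w & abs (th i w) <= M].
Proof.
have [b [phi [Hf phi1]]] := chart_lift z lf; have [c [gam [Hg gam1]]] := chart_lift z lg.
have Nn := nearc_and (on_chart_near Hf) (on_chart_near Hg).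
have dphi : nearc z (diffc phi) by apply: nearcW Hf => w [].
have dgam : nearc z (diffc gam) by apply: nearcW Hg => w [].
have B1 := cont_bounded (diffc_cont (nearc_id dphi)); have B2 := cont_bounded (diffc_cont (nearc_id dgam)).
have B3 := cont_bounded (diffc_cont (Dc_diffc dphi)); have B4 := cont_bounded (diffc_cont (Dc_diffc dgam)).
have [K K0 HK] := theta_bound simpleP n_ge4.
have [r r0 H] := nearc_and (generic z) (nearc_and Nn (nearc_and (nearc_and B1 B2) (nearc_and B3 B4))).
exists r => //; exists (K * ((abs (Dc phi z) + 1) ^+ 2 + (abs (Dc gam z) + 1) ^+ 2)) => w wr wz.
have [/(_ wz) [gw _] [[Hf' Hg'] [[b1 b2] [b3 b4]]]] := H w wr.
have [dth _] := diffc_th i gw; split=> //.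
move: (gw); rewrite (good_chart Hf' Hg') (th_chart i Hf' Hg') => /andP[J1 J2].
have [S E] := chart_relation Hf' Hg'.
have le2 (a d : R) : a <= 1 -> d <= a + 1 -> d <= 2 by move=> a1 da; exact: le_trans da (lerD a1 (lexx 1)).
have two : 1 <= 2 :> R by rewrite ler1n.
apply: le_trans (HK i b c _ _ _ _ 2 two (lexx _) (le2 _ _ phi1 b1) (le2 _ _ gam1 b2) S J1 J2 E) _.
have cs b' (d : C) : abs (csign R b' * d) = abs d.
  by rewrite /csign; case: b'; rewrite ?mul1r ?mulN1r ?absN.
by rewrite ler_wpM2l // !cs lerD // sqr_ler ?abs_ge0.
Qed.

Lemma th_extension i : exists Th : C -> C, (forall z, diffc Th z) /\ (forall z, good z -> Th z = th i z).
Proof.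
have : forall z, exists v, diffc (fun w => if w == z then v else th i w) z.
  move=> z; have [r r0 [M H]] := th_bounded i z.
  by apply: (removable (M := M) r0) => w wr wz; have [] := H w wr wz.
(* Where [J] vanishes along [f] or [g], the quotient defining [th] is a division by zero and is
   replaced by the limit value. *)
move=> /choice [v Hv]; exists (fun z => if good z then th i z else v z); split; last by move=> z ->.
move=> z; have [gz|gz] := boolP (good z).
  have [d gn] := diffc_th i gz; apply: diffc_ext d.
  by apply: nearcW gn => w ->.
apply: diffc_ext (Hv z); apply: nearcW (generic z) => w H.
by case: eqVneq => [->|/H [-> _]//]; rewrite (negbTE gz).
Qed.

End EntireDifferential.

(** * The rescaling argument *)

Section Rescaling.
Variable R : realType.
Local Notation C := R[i].
Implicit Types (z w : C).

(* Applied at a point where [(rho - |z - z0|)^2 S] almost attains its supremum. *)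
Lemma rescaling (S : C -> R) (G : C -> Prop) (K : R) : 0 <= K -> (forall z, 0 <= S z) ->
  (forall z, exists M, nearc z (fun w => S w <= M)) ->
  (forall z, 0 < S z -> nearc z (fun w => S z / 2 < S w)) ->
  (forall z, nearc z (fun w => w != z -> G w)) ->
  (forall z r, G z -> 0 < r -> (forall w, abs (w - z) < r -> S w <= 32 * S z) -> S z * r ^+ 2 <= K) ->
  forall z, S z = 0.
Proof.
move=> K0 S0 SB SL GN H z; apply/eqP; rewrite eq_le S0 andbT leNgt; apply/negP => Sz.
suff main (rho : R) : 0 < rho -> S z * rho ^+ 2 <= 32 * K.
  (* For this radius [S z * rho = 32 K + S z] already exceeds the bound. *)
  pose rho := 32 * K / S z + 1.
  have q0 : 0 <= 32 * K / S z by rewrite divr_ge0 ?mulr_ge0 // ltW.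
  have rho1 : 1 <= rho by rewrite /rho; move: q0; clear; lra.
  have := main rho (lt_le_trans ltr01 rho1).
  have : S z * rho <= S z * rho ^+ 2.
    by rewrite ler_wpM2l // expr2 ler_peMl // (le_trans ler01).
  have -> : S z * rho = 32 * K + S z by rewrite /rho; field; rewrite gt_eqF.
  by move: Sz; clear; lra.
move=> rho0; pose d w := rho - abs (w - z); pose T w := d w ^+ 2 * S w.
pose A := [set T w | w in [set w | abs (w - z) < rho]].
have d_rho w : d w <= rho by rewrite /d lerBlDr lerDl abs_ge0.
have TA w : abs (w - z) < rho -> A (T w) by move=> h; exists w.
have [M HM] := locally_bounded (abs z + rho) SB.
have UB : ubound A (rho ^+ 2 * M).
  move=> _ [w /= wr <-]; rewrite /T; apply: ler_pM => //; first exact: sqr_ge0.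
    by apply: sqr_ler => //; rewrite /d; apply/ltW; rewrite subr_gt0.
  apply: HM; have := abs_subD w z 0; rewrite !subr0 => h; apply: le_trans h _.
  by rewrite addrC lerD2l ltW.
have Tz : T z = S z * rho ^+ 2 by rewrite /T /d subrr abs0 subr0 mulrC.
have hA : has_sup A.
  by split; [exists (T z); apply: TA; rewrite subrr abs0|exists (rho ^+ 2 * M)].
set s := sup A.
have leS w : abs (w - z) < rho -> T w <= s by move=> h; apply: ub_le_sup; [case: hA|exact: TA].
have Tzs : T z <= s by apply: leS; rewrite subrr abs0.
have s0 : 0 < s by apply: lt_le_trans Tzs; rewrite Tz mulr_gt0 // exprn_gt0.
have s2 : 0 < s / 2 by rewrite divr_gt0.
have [_ [z1 /= z1r <-] hT1] := sup_adherent s2 hA.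
have T1 : s / 2 < T z1 by move: hT1; rewrite -/s; clear; lra.
have d1 : 0 < d z1 by rewrite /d subr_gt0.
have S1 : 0 < S z1.
  have := lt_trans s2 T1; rewrite /T pmulr_rgt0 //; by rewrite exprn_gt0.
have near_d : nearc z1 (fun w => abs (w - z1) < d z1 / 4).
  by exists (d z1 / 4) => //; rewrite divr_gt0.
(* The near-maximal point [z1] may lie outside [G]. Moving to a nearby point [z0] of [G] costs a
   factor 2 in [S] and 3/4 in [d]; as [9 / 32 * s / 2 >= s / 8], the product stays at least
   [s / 8]. *)
have [z0 nz0 [[S01 dz0] /(_ nz0) Gz0]] := near_other (nearc_and (nearc_and (SL _ S1) near_d) (GN z1)).
have d0 : 3 / 4 * d z1 <= d z0.
  by have := abs_subD z0 z1 z; move: dz0; rewrite /d; clear; lra.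
have d0p : 0 < d z0 by move: d0 d1; clear; lra.
have T0 : s / 8 <= d z0 ^+ 2 * S z0.
  have h1 : (3 / 4 * d z1) ^+ 2 <= d z0 ^+ 2 by apply: sqr_ler d0; move: d1; clear; lra.
  have h2 : (3 / 4 * d z1) ^+ 2 * (S z1 / 2) <= d z0 ^+ 2 * S z0.
    by apply: ler_pM => //; [exact: sqr_ge0|rewrite divr_ge0|exact: ltW].
  apply: le_trans h2; rewrite exprMn (_ : _ * _ = 9 / 32 * T z1); last by rewrite /T; field.
  by move: T1 s0; clear; lra.
have r0 : 0 < d z0 / 2 by rewrite divr_gt0.
have : S z0 * (d z0 / 2) ^+ 2 <= K.
  apply: H => // w wz0.
  (* On the disc of radius [d z0 / 2] the weight loses at most half, so
     [S w <= 4 s / (d z0)^2 <= 32 S z0]: this is the origin of 32. *)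
  have dw : d z0 / 2 <= d w by have := abs_subD w z0 z; move: wz0; rewrite /d; clear; lra.
  have wr : abs (w - z) < rho by rewrite -subr_gt0 -/(d w); exact: lt_le_trans dw.
  have h1 : (d z0 / 2) ^+ 2 <= d w ^+ 2 by apply: sqr_ler dw; exact: ltW.
  have h2 : (d z0 / 2) ^+ 2 * S w <= s.
    by apply: le_trans (leS _ wr); rewrite /T ler_wpM2r.
  rewrite -(ler_pM2l (exprn_gt0 2 r0)); apply: le_trans h2 _.
  have -> : (d z0 / 2) ^+ 2 * (32 * S z0) = 8 * (d z0 ^+ 2 * S z0) by field.
  by move: T0; clear; lra.
have -> : S z0 * (d z0 / 2) ^+ 2 = (d z0 ^+ 2 * S z0) / 4 by field.
by move: T0 Tzs; rewrite Tz; clear; lra.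
Qed.

End Rescaling.

(** * Vanishing of all the entire differentials *)

Section NoEntireDifferential.
Variable R : realType.
Local Notation C := R[i].
Variable P : ratfun R.
Hypothesis simpleP : forall s, critical_value P s -> simple_critical_value P s.
Hypothesis n_ge4 : (3 < ratdeg P)%N.
Variables (f g : C -> CP1 R) (F1 F2 G1 G2 : C -> C -> C).
Hypothesis LF : forall z, lift f z (F1 z) (F2 z).
Hypothesis LG : forall z, lift g z (G1 z) (G2 z).
Hypotheses (nf : nonconstant f) (ng : nonconstant g).
Hypothesis fg_neq : exists z, f z <> g z.
Hypothesis fg_fib : forall z, ratmap P (f z) = ratmap P (g z).
Implicit Types (z w u v t : C) (b c : bool) (x y : C * C) (i : bool * bool * bool * bool).

Let n_ge3 : (2 < ratdeg P)%N. Proof. exact: ltnW. Qed.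
Local Notation J x := (Jac P x.1 x.2).

Let lf : liftable f. Proof. by move=> z; exists (F1 z), (F2 z). Qed.
Let lg : liftable g. Proof. by move=> z; exists (G1 z), (G2 z). Qed.

Local Notation th := (th P F1 F2 G1 G2).
Local Notation good := (good P F1 F2 G1 G2).

Lemma mono_chart b (k : bool) t : mono P b k (chart b t) = t ^+ k.
Proof. by rewrite /mono /sel /oth /chart; case: b => /=; rewrite expr1n mul1r. Qed.

Lemma theta_chart b c (k l : bool) t u dt du :
  theta P (b, c, k, l) (chart b t) dt (chart c u) du =
  t ^+ k * u ^+ l * theta P (b, c, false, false) (chart b t) dt (chart c u) du.
Proof. by rewrite /theta !mono_chart !expr0 !mul1r !mulrA. Qed.

(** In the charts [b] and [c] the monomial with index [(b, c, false, false)] is 1, and any other is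
    at most 1 when both coordinates are. *)
Lemma theta_le i b c t u dt du : abs t <= 1 -> abs u <= 1 ->
  abs (theta P i (chart b t) dt (chart c u) du) <=
  abs (theta P (b, c, false, false) (chart b t) dt (chart c u) du).
Proof.
case: i => [[[b' c'] k] l] t1 u1.
have -> : theta P (b', c', k, l) (chart b t) dt (chart c u) du =
    mono P b' k (chart b t) * mono P c' l (chart c u) * theta P (b, c, false, false) (chart b t) dt (chart c u) du.
  by rewrite /theta (mono_chart b false) (mono_chart c false) !expr0 !mul1r !mulrA.
rewrite absM ler_piMl ?abs_ge0 // absM mulr_ile1 ?abs_ge0 //.
  by have := mono_le n_ge4 b' b k (lexx 1) t1; rewrite expr1n.
by have := mono_le n_ge4 c' c l (lexx 1) u1; rewrite expr1n.
Qed.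

Local Notation I := (bool * bool * bool * bool)%type.

Section Bound.
Variable Th : I -> C -> C.
Hypothesis dTh : forall i z, diffc (Th i) z.
Hypothesis ThE : forall i z, good z -> Th i z = th i z.

Local Ltac slra := clear -simpleP n_ge4 LF LG nf ng fg_neq fg_fib n_ge3 lf lg Th dTh ThE; lra.

Definition size_th z : R := \sum_(i : I) abs (Th i z).

Lemma size_th_ge0 z : 0 <= size_th z.
Proof. by apply: sumr_ge0 => i _; exact: abs_ge0. Qed.

Lemma th_le_size i z : abs (Th i z) <= size_th z.
Proof. by rewrite /size_th (bigD1 i) //= lerDl; apply: sumr_ge0 => j _; exact: abs_ge0. Qed.

Lemma size_th_cont z (e : R) : 0 < e -> nearc z (fun w => `|size_th w - size_th z| < e).
Proof.
(* There are 16 indices, so the errors sum to less than [e]. *)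
move=> e0; have e1 : 0 < e / 17 by rewrite divr_gt0.
have : nearc z (fun w => forall i : I, i \in index_enum I -> abs (Th i w - Th i z) < e / 17).
  elim: (index_enum I) => [|j s IH]; first by apply: nearc_all.
  have cj := diffc_cont (dTh j z) e1; apply: nearcW (nearc_and cj IH) => w [h1 h2] i.
  by rewrite inE => /orP[/eqP ->|/h2].
apply: nearcW => w H; rewrite /size_th -sumrB; apply: le_lt_trans (ler_norm_sum _ _ _) _.
apply: le_lt_trans (_ : _ <= \sum_(i : I) (e / 17)) _.
  apply: ler_sum => i _; apply: le_trans (ltW (H i (mem_index_enum i))).
  rewrite ler_norml; have := abs_leB (Th i w) (Th i z); have := abs_leB (Th i z) (Th i w).
  by rewrite absB; slra.
rewrite sumr_const cardE -cardT !card_prod card_bool /=; move: e0; slra.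
Qed.

Lemma chart_at z : good z -> exists b c phi gam, [/\ on_chart b phi f z, on_chart c gam g z,
  abs (phi z) <= 1 & abs (gam z) <= 1] /\ nearc z (fun w => good w /\ forall i,
   Th i w = theta P i (chart b (phi w)) (csign R b * Dc phi w) (chart c (gam w)) (csign R c * Dc gam w)).
Proof.
move=> gz; have [b [phi [Hf phi1]]] := chart_lift z lf; have [c [gam [Hg gam1]]] := chart_lift z lg.
exists b, c, phi, gam; split => //.
have [_ ng'] := diffc_th n_ge4 LF LG (false, false, false, false) gz.
apply: nearcW (nearc_and ng' (nearc_and (on_chart_near Hf) (on_chart_near Hg))) => w [gw [h1 h2]].
split=> [//|i]; rewrite (ThE i gw); exact: (th_chart n_ge4 LF LG i h1 h2).
Qed.

Lemma size_bound : exists2 K : R, 0 <= K & forall z r, good z -> 0 < r ->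
  (forall w, abs (w - z) < r -> size_th w <= 32 * size_th z) -> size_th z * r ^+ 2 <= K.
Proof.
have [K K0 HK] := theta_bound simpleP n_ge4.
(* 24 is the constant of Cauchy's estimate, 32 the growth allowed on the disc, 2 counts the two
   terms in [psi' E = (psi E)' - psi E'], and 16 bounds the sum over the indices by its dominant
   term. *)
pose L : R := 2 * (24 * 32) * 16.
exists (16 * K * (L ^+ 2 + L ^+ 2)); first by rewrite !mulr_ge0 ?addr_ge0 ?sqr_ge0.
move=> z r gz r0 H.
have [b [c [phi [gam [[Hf Hg phi1 gam1] Nn]]]]] := chart_at gz.
have [_ Ez] := nearc_id Nn.
pose E k l := Th (b, c, k, l).
have dE k l : abs (Dc (E k l) z) <= 24 * (32 * size_th z) / r.
  by apply: cauchy_est => // w /H h; split; [exact: dTh|exact: le_trans (th_le_size _ _) h].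
have SE : size_th z <= 16 * abs (E false false z).
  rewrite /size_th; apply: le_trans (_ : _ <= \sum_(i : I) abs (E false false z)) _.
    by apply: ler_sum => i _; rewrite /E !Ez; exact: theta_le.
  by rewrite sumr_const cardE -cardT !card_prod card_bool /= mulr_natl.
have [S0|Sn] := eqVneq (size_th z) 0.
  by rewrite S0 mul0r !mulr_ge0 ?addr_ge0 ?sqr_ge0.
have S0 : 0 < size_th z by rewrite lt_def Sn size_th_ge0.
have E0 : 0 < abs (E false false z) by move: SE S0; slra.
have dbound (psi : C -> C) k l : diffc psi z -> abs (psi z) <= 1 ->
    nearc z (fun w => E k l w = psi w * E false false w) -> abs (Dc psi z) <= L / r.
  move=> dpsi psi1 N1; have dM := cderivM (DcP dpsi) (DcP (dTh (b, c, false, false) z)).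
  have := DcE (cderiv_ext (nearcW (fun w => @esym _ _ _) N1) dM) => DE.
  have h1 : abs (Dc psi z) * abs (E false false z) <= 2 * (24 * (32 * size_th z) / r).
    rewrite -absM (_ : _ * _ = Dc (E k l) z - psi z * Dc (E false false) z); last by rewrite DE addrK.
    apply: le_trans (absD _ _) _; rewrite absN absM mulr_natl mulr2n.
    by apply: lerD => //; apply: le_trans (dE false false); rewrite ler_piMl // abs_ge0.
  rewrite -(ler_pM2r E0); apply: le_trans h1 _.
  have -> : 2 * (24 * (32 * size_th z) / r) = (2 * (24 * 32) / r) * size_th z.
    by field; rewrite gt_eqF.
  have -> : L / r * abs (E false false z) = (2 * (24 * 32) / r) * (16 * abs (E false false z)).
    by rewrite /L; field; rewrite gt_eqF.
  by rewrite ler_wpM2l // divr_ge0 // ltW.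
have [dphi _] := nearc_id Hf; have [dgam _] := nearc_id Hg.
have b1 : abs (Dc phi z) <= L / r.
  apply: (dbound _ true false) => //; apply: nearcW Nn => w [_ Ew].
  by rewrite /E !Ew theta_chart expr1 expr0 mulr1.
have b2 : abs (Dc gam z) <= L / r.
  apply: (dbound _ false true) => //; apply: nearcW Nn => w [_ Ew].
  by rewrite /E !Ew theta_chart expr1 expr0 mul1r.
move: (gz); rewrite (good_chart P LF LG Hf Hg) => /andP[J1 J2].
have [F Rel] := chart_relation n_ge4 fg_fib Hf Hg.
have one2 : 1 <= 2 :> R by rewrite ler1n.
have := HK (b, c, false, false) b c _ _ _ _ 1 (lexx _) one2 phi1 gam1 F J1 J2 Rel.
have cs b' (d : C) : abs (csign R b' * d) = abs d.
  by rewrite /csign; case: b'; rewrite ?mul1r ?mulN1r ?absN.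
rewrite -Ez !cs => Eb.
have L0 : 0 <= L / r by apply: le_trans b1; exact: abs_ge0.
have h : abs (E false false z) <= K * ((L / r) ^+ 2 + (L / r) ^+ 2).
  apply: le_trans Eb _; rewrite ler_wpM2l //.
  by apply: lerD; apply: sqr_ler => //; exact: abs_ge0.
have r2 : 0 <= r ^+ 2 by exact: sqr_ge0.
apply: le_trans (ler_wpM2r r2 (le_trans SE (ler_wpM2l (_ : 0 <= 16) h))) _ => //.
by rewrite le_eqVlt; apply/orP; left; apply/eqP; field; rewrite gt_eqF.
Qed.

Lemma size_th0 z : size_th z = 0.
Proof.
have [K K0 HK] := size_bound.
apply: (rescaling K0 size_th_ge0 _ _ _ HK) => {}z.
- exists (size_th z + 1); apply: nearcW (size_th_cont z ltr01) => w.
  by rewrite ltr_norml => /andP[_]; slra.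
- move=> Sz; have S2 : 0 < size_th z / 2 by rewrite divr_gt0.
  apply: nearcW (size_th_cont z S2) => w.
  by rewrite ltr_norml => /andP[+ _]; slra.
have := generic simpleP n_ge4 LF LG nf ng fg_neq z.
by apply: nearcW => w H /H [].
Qed.

End Bound.

(** Where [J] and the wedge are nonzero, the vanishing of the differentials leaves [W(f) W(g) = 0].
    By the comparison of spherical derivatives [W(g) = 0] implies [W(f) = 0], so [f] is constant
    near a point, against the discreteness of its level sets. *)
Lemma no_solution : False.
Proof.
have [Th HTh] := choice (th_extension simpleP n_ge4 LF LG nf ng fg_neq fg_fib).
have dTh i : forall z, diffc (Th i) z by case: (HTh i).
have ThE i : forall z, good z -> Th i z = th i z by case: (HTh i).
have G := generic simpleP n_ge4 LF LG nf ng fg_neq.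
have [z nz [/(_ nz) [gz fgz] Gz]] := near_other (nearc_and (G 0) (nearc_all 0 G)).
have [b [c [phi [gam [[Hf Hg _ _] Nn]]]]] := chart_at ThE gz.
have Nn2 := nearc_and (on_chart_near Hf) (on_chart_near Hg).
have : nearc z (fun w => cderiv phi w 0).
  apply: nearcW (nearc_and (nearc_and Nn Nn2) Gz) => w [[[gw Ew] [Hf' Hg']] Gw].
  have fgw : f w <> g w by have [->//|/Gw []] := eqVneq w z.
  have [dphi fw] := nearc_id Hf'; have [dgam gw'] := nearc_id Hg'.
  have E0 : Th (b, c, false, false) w = 0.
    apply/eqP; rewrite -abs_eq0 eq_le abs_ge0 andbT.
    by rewrite -(size_th0 dTh ThE w); exact: th_le_size.
  move: (gw); rewrite (good_chart P LF LG Hf' Hg') => /andP[J1 J2].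
  have [F Rel] := chart_relation n_ge4 fg_fib Hf' Hg'.
  have W0 : wedge (chart b (phi w)) (chart c (gam w)) != 0.
    apply/eqP => W; apply: fgw; rewrite fw gw'; apply/pt_eq; try exact: chart_neq0.
    by apply/eqP; rewrite -subr_eq0; apply/eqP.
  suff D0 : Dc phi w = 0 by rewrite -D0; exact: DcP.
  have cs b' : csign R b' != 0 by rewrite /csign; case: b'; rewrite ?oppr_eq0 oner_eq0.
  move/eqP: E0; rewrite Ew /theta !mono_chart !expr0 !mul1r !mulf_eq0 invr_eq0 mulf_eq0.
  rewrite (negbTE W0) (negbTE (cs b)) (negbTE (cs c)) (negbTE J1) (negbTE J2) /= !orbF.
  move=> /orP[/eqP //|/eqP dg0]; move/eqP: Rel; rewrite dg0 mulr0 abs0 mulr0 mul0r.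
  rewrite !mulf_eq0 !abs_eq0 mulf_eq0 (negbTE J1) (negbTE (cs b)) /=.
  have /gt_eqF -> := fnorm_gt0 P (chart_neq0 c (gam w)).
  by rewrite orbF => /eqP.
move=> /deriv0_cst N0.
have [w wz [/(_ wz) h [fw' E]]] := near_other (nearc_and (level_discrete (f z) lf nf z) (nearc_and Hf N0)).
by case: fw' => _ fw; apply: h; rewrite fw E; case: (nearc_id Hf).
Qed.

End NoEntireDifferential.

(** * Solutions in degrees 0, 2 and 3 *)

Section LowDegree.
Variable R : realType.
Local Notation C := R[i].
Variable P : ratfun R.
Implicit Types (z w x y : C).

Lemma liftable_pt (a b : C -> C) : (forall z, diffc a z) -> (forall z, diffc b z) ->
  (forall z, (a z != 0) || (b z != 0)) -> liftable (fun z => pt (a z) (b z)).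
Proof. by move=> da db ab z; exists a, b; apply: nearc_all => w; split. Qed.

Definition solvable_fibres := exists f g : C -> CP1 R,
  [/\ liftable f, liftable g, nonconstant f & nonconstant g] /\
  (exists z, f z <> g z) /\ (forall z, ratmap P (f z) = ratmap P (g z)).

Lemma some_pt z : Some z = pt z 1 :> CP1 R.
Proof. by rewrite /pt oner_eq0 divr1. Qed.

Lemma liftable_Some : liftable (fun z => Some z : CP1 R).
Proof.
move=> z; exists id, (fun=> 1); apply: nearc_all => w.
by split; [exact: diffc_id|exact: diffc_cst|rewrite oner_eq0 orbT|exact: some_pt].
Qed.

Lemma nonconstant_Some : nonconstant (fun z => Some z : CP1 R).
Proof. by exists 0, 1 => -[] /eqP; rewrite eq_sym oner_eq0. Qed.

Lemma solvable0 : ratdeg P = 0%N -> solvable_fibres.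
Proof.
move=> n0; exists (fun z => Some z), (fun z => Some (z + 1)); split.
  split; [exact: liftable_Some| |exact: nonconstant_Some|].
    move=> z; exists (fun z => z + 1), (fun=> 1); apply: nearc_all => w.
    split; [|exact: diffc_cst|by rewrite oner_eq0 orbT|exact: some_pt].
    by apply: diffcD; [exact: diffc_id|exact: diffc_cst].
  by exists 0, 1 => -[] /eqP; rewrite add0r -subr_eq0 opprD addNKr oppr_eq0 oner_eq0.
split; first by exists 0 => -[] /eqP; rewrite add0r eq_sym oner_eq0.
move=> z; rewrite !some_pt; apply/ratmap_eq; rewrite ?oner_eq0 ?orbT //.
by rewrite n0 /hev !big_ord1 !expr0 !mulr1 mulrC.
Qed.

Lemma hev2E (p : {poly C}) x y : hev p 2 x y = p`_2 * x ^+ 2 + p`_1 * (x * y) + p`_0 * y ^+ 2.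
Proof. by rewrite /hev !big_ord_recr big_ord0 /=; ring. Qed.

Section Degree2.
Hypothesis n2 : ratdeg P = 2%N.
Local Notation p i := (ratnum P)`_i.
Local Notation q i := (ratden P)`_i.
Let a := p 2 * q 1 - p 1 * q 2.
Let b := p 2 * q 0 - p 0 * q 2.
Let c := p 1 * q 0 - p 0 * q 1.

(* A kernel vector of the symmetric matrix [[a, b], [b, c]] is a point sharing its fibre with
   every other point, since the points [x] and [z] share a fibre iff [x = z] or
   [a x z + b (x + z) + c = 0]. *)
Lemma bezout_neq0 x y : (x != 0) || (y != 0) -> (b * x + c * y != 0) || (a * x + b * y != 0).
Proof.
move=> xy; apply: contraT; rewrite negb_or !negbK => /andP[/eqP e1 /eqP e2].
have n0 : (0 < ratdeg P)%N by rewrite n2.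
have := hev_neq0 P xy => /(pencil_neq0 n0) /negP []; apply/eqP/polyP => i.
rewrite /pencil coefB !coefZ coef0 n2 !hev2E.
case: i => [|[|[|i]]].
- transitivity (- x * (b * x + c * y)); last by rewrite e1 mulr0.
  by rewrite /b /c; ring.
- transitivity (- x * (a * x + b * y) + y * (b * x + c * y)); last by rewrite e1 e2 !mulr0 addr0.
  by rewrite /a /b /c; ring.
- transitivity (y * (a * x + b * y)); last by rewrite e2 mulr0.
  by rewrite /a /b; ring.
have := size_num P; have := size_den P; rewrite n2 => s1 s2.
have -> : (ratnum P)`_i.+3 = 0 by apply: nth_default; apply: leq_trans s2 _.
have -> : (ratden P)`_i.+3 = 0 by apply: nth_default; apply: leq_trans s1 _.
by rewrite !mulr0 subr0.
Qed.

(** If the determinant vanished, [(- b, a)], or [(1, 0)] when [a = b = 0], would be a kernel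
    vector. *)
Lemma bezout_det : b ^+ 2 - a * c != 0.
Proof.
apply/eqP => D; have [ab|] := boolP ((- b != 0) || (a != 0)).
  have := bezout_neq0 ab; rewrite (_ : _ + _ = - (b ^+ 2 - a * c)); last by ring.
  by rewrite D oppr0 eqxx /= (_ : _ + _ = 0) ?eqxx //; ring.
rewrite negb_or !negbK oppr_eq0 => /andP[/eqP b0 /eqP a0].
have := @bezout_neq0 1 0; rewrite a0 b0 oner_eq0 !mul0r !mulr0 addr0 eqxx.
by move=> /(_ isT).
Qed.

(** The pair is the identity and the involution exchanging the two points of each fibre, the Moebius
    map solved from [a x z + b (x + z) + c = 0]. Were it the identity, [a z^2 + 2 b z + c] would
    vanish for all [z], hence [a = b = c = 0]. *)
Lemma solvable2 : solvable_fibres.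
Proof.
have nz z : (- (b * z + c) != 0) || (a * z + b != 0).
  by have := @bezout_neq0 z 1; rewrite !mulr1 oner_eq0 orbT oppr_eq0; apply.
pose g z := pt (- (b * z + c)) (a * z + b).
have lg : liftable g.
  by apply: liftable_pt => // z; [apply: diffcN|]; apply: diffcD;
    [apply: diffcM|exact: diffc_cst|apply: diffcM|exact: diffc_cst];
    [exact: diffc_cst|exact: diffc_id|exact: diffc_cst|exact: diffc_id].
exists (fun z => Some z), g; split.
  split=> //; [exact: liftable_Some|exact: nonconstant_Some|].
  exists 0, 1 => /pt_eq E; move/eqP: (E (nz 0) (nz 1)); rewrite -subr_eq0.
  by rewrite (_ : _ - _ = b ^+ 2 - a * c) ?(negbTE bezout_det) //; ring.
split.
  apply: contrapT => H.
  have E z : a * z ^+ 2 + 2 * b * z + c = 0.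
    have : Some z = g z by apply: contra_notP H => H; exists z.
    rewrite some_pt => /pt_eq; rewrite oner_eq0 orbT => /(_ isT (nz z)).
    by move=> /eqP; rewrite -subr_eq0 => /eqP <-; ring.
  have c0 : c = 0 by rewrite -[RHS](E 0); ring.
  have a0 : a = 0.
    apply: (mulIf (_ : 2 != 0 :> C)); first by rewrite pnatr_eq0.
    by transitivity ((a * 1 ^+ 2 + 2 * b * 1 + c) + (a * (-1) ^+ 2 + 2 * b * (-1) + c) - 2 * c); [ring|rewrite !E c0; ring].
  have b0 : b = 0.
    apply: (mulIf (_ : 2 != 0 :> C)); first by rewrite pnatr_eq0.
    by transitivity ((a * 1 ^+ 2 + 2 * b * 1 + c) - a - c); [ring|rewrite E a0 c0; ring].
  by move/eqP: bezout_det; apply; rewrite a0 b0; ring.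
move=> z; rewrite some_pt; apply/ratmap_eq; rewrite ?oner_eq0 ?orbT // n2 !hev2E.
by rewrite /a /b /c; ring.
Qed.

End Degree2.
End LowDegree.

(** * Linearization at a fixed point of multiplier -2 *)

Section Koenigs.
Variable R : realType.
Local Notation C := R[i].
Implicit Types (z w a b : C) (m : nat).

(** Halving the argument divides a quadratic error by 4, and one application of [h] multiplies it by
    at most 3. *)
Let q : R := 3 / 4.

Lemma geom_ge0 m : 0 <= q ^+ m.
Proof. by rewrite exprn_ge0 // /q divr_ge0. Qed.

(** A rational bound for the geometric decay, suited to Archimedean arguments; the induction rests
    on [3 (m + 5) <= 4 (m + 4)]. *)
Lemma geom_le m : q ^+ m <= 4 / (m + 4)%:R.
Proof.
have pos k : 0 < (k + 4)%:R :> R by rewrite ltr0n addn4.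
rewrite ler_pdivlMr //; elim: m => [|m IH]; first by rewrite expr0 mul1r.
apply: le_trans IH; rewrite exprSr -mulrA ler_wpM2l ?geom_ge0 // /q !natrD -(natr1 m).
by have := ler0n R m; move: (m%:R) => x; clear; lra.
Qed.

Lemma le_geom (x y D : R) : 0 <= D -> (forall m, x <= y + D * q ^+ m) -> x <= y.
Proof.
move=> D0 H; rewrite leNgt; apply/negP => yx.
have e0 : 0 < x - y by rewrite subr_gt0.
have [m Hm] : exists m : nat, 4 * D / (x - y) < m%:R.
  by exists (Num.bound (4 * D / (x - y))); apply: archi_boundP; rewrite divr_ge0 ?mulr_ge0 // ltW.
have := H m; have := ler_wpM2l D0 (geom_le m); rewrite ltr_pdivrMr // in Hm.
have m4 : 0 < (m + 4)%:R :> R by rewrite ltr0n addn4.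
rewrite mulrA ler_pdivlMr // => h1 h2.
have h3 : (x - y) * (m + 4)%:R <= D * q ^+ m * (m + 4)%:R by rewrite ler_wpM2r ?(ltW m4) // lerBlDl.
move: (le_trans h3 h1) Hm; rewrite natrD mulrDr (mulrC (m%:R)).
move: ((x - y) * m%:R) e0 => t; clear; lra.
Qed.

(** Near 0 the constant is [2 + 1/2 + 1/2]: the multiplier, the variation of the derivative and the
    quadratic remainder. *)
Lemma strict_lipschitz (h : C -> C) : nearc 0 (diffc h) -> Dc h 0 = - 2 ->
  exists2 r : R, 0 < r & forall a b, abs a < r -> abs b < r ->
    diffc h a /\ abs (h a - h b) <= 3 * abs (a - b).
Proof.
move=> dh h2; have [r r0 [M H]] := bounded_near dh.
have M0 : 0 <= M by have [|_] := H 0; [rewrite subrr abs0|apply: le_trans; exact: abs_ge0].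
have half0 : 0 < 2^-1 :> R by rewrite invr_gt0.
have [s s0 Hs] := diffc_cont (Dc_diffc dh) half0.
have r2 : 0 < r / 2 by rewrite divr_gt0.
pose K := 32 * M / (r / 2) ^+ 2.
have K0 : 0 <= K by rewrite divr_ge0 ?mulr_ge0 ?exprn_ge0 // ltW.
pose t := (4 * (K + 1))^-1; have t0 : 0 < t by rewrite invr_gt0 mulr_gt0 // ltr_wpDl.
have Kt : 2 * t * K <= 2^-1.
  have -> : 2 * t * K = 2^-1 * (K / (K + 1)).
    by rewrite /t; field; rewrite gt_eqF // ltr_wpDl.
  rewrite ler_piMr ?(ltW half0) // ler_pdivrMr ?mul1r ?lerDl //; exact: ltr_wpDl.
exists (Num.min (Num.min (r / 16) s) t); first by rewrite !lt_min s0 t0 divr_gt0.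
move=> a b; rewrite !lt_min -!andbA => /and3P[ar as_ at_] /and3P[br bs bt].
have dha : diffc h a by have [] := H a; rewrite ?subr0 //; move: ar r0; clear; lra.
split=> //.
have [|c T] := @taylor _ h b (r / 2) M r2.
  move=> w wb; apply: H; apply: le_lt_trans (abs_subD w b 0) _.
  by rewrite subr0; move: wb br r0; clear; lra.
have ab : abs (a - b) <= abs a + abs b by apply: le_trans (absD _ _) _; rewrite absN.
have ab4 : abs (a - b) <= r / 2 / 4 by move: ab ar br r0; clear; lra.
have := tayl_quad r2 T ab4; rewrite (addrC b) subrK -/K.
rewrite -(DcE (tayl_cderiv r2 T)) => Q.
have Db : abs (Dc h b + 2) <= 2^-1.
  by have := Hs b; rewrite subr0 h2 opprK => /(_ bs) /ltW.
have {Q}Q : abs (h a - h b - Dc h b * (a - b)) <= 2^-1 * abs (a - b).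
  apply: le_trans Q _; rewrite expr2 mulrA ler_wpM2r ?abs_ge0 //.
  apply: le_trans Kt; rewrite mulrC ler_wpM2r //.
  by move: ab at_ bt; clear; lra.
have -> : h a - h b = (h a - h b - Dc h b * (a - b)) + ((Dc h b + 2) * (a - b) - 2 * (a - b)) by ring.
apply: le_trans (absD _ _) _; apply: le_trans (lerD Q (absD _ _)) _.
rewrite absN !absM absn.
have := ler_wpM2r (abs_ge0 (a - b)) Db; clear; lra.
Qed.

(* The linearization is the limit of [h^m (z / (-2)^m)]: one more step contracts errors
   of order [z^2] by the factor [3 / 4]. *)
Lemma koenigs (h : C -> C) : nearc 0 (diffc h) -> h 0 = 0 -> Dc h 0 = - 2 ->
  exists phi : C -> C, exists2 r : R, 0 < r & forall z, abs z < r ->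
    [/\ diffc phi z, abs (phi z - z) <= abs z / 2 &
        abs (- 2 * z) < r -> phi (- 2 * z) = h (phi z)].
Proof.
move=> dh h0 h2; have [r1 r10 Lip] := strict_lipschitz dh h2.
have [r r0 [M H]] := bounded_near dh; have [a T] := taylor r0 H.
have M0 : 0 <= M by have [|_] := H 0; [rewrite subrr abs0|apply: le_trans; exact: abs_ge0].
have a1 : a 1%N = - 2 by rewrite -(DcE (tayl_cderiv r0 T)).
pose K := 32 * M / r ^+ 2.
have K0 : 0 <= K by rewrite divr_ge0 ?mulr_ge0 ?exprn_ge0 // ltW.
pose hz z : C := - z / 2.
have hzE z : abs (hz z) = abs z / 2 by rewrite /hz absM absN absV absn.
have base z : abs z <= r / 4 -> abs (h (hz z) - z) <= K * abs z ^+ 2.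
  move=> zr; have zr' : abs (hz z) <= r / 4 by rewrite hzE; move: zr (abs_ge0 z); clear; lra.
  have := tayl_quad r0 T zr'; rewrite add0r h0 subr0 a1 -/K hzE.
  have -> : h (hz z) - - 2 * hz z = h (hz z) - z by rewrite /hz; field.
  move=> /le_trans; apply; rewrite ler_wpM2l //; apply: sqr_ler; first by rewrite divr_ge0 ?abs_ge0.
  by move: (abs_ge0 z); clear; lra.
pose t := (8 * (K + 1))^-1; have t0 : 0 < t by rewrite invr_gt0 mulr_gt0 // ltr_wpDl.
have Kt z : abs z < t -> 4 * K * abs z ^+ 2 <= abs z / 2.
  move=> zt; rewrite expr2 mulrA mulrC ler_wpM2l ?abs_ge0 //.
  have k1 : 4 * K * abs z <= 4 * K * t by apply: ler_wpM2l; [exact: mulr_ge0|exact: ltW].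
  apply: le_trans k1 _; have -> : 4 * K * t = 2^-1 * (K / (K + 1)).
    by rewrite /t; field; rewrite gt_eqF // ltr_wpDl.
  rewrite ler_piMr ?invr_ge0 // ler_pdivrMr ?mul1r ?lerDl //; exact: ltr_wpDl.
pose rho := Num.min (Num.min (r1 / 2) (r / 4)) (Num.min t 1).
have rho0 : 0 < rho by rewrite !lt_min t0 ltr01 !divr_gt0.
have rhoP z : abs z < rho -> [/\ abs z < r1 / 2, abs z <= r / 4, abs z < t & abs z <= 1].
  by rewrite !lt_min -!andbA => /and4P[h1 h3 h4 h5]; split=> //; exact: ltW.
pose f := fix f m z := if m is k.+1 then h (f k (hz z)) else z.
have q01 m : 0 <= 1 - q ^+ m.
  rewrite subr_ge0; apply: exprn_ile1; rewrite /q; clear; lra.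
have near_id z (v : C) m : abs z < rho -> abs (v - z) <= 4 * K * (1 - q ^+ m) * abs z ^+ 2 ->
    abs (v - z) <= abs z / 2.
  move=> /rhoP[_ _ zt _] h1; apply: le_trans (Kt _ zt); apply: le_trans h1 _.
  apply: ler_wpM2r; first by rewrite exprn_ge0 ?abs_ge0.
  apply: ler_piMr; first exact: mulr_ge0.
  by rewrite lerBlDr lerDl geom_ge0.
have small z (v : C) : abs z < rho -> abs (v - z) <= abs z / 2 -> abs v < r1.
  move=> /rhoP[z1 _ _ _] h1; have := abs_leB v z; move: z1 h1 (abs_ge0 z); clear; lra.
have hz_rho z : abs z < rho -> abs (hz z) < rho.
  by rewrite hzE; apply: le_lt_trans; move: (abs_ge0 z); clear; lra.
(* The factor [4 (1 - q^m)] is the sum of the [q^j] for [j < m], which adds up the bounds for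
   successive differences. *)
have main m z : abs z < rho -> [/\ diffc (f m) z,
    abs (f m z - z) <= 4 * K * (1 - q ^+ m) * abs z ^+ 2 &
    abs (f m.+1 z - f m z) <= q ^+ m * K * abs z ^+ 2].
  elim: m z => [|m IH] z zr.
    rewrite /= expr0 !subrr mulr0 mul0r mul1r abs0; split=> //; first exact: diffc_id.
    by apply: base; case: (rhoP z zr).
  have second w : abs w < rho -> abs (f m.+1 w - w) <= 4 * K * (1 - q ^+ m.+1) * abs w ^+ 2.
    move=> /IH [_ i1 i2]; apply: le_trans (abs_subD _ (f m w) _) _; apply: le_trans (lerD i2 i1) _.
    rewrite -mulrDl ler_wpM2r ?exprn_ge0 ?abs_ge0 // (exprS q m).
    by rewrite le_eqVlt; apply/orP; left; apply/eqP; rewrite /q; field.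
  have zr2 := hz_rho z zr; have [i1 i2 i3] := IH _ zr2.
  have b1 := small _ _ zr2 (near_id _ _ _ zr2 i2).
  have b2 := small _ _ zr2 (near_id _ _ _ zr2 (second _ zr2)).
  split; [|exact: second|].
    apply: (@diffc_comp _ (fun z => f m (hz z)) h); last by have [] := Lip _ _ b1 b1.
    apply: diffc_comp => //; apply: diffcM; last exact: diffc_cst.
    by apply: diffcN; exact: diffc_id.
  have [_] := Lip _ _ b2 b1; rewrite -/(f m.+2 z) -/(f m.+1 z) => /le_trans; apply.
  apply: le_trans (ler_wpM2l _ i3) _ => //; rewrite hzE (exprS q m).
  by rewrite le_eqVlt; apply/orP; left; apply/eqP; rewrite /q; field.
have cauchy z m k : abs z < rho -> abs (f (m + k)%N z - f m z) <= 4 * K * (q ^+ m - q ^+ (m + k)).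
  move=> zr; elim: k => [|k IH]; first by rewrite addn0 !subrr abs0 mulr0.
  have [_ _ i3] := main (m + k)%N z zr; have [_ _ _ z1] := rhoP z zr.
  apply: le_trans (abs_subD _ (f (m + k)%N z) _) _; rewrite addnS.
  have : q ^+ (m + k) * K * abs z ^+ 2 <= q ^+ (m + k) * K.
    by apply: ler_piMr; [rewrite mulr_ge0 ?geom_ge0|apply: exprn_ile1; rewrite ?abs_ge0].
  move: i3 IH; rewrite (exprS q (m + k)); move: (q ^+ (m + k)) (q ^+ m) => u v i3 IH h3.
  apply: le_trans (lerD (le_trans i3 h3) IH) _.
  by rewrite le_eqVlt; apply/orP; left; apply/eqP; rewrite /q; field.
have lim z : exists v, abs z < rho -> forall m, abs (f m z - v) <= 4 * K * q ^+ m.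
  have [zr|nzr] := boolP (abs z < rho); last by exists 0.
  have [|v Hv] := @cluster_point _ (fun m => f m z) (abs z + abs z / 2).
    move=> m; have [_ i2 _] := main m z zr; have := near_id _ _ _ zr i2; have := abs_leB (f m z) z.
    by clear; lra.
  exists v => _ m; apply/ler_addgt0Pr => e e0.
  have [n mn /ltW ne] := Hv e e0 m.
  apply: le_trans (abs_subD _ (f n z) _) _; apply: lerD => //.
  rewrite absB -(subnKC mn); apply: le_trans (cauchy z m _ zr) _.
  by apply: ler_wpM2l; [exact: mulr_ge0|rewrite lerBlDr lerDl geom_ge0].
have [phi Hphi] := choice lim.
have K4 : 0 <= 4 * K by rewrite mulr_ge0.
have phi_id z : abs z < rho -> abs (phi z - z) <= abs z / 2.
  move=> zr; apply: (le_geom K4) => m; have [_ i2 _] := main m z zr.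
  rewrite [leRHS]addrC; apply: le_trans (abs_subD _ (f m z) _) _; apply: lerD.
    by rewrite absB; exact: Hphi.
  exact: (near_id _ _ _ zr i2).
exists phi, rho => // z zr; split; [|exact: phi_id|].
  have d0 : 0 < rho - abs z by rewrite subr_gt0.
  have disc w : abs (w - z) < rho - abs z -> abs w < rho.
    by move=> wz; have := abs_subD w z 0; rewrite !subr0; move: wz; clear; lra.
  apply: (@unif_lim _ f phi z (rho - abs z) r1 d0).
    move=> n w /disc wr; have [i1 i2 _] := main n w wr; split=> //.
    by apply/ltW; exact: (small _ _ wr (near_id _ _ _ wr i2)).
  move=> e e0 N; pose x := 16 * K / e.
  have [m Hm] : exists m : nat, x < m%:R.
    by exists (Num.bound x); apply/archi_boundP/divr_ge0; [exact: mulr_ge0|exact: ltW].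
  exists (maxn N m); first exact: leq_maxl.
  move=> w /disc wr; apply: le_trans (Hphi w wr _) _.
  have mm : m%:R <= (maxn N m + 4)%:R :> R by rewrite ler_nat (leq_trans (leq_maxr N m)) ?leq_addr.
  apply: le_trans (ler_wpM2l K4 (geom_le _)) _.
  have pos : 0 < (maxn N m + 4)%:R :> R by rewrite ltr0n addn4.
  have := lt_le_trans Hm mm; rewrite /x ltr_pdivrMr // (mulrA (4 * K) 4) ler_pdivrMr // => /ltW.
  by rewrite (mulrC e); apply: le_trans; rewrite le_eqVlt; apply/orP; left; apply/eqP; ring.
move=> z2r; apply/eqP; rewrite -subr_eq0 -abs_eq0 eq_le abs_ge0 andbT.
apply: (@le_geom _ _ (4 * (4 * K))); first by rewrite mulr_ge0.
move=> m; rewrite add0r.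
have fE : f m.+1 (- 2 * z) = h (f m z) by rewrite /= /hz; congr (h (f m _)); field.
have [_ i2 _] := main m z zr.
have [_ l1] := Lip _ _ (small _ _ zr (near_id _ _ _ zr i2)) (small _ _ zr (phi_id z zr)).
apply: le_trans (abs_subD _ (f m.+1 (- 2 * z)) _) _; rewrite [X in _ + abs (X - _)]fE.
have p1 := Hphi _ z2r m.+1; have p2 := Hphi _ zr m.
rewrite absB in p1; have := geom_ge0 m; move: p1 l1 p2; rewrite (exprS q m).
move: (abs _) (abs _) (abs _) (q ^+ m) => u v w x p1 l1 p2 x0.
have := mulr_ge0 K4 x0; have e1 : 4 * K * (q * x) = q * (4 * K * x) by ring.
have -> : 4 * (4 * K) * x = 4 * (4 * K * x) by ring.
by move: p1 p2 l1; rewrite e1; move: (4 * K * x) => y; rewrite /q; clear; lra.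
Qed.

End Koenigs.

(** * Differentiability of the principal square root *)

Section SquareRoot.
Variable R : realType.
Local Notation C := R[i].
Implicit Types (u v : C).

Lemma Re_sqrtc_ge0 u : 0 <= Re (sqrtc u).
Proof. by case: u => a b /=; exact: sqrtr_ge0. Qed.

(** The slope is [1 / (sqrt u + sqrt v)]. Principal roots have nonnegative real part, so the
    denominator is at least [Re (sqrt v)] in modulus for every [u]. *)
Lemma diffc_sqrtc_pos v : 0 < Re (sqrtc v) -> diffc (@sqrtc R) v.
Proof.
move=> pos.
have le u : Re (sqrtc v) <= abs (sqrtc u + sqrtc v).
  apply: le_trans (abs_Re _); apply: le_trans (ler_norm _).
  by rewrite cReD lerDr Re_sqrtc_ge0.
have nz u : sqrtc u + sqrtc v != 0 by rewrite -abs_gt0 (lt_le_trans pos).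
have E u : sqrtc u = sqrtc v + (sqrtc u + sqrtc v)^-1 * (u - v).
  have -> : u - v = sqrtc u ^+ 2 - sqrtc v ^+ 2 by rewrite !sqr_sqrtc.
  by field; exact: nz.
have cs : cont_at (@sqrtc R) v.
  move=> e e0; exists (e * Re (sqrtc v)); first exact: mulr_gt0.
  move=> u uv; rewrite {1}(E u) addrC addKr absM absV mulrC ltr_pdivrMr ?(lt_le_trans pos) //.
  by apply: lt_le_trans uv _; rewrite ler_wpM2l // ltW.
exists ((sqrtc v + sqrtc v)^-1), (fun u => (sqrtc u + sqrtc v)^-1); split=> //.
by apply: contV => //; apply: contD => //; exact: cont_cst.
Qed.

Lemma diffc_sqrtc : nearc 1 (diffc (@sqrtc R)).
Proof.
have d1 : diffc (@sqrtc R) 1 by apply: diffc_sqrtc_pos; rewrite sqrtc1 /= ltr01.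
apply: nearcW (diffc_cont d1 ltr01) => v; rewrite sqrtc1 => h; apply: diffc_sqrtc_pos.
have := le_lt_trans (abs_Re _) h; rewrite cReD cReN /= ltr_norml => /andP[+ _].
by clear; lra.
Qed.

End SquareRoot.

(** * Extension to the plane by a functional equation *)

Section Extension.
Variable R : realType.
Local Notation C := R[i].
Variable L : ratfun R.
Implicit Types (f : C -> CP1 R) (z w u : C) (m k : nat).

Lemma lift_ratmap f z a b : lift f z a b -> lift (fun w => ratmap L (f w)) z
  (fun w => hev (ratnum L) (ratdeg L) (a w) (b w)) (fun w => hev (ratden L) (ratdeg L) (a w) (b w)).
Proof.
apply: nearcW => w [da db ab ->]; split; [exact: diffc_hev|exact: diffc_hev|exact: hev_neq0|].
exact: ratmap_pt.
Qed.

Lemma nearc_comp (u : C -> C) z (Q : C -> Prop) : cont_at u z -> nearc (u z) Q -> nearc z (fun w => Q (u w)).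
Proof. by move=> cu [e e0 H]; apply: nearcW (cu e e0) => w /H. Qed.

Lemma lift_comp f (u : C -> C) z a b : nearc z (diffc u) -> lift f (u z) a b ->
  lift (fun w => f (u w)) z (fun w => a (u w)) (fun w => b (u w)).
Proof.
move=> du La; have cu := diffc_cont (nearc_id du).
apply: nearcW (nearc_and du (nearc_comp cu La)) => w [duw [da db ab fw]].
by split=> //; exact: diffc_comp.
Qed.

(** By the functional equation [F m] and [F m.+1] agree on the disc of radius [2^m r], and these
    discs exhaust the plane. *)
Lemma extension f r : 0 < r -> (forall z, abs z < r -> exists a b, lift f z a b) ->
  (forall z, abs (- 2 * z) < r -> f (- 2 * z) = ratmap L (f z)) ->
  exists2 g, liftable g & forall z, abs z < r -> g z = f z.
Proof.
move=> r0 Lf Ef; pose F m z := iter m (ratmap L) (f ((- 2) ^- m * z)).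
have n2 : (- 2 : C) != 0 by rewrite oppr_eq0 pnatr_eq0.
have absF m z : abs ((- 2) ^- m * z) = abs z / 2 ^+ m.
  by rewrite absM absV absX absN absn mulrC.
have pow m z : - 2 * ((- 2) ^- m.+1 * z) = (- 2) ^- m * z.
  by rewrite exprS invfM !mulrA divff // mul1r.
have step m z : abs z < 2 ^+ m * r -> F m.+1 z = F m z.
  by move=> zm; rewrite /F iterSr -Ef pow // absF ltr_pdivrMr ?exprn_gt0 // mulrC.
have stepk m k z : abs z < 2 ^+ m * r -> F (m + k)%N z = F m z.
  move=> zm; elim: k => [|k IH]; first by rewrite addn0.
  rewrite addnS step //; apply: lt_le_trans zm _; rewrite ler_pM2r // ler_weXn2l ?leq_addr //.
  by rewrite ler1n.
pose M z := Num.bound (abs z / r).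
have MP z : abs z < 2 ^+ M z * r.
  rewrite -ltr_pdivrMr //; apply: lt_le_trans (archi_boundP (divr_ge0 (abs_ge0 z) (ltW r0))) _.
  by rewrite -natrX ler_nat ltnW // ltn_expl.
pose g z := F (M z) z.
have gF m z : abs z < 2 ^+ m * r -> g z = F m z.
  move=> zm; rewrite /g; have [le|/ltnW le] := leqP m (M z).
    by rewrite -(subnKC le) stepk.
  by rewrite -(subnKC le) stepk.
exists g; last by move=> z zr; rewrite (gF 0%N) ?expr0 ?mul1r // /F /= expr0 invr1 mul1r.
move=> z; set m := M z.
have zr : abs ((- 2) ^- m * z) < r by rewrite absF ltr_pdivrMr ?exprn_gt0 // mulrC MP.
have [a [b Lab]] := Lf _ zr.
have du : nearc z (diffc (fun w => (- 2) ^- m * w)).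
  by apply: nearc_all => w; apply: diffcM; [exact: diffc_cst|exact: diffc_id].
have {Lab} Lab := lift_comp du Lab.
have [a' [b' Lab']] : exists a b, lift (F m) z a b.
  rewrite /F; elim: {1}m => [|j [a' [b' IH]]]; first by exists (fun w => a ((- 2) ^- m * w)), (fun w => b ((- 2) ^- m * w)).
  by do 2 eexists; exact: (lift_ratmap IH).
exists a', b'; have Fg : nearc z (fun w => g w = F m w).
  have d0 : 0 < 2 ^+ m * r - abs z by rewrite subr_gt0 MP.
  exists (2 ^+ m * r - abs z); first exact: d0.
  move=> w wz; apply: gF; have := abs_subD w z 0; rewrite !subr0 => h.
  by apply: le_lt_trans h _; rewrite -ltrBrDr.
by apply: nearcW (nearc_and Fg Lab') => w [-> ].
Qed.

End Extension.

(** * Multiplication by -2 on the fibre curve *)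

Section Lattes.
Variable R : realType.
Local Notation C := R[i].
Implicit Types (a y z w x : C).

(* If [x, y, w] are the three roots of [X^3 + al X^2 + t X + ga] then so are their images under
   [x |-> x (y - w)^2 / ((w - x) (x - y))] for another [t]; the image of [x] depends on [x] alone.
   Here [a = 1 / x]. *)
Lemma fibre_duplication (al ga a y : C) : a != 0 -> 1 - a * y != 0 -> y != 0 ->
  (1 + al * a) ^+ 2 + 4 * ga * a ^+ 3 != 0 -> 2 * y ^+ 3 + al * y ^+ 2 - ga != 0 ->
  y * (1 + a * y + al * a) = ga * a ^+ 2 ->
  let a' := - (a * (2 + al * a - ga * a ^+ 3)) / ((1 + al * a) ^+ 2 + 4 * ga * a ^+ 3) in
  let y' := - (y * ((y + al) ^+ 2 * y + 4 * ga)) / (2 * y ^+ 3 + al * y ^+ 2 - ga) in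
  y' * (1 + a' * y' + al * a') = ga * a' ^+ 2.
Proof.
move=> a0 B0 y0 D0 Q0 rel a' y'.
have gE : ga = y * (1 + a * y + al * a) / a ^+ 2 by rewrite rel mulfK // expf_neq0.
(* The denominator of [a'] is the discriminant of the relation, read as a quadratic equation for
   [y], and [c] is the derivative of that equation at its root [y]; hence the square. *)
pose c := 1 + 2 * a * y + al * a.
have cE : (1 + al * a) ^+ 2 + 4 * ga * a ^+ 3 = c ^+ 2.
  by rewrite /c gE; field; exact: a0.
have c0 : c != 0 by move: D0; rewrite cE expf_eq0.
(* With [x = 1 / a] and the third root [w = - al - x - y], the quantities [A], [B] and [c] are [a]
   times [x - w], [x - y] and [y - w]. *)
pose A := 2 + a * y + al * a; pose B := 1 - a * y.
have aE : a' = - (a * A * B) / c ^+ 2.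
  by rewrite /a' cE; congr (_ / _); rewrite gE /A /B; field; exact: a0.
have yE : y' = y * A ^+ 2 / (c * B).
  have -> : y' = - (y * (y * A ^+ 2 / a ^+ 2)) / (- (y * c * B) / a ^+ 2).
    by rewrite /y' /A /B /c; congr (- _ / _); rewrite gE; field; exact: a0.
  by field; rewrite a0 c0 y0 B0.
rewrite aE yE gE /A /B /c.
by field; rewrite a0 B0 /= andbT.
Qed.

Variables al ga : C.
Hypothesis ga0 : ga != 0.
Hypothesis disc : al ^+ 3 != 27 * ga.

(** The image [x (y - w)^2 / ((w - x) (x - y))] in terms of [x] alone, by [y + w = - (x + al)] and
    [y w = - ga / x]. Coefficients are listed from the constant term upwards. *)
Definition lnum : {poly C} := Poly [:: 0; - (4 * ga); - al ^+ 2; - (2 * al); - 1].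
Definition lden : {poly C} := Poly [:: - ga; 0; al; 2].

Lemma lnumE x : lnum.[x] = - (x * ((x + al) ^+ 2 * x + 4 * ga)).
Proof. by rewrite horner_Poly /=; ring. Qed.

Lemma ldenE x : lden.[x] = 2 * x ^+ 3 + al * x ^+ 2 - ga.
Proof. by rewrite horner_Poly /=; ring. Qed.

Lemma lden_neq0 : lden != 0.
Proof.
apply/eqP => /(congr1 (fun h : {poly C} => h.[0])); rewrite ldenE horner0 => /eqP.
by rewrite expr0n expr0n /= !mulr0 !add0r oppr_eq0 (negbTE ga0).
Qed.

(** A common root [x] would satisfy [al = - 3 x] and [ga = - x^3], hence [al^3 = 27 ga]. *)
Lemma lcoprime : coprimep lnum lden.
Proof.
apply: contraT => /closed_rootP [x]; rewrite root_gcd /root lnumE ldenE => /andP[/eqP n0 /eqP d0].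
have gE : ga = 2 * x ^+ 3 + al * x ^+ 2 by apply/esym/eqP; rewrite -subr_eq0 d0.
have x0 : x != 0 by apply: contraNneq ga0 => x0; rewrite gE x0 !expr0n /= !mulr0 addr0.
have : x * (x * (3 * x + al) ^+ 2) = 0.
  by apply/eqP; rewrite -oppr_eq0 -n0 gE; apply/eqP; ring.
move/eqP; rewrite !mulf_eq0 (negbTE x0) /= orbb => /eqP e; move/negP: disc; case.
have alE : al = - (3 * x).
  by apply/eqP; rewrite -subr_eq0 opprK addrC e.
by rewrite gE alE; apply/eqP; ring.
Qed.

Definition lattes := RatFun lden_neq0 lcoprime.

Lemma lattes_deg : ratdeg lattes = 4%N.
Proof.
by rewrite /ratdeg /= !(PolyK (c := 0)) //= ?pnatr_eq0 // oppr_eq0 oner_eq0.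
Qed.

Definition discr a := (1 + al * a) ^+ 2 + 4 * ga * a ^+ 3.
(** The map [lattes] in the coordinate [a = 1 / x] at its fixed point infinity, where the multiplier
    is -2. *)
Definition ell a := - (a * (2 + al * a - ga * a ^+ 3)) / discr a.

Lemma lattes_inf a : discr a != 0 -> ratmap lattes (pt 1 a) = pt 1 (ell a).
Proof.
move=> D0; have nz (b : C) : (1 != 0 :> C) || (b != 0) by rewrite oner_eq0.
rewrite (ratmap_pt _ (nz a)) lattes_deg; apply/pt_eq => //.
  by have := hev_neq0 lattes (nz a); rewrite lattes_deg.
rewrite /hev !big_ord_recr !big_ord0 !coef_Poly /= /ell.
by move: D0; rewrite /discr => D0; field.
Qed.

Lemma lattes_fin y : ratmap lattes (pt y 1) = pt lnum.[y] lden.[y].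
Proof.
rewrite ratmap_pt ?oner_eq0 ?orbT // !hev1 //; [exact: (size_den lattes)|exact: (size_num lattes)].
Qed.

Lemma diffc_discr a : diffc discr a.
Proof.
apply: diffcD; first by apply: (diffcX 2); apply: diffcD; [exact: diffc_cst|apply: diffcM; [exact: diffc_cst|exact: diffc_id]].
by apply: diffcM; [exact: diffc_cst|apply: diffcX; exact: diffc_id].
Qed.

Lemma discr0 : discr 0 = 1.
Proof. by rewrite /discr mulr0 addr0 expr1n expr0n /= mulr0 addr0. Qed.

Lemma discr_near : nearc 0 (fun a => discr a != 0).
Proof. by apply: nearc_neq0; [exact/diffc_cont/diffc_discr|rewrite discr0 oner_eq0]. Qed.

Lemma ell_koenigs : [/\ nearc 0 (diffc ell), ell 0 = 0 & Dc ell 0 = - 2].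
Proof.
pose k a := - (2 + al * a - ga * a ^+ 3) / discr a.
have dk a : discr a != 0 -> diffc k a.
  move=> D0; apply: diffcM; last by apply: (diffcV D0); exact: diffc_discr.
  apply: diffcN; apply: diffcB.
    by apply: diffcD; [exact: diffc_cst|apply: diffcM; [exact: diffc_cst|exact: diffc_id]].
  by apply: diffcM; [exact: diffc_cst|apply: diffcX; exact: diffc_id].
have E a : a * k a = ell a by rewrite /k /ell; ring.
split.
- apply: nearcW discr_near => a /dk d.
  by apply: diffc_ext (diffcM (diffc_id a) d); apply: nearc_all.
- by rewrite -E mul0r.
have d0 : diffc k 0 by apply: dk; rewrite discr0 oner_eq0.
have := cderiv_ext (nearc_all 0 E) (cderivM (cderiv_id 0) (DcP d0)).
by move=> /DcE ->; rewrite mul0r addr0 mul1r /k discr0 expr0n /= !mulr0 subr0 addr0 divr1.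
Qed.

End Lattes.

(** * Parametrization of the fibre curve *)

Section EllipticParametrization.
Variable R : realType.
Local Notation C := R[i].
Implicit Types (a z w x : C).
Variables al ga : C.
Hypothesis ga0 : ga != 0.
Hypothesis disc : al ^+ 3 != 27 * ga.
Local Notation L := (lattes ga0 disc).

Lemma nearc_dbl (Q : C -> Prop) : nearc 0 Q -> nearc 0 (fun w => Q (- 2 * w)).
Proof.
move=> H; apply: (nearc_comp (u := fun w => - 2 * w)); last by rewrite mulr0.
by apply: contM; [exact: cont_cst|exact: cont_id].
Qed.

Lemma local_param : exists phi y : C -> C, phi 0 = 0 /\ nearc 0 (fun w =>
  [/\ diffc phi w, diffc y w, w != 0 -> phi w != 0,
      y w * (1 + phi w * y w + al * phi w) = ga * phi w ^+ 2 &
      pt 1 (phi (- 2 * w)) = ratmap L (pt 1 (phi w)) /\ pt (y (- 2 * w)) 1 = ratmap L (pt (y w) 1)]).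
Proof.
have [d1 e0 e1] := ell_koenigs al ga; have [phi [r r0 H]] := koenigs d1 e0 e1.
have phi0 : phi 0 = 0.
  have [|_ h _] := H 0; first by rewrite abs0.
  by apply/eqP; rewrite -abs_eq0 eq_le abs_ge0 andbT; rewrite subr0 abs0 mul0r in h.
have dphi : nearc 0 (diffc phi) by exists r => // w; rewrite subr0 => /H [].
have cphi := diffc_cont (nearc_id dphi).
pose D w := discr al ga (phi w).
have dD : nearc 0 (diffc D) by apply: nearcW dphi => w dw; apply: diffc_comp => //; exact: diffc_discr.
have D0 : D 0 = 1 by rewrite /D phi0 discr0.
have ds : nearc 0 (diffc (fun w => sqrtc (D w))).
  have N : nearc 0 (fun w => diffc (@sqrtc R) (D w)).
    by apply: (nearc_comp (diffc_cont (nearc_id dD))); rewrite D0; exact: diffc_sqrtc.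
  by apply: nearcW (nearc_and dD N) => w [h1 h2]; exact: diffc_comp h1 h2.
pose e w := sqrtc (D w) + (1 + al * phi w).
have de : nearc 0 (diffc e).
  apply: nearcW (nearc_and ds dphi) => w [h1 h2]; apply: diffcD h1 _.
  by apply: diffcD; [exact: diffc_cst|apply: diffcM h2; exact: diffc_cst].
have en : nearc 0 (fun w => e w != 0).
  apply: nearc_neq0 (diffc_cont (nearc_id de)) _.
  by rewrite /e D0 phi0 sqrtc1 mulr0 addr0 -mulr2n pnatr_eq0.
(* The root of the quadratic equation that vanishes with [phi], with rationalized numerator so that
   no division by [phi] occurs. The discriminant is 1 at 0, and there the principal square root is
   holomorphic. *)
pose y w := 2 * ga * phi w ^+ 2 * (e w)^-1.
have dy : nearc 0 (diffc y).
  apply: nearcW (nearc_and (nearc_and de en) dphi) => w [[h1 h2] h3].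
  by apply: diffcM (diffcV h2 h1); apply: diffcM; [exact: diffc_cst|exact: diffcX].
have cy := diffc_cont (nearc_id dy).
have y0 : y 0 = 0 by rewrite /y phi0 expr0n /= mulr0 mul0r.
have rel : nearc 0 (fun w => y w * (1 + phi w * y w + al * phi w) = ga * phi w ^+ 2).
  apply: nearcW en => w ew.
  have es : (e w - (1 + al * phi w)) ^+ 2 = (1 + al * phi w) ^+ 2 + 4 * ga * phi w ^+ 3.
    by rewrite /e addrK sqr_sqrtc.
  apply/eqP; rewrite -subr_eq0; apply/eqP.
  transitivity (ga * phi w ^+ 2 / e w ^+ 2 * ((1 + al * phi w) ^+ 2 + 4 * ga * phi w ^+ 3 - (e w - (1 + al * phi w)) ^+ 2)).
    by rewrite /y; move: (e w) ew (phi w) => u u0 v; field; exact: u0.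
  by rewrite es subrr mulr0.
pose q w := 2 * y w ^+ 3 + al * y w ^+ 2 - ga.
have cX (f : C -> C) k : cont_at f 0 -> cont_at (fun w => f w ^+ k) 0.
  move=> cf; elim: k => [|k IH]; first exact: cont_cst.
  by apply: cont_ext (contM cf IH); apply: nearc_all => w; rewrite exprS.
have cZ (c : C) (f : C -> C) : cont_at f 0 -> cont_at (fun w => c * f w) 0.
  by apply: contM; exact: cont_cst.
have cq : cont_at q 0.
  by apply: contD; [apply: contD; apply: cZ; exact: cX|exact: cont_cst].
have q0 : q 0 != 0 by rewrite /q y0 !expr0n /= !mulr0 !add0r oppr_eq0.
pose y2 w := - (y w * ((y w + al) ^+ 2 * y w + 4 * ga)) * (q w)^-1.
have cy2 : cont_at y2 0.
  apply: contM; last exact: contV.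
  apply: contN; apply: contM => //; apply: contD; last exact: cont_cst.
  by apply: contM => //; apply: cX; apply: contD => //; exact: cont_cst.
have y20 : y2 0 = 0 by rewrite /y2 y0 mul0r oppr0 mul0r.
have dbl (f : C -> C) : cont_at f 0 -> cont_at (fun w => f (- 2 * w)) 0.
  move=> cf; apply: (cont_comp (f := fun w => - 2 * w)); first by apply: cZ; exact: cont_id.
  by rewrite mulr0.
have En : nearc 0 (fun w => 1 + al * phi (- 2 * w) + phi (- 2 * w) * (y (- 2 * w) + y2 w) != 0).
  apply: nearc_neq0; last by rewrite !mulr0 phi0 mulr0 mul0r !addr0 oner_eq0.
  apply: contD; first by apply: contD; [exact: cont_cst|apply: cZ; exact: dbl].
  by apply: contM; [exact: dbl|apply: contD => //; exact: dbl].
have Bn : nearc 0 (fun w => 1 - phi w * y w != 0).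
  apply: nearc_neq0; last by rewrite phi0 mul0r subr0 oner_eq0.
  by apply: contD; [exact: cont_cst|apply: contN; exact: contM].
have qn := nearc_neq0 cq q0.
have Dn : nearc 0 (fun w => D w != 0).
  by apply: nearc_neq0; [exact: diffc_cont (nearc_id dD)|rewrite D0 oner_eq0].
have rn : nearc 0 (fun w => abs w < r) by exists r => // w; rewrite subr0.
exists phi, y; split=> //.
have N1 := nearc_and (nearc_and dphi dy) (nearc_and rel (nearc_and Bn (nearc_and qn Dn))).
have N2 := nearc_and (nearc_and rn (nearc_dbl rn)) (nearc_and En (nearc_dbl rel)).
apply: nearcW (nearc_and N1 N2) => w [[[h1 h2] [h3 [h4 [h5 h6]]]] [[h7 h8] [h9 h10]]].
have [_ hphi /(_ h8) hell] := H w h7; split=> //.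
  move=> w0; apply: contraTneq hphi => ->; rewrite sub0r absN -ltNge.
  by move: w0; rewrite -abs_gt0 => a0; rewrite ltr_pdivrMr // ltr_pMr // ltr1n.
split; first by rewrite hell lattes_inf.
suff -> : y (- 2 * w) = y2 w.
  rewrite lattes_fin lnumE ldenE; apply/pt_eq; rewrite ?oner_eq0 ?orbT //.
    by rewrite [X in _ || X]h5 orbT.
  by rewrite mul1r /y2 mulfVK.
have rel2 : y2 w * (1 + phi (- 2 * w) * y2 w + al * phi (- 2 * w)) = ga * phi (- 2 * w) ^+ 2.
  have [p0|p0] := eqVneq (phi w) 0.
    have yw : y w = 0 by rewrite /y p0 expr0n /= mulr0 mul0r.
    by rewrite /y2 yw hell p0 /ell !mul0r oppr0 !mul0r expr0n /= mulr0.
  have yw : y w != 0.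
    apply/eqP => yw; move/esym/eqP: h3; rewrite yw mul0r mulf_eq0 (negbTE ga0) /=.
    by rewrite expf_eq0 (negbTE p0).
  by rewrite hell; exact: (fibre_duplication p0 h4 yw h6 h5 h3).
apply/eqP; rewrite -subr_eq0; apply/eqP/(mulIf h9); rewrite mul0r.
transitivity (y (- 2 * w) * (1 + phi (- 2 * w) * y (- 2 * w) + al * phi (- 2 * w)) -
  y2 w * (1 + phi (- 2 * w) * y2 w + al * phi (- 2 * w))); first by ring.
by rewrite h10 rel2 subrr.
Qed.

Lemma elliptic_param : exists f g : C -> CP1 R, [/\ liftable f, liftable g, nonconstant f & nonconstant g] /\
  f 0 <> g 0 /\ nearc 0 (fun w => exists a y : C, [/\ f w = pt 1 a, g w = pt y 1 & y * (1 + a * y + al * a) = ga * a ^+ 2]).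
Proof.
have [phi [y [phi0 [r r0 H]]]] := local_param.
have H' w (wr : abs w < r) := H w (eq_ind_r (fun u => is_true (abs u < r)) wr (subr0 w)).
have near_r z : abs z < r -> nearc z (fun w => abs w < r).
  move=> zr; have := @nearc_ball _ 0 z r; rewrite subr0 => /(_ zr).
  by apply: nearcW => w; rewrite subr0.
have one0 : 1 != 0 :> C by rewrite oner_eq0.
have half w : abs (- 2 * w) < r -> abs w < r.
  by rewrite absM absN absn; apply: le_lt_trans; rewrite ler_peMl ?abs_ge0 // ler1n.
have [||f lf fE] := @extension _ L (fun w => pt 1 (phi w)) r r0.
- move=> z zr; exists (fun=> 1), phi; apply: nearcW (near_r z zr) => w /H' [d1 _ _ _ _].
  by split; rewrite ?one0 //; exact: diffc_cst.
- by move=> z /half /H' [_ _ _ _ []].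
have [||g lg gE] := @extension _ L (fun w => pt (y w) 1) r r0.
- move=> z zr; exists y, (fun=> 1); apply: nearcW (near_r z zr) => w /H' [_ d1 _ _ _].
  by split; rewrite ?one0 ?orbT //; exact: diffc_cst.
- by move=> z /half /H' [_ _ _ _ []].
have z0 : abs (0 : C) < r by rewrite abs0.
have f0 : f 0 = None by rewrite fE // /pt phi0 eqxx.
have yS w : pt (y w) 1 = Some (y w) by rewrite /pt (negbTE one0) divr1.
have [_ _ _ rel0 _] := H' 0 z0.
have y0 : y 0 = 0 by move: rel0; rewrite phi0 !mul0r !mulr0 !addr0 mulr1 expr0n /= mulr0.
have g0 : g 0 = Some 0 by rewrite gE // yS y0.
have [w w0 wr] := near_other (near_r 0 z0).
have [_ _ /(_ w0) pw relw _] := H' w wr.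
exists f, g; split; last split.
- split=> //; first by exists 0, w; rewrite f0 fE // /pt (negbTE pw).
  exists 0, w; rewrite g0 gE // yS => -[] yw; move: relw; rewrite -yw mul0r => /esym/eqP.
  by rewrite mulf_eq0 (negbTE ga0) expf_eq0 (negbTE pw).
- by rewrite f0 g0.
exists r => // v; rewrite subr0 => vr; exists (phi v), (y v).
by rewrite fE // gE //; split=> //; have [] := H' v vr.
Qed.

End EllipticParametrization.

(** * Normal form of cubic maps *)

Section CubicForms.
Variable R : realType.
Local Notation C := R[i].
Implicit Types (k : nat -> C) (x y a b s t : C).

Definition cubic k x y := k 3%N * x ^+ 3 + k 2%N * (x ^+ 2 * y) + k 1%N * (x * y ^+ 2) + k 0%N * y ^+ 3.
Definition cubicx k x y := 3 * k 3%N * x ^+ 2 + 2 * k 2%N * (x * y) + k 1%N * y ^+ 2.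
Definition cubicy k x y := k 2%N * x ^+ 2 + 2 * k 1%N * (x * y) + 3 * k 0%N * y ^+ 2.

Lemma cubic_expand k x y a b s t : cubic k (s * x + t * a) (s * y + t * b) =
  cubic k x y * s ^+ 3 + (a * cubicx k x y + b * cubicy k x y) * (s ^+ 2 * t) +
  (x * cubicx k a b + y * cubicy k a b) * (s * t ^+ 2) + cubic k a b * t ^+ 3.
Proof. by rewrite /cubic /cubicx /cubicy; ring. Qed.

Lemma hev3E (p : {poly C}) x y : hev p 3 x y = cubic (fun i => p`_i) x y.
Proof. by rewrite /hev !big_ord_recr big_ord0 /cubic /=; ring. Qed.

Lemma poly_ext (p q : {poly C}) : (forall x, p.[x] = q.[x]) -> p = q.
Proof.
move=> H; apply/eqP; rewrite -subr_eq0; apply: contraT => n0.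
pose rs := [seq (i%:R : C) | i <- iota 0 (size (p - q))].
have ur : uniq rs by rewrite map_inj_uniq ?iota_uniq // => i j /eqP; rewrite eqr_nat => /eqP.
have ar : all (root (p - q)) rs by apply/allP => x _; rewrite /root hornerD hornerN H subrr.
by have := max_poly_roots n0 ar ur; rewrite size_map size_iota ltnn.
Qed.

Variable P : ratfun R.
Hypothesis simpleP : forall s : CP1 R, critical_value P s -> simple_critical_value P s.
Hypothesis n3 : ratdeg P = 3%N.
Local Notation pc := (fun i => (ratnum P)`_i).
Local Notation qc := (fun i => (ratden P)`_i).
Local Notation p := (cubic pc).
Local Notation q := (cubic qc).

Lemma cubic_neq0 x y : (x != 0) || (y != 0) -> (p x y != 0) || (q x y != 0).
Proof. by move=> /(hev_neq0 P); rewrite n3 !hev3E. Qed.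

(** A cube in the pencil would be a triple point of a fibre, finite if [l1] is nonzero and at
    infinity otherwise. *)
Lemma no_cube c d kap l1 l2 : (c != 0) || (d != 0) ->
  ~ forall x y, c * p x y + d * q x y = kap * (l1 * x + l2 * y) ^+ 3.
Proof.
move=> cd H; have n0 : (0 < ratdeg P)%N by rewrite n3.
have NE x : (pencil P (- d) c).[x] = kap * (l1 * x + l2) ^+ 3.
  have := H x 1; rewrite mulr1 => <-; rewrite /pencil hornerD hornerN !hornerZ mulNr opprK.
  by rewrite -!hev3E !hev1 // -n3; [exact: size_den|exact: size_num].
have dc : (- d != 0) || (c != 0) by rewrite oppr_eq0 orbC.
have [l0|l0] := eqVneq l1 0.
  apply: (no_triple simpleP n0 (x := None) dc); rewrite /mult_ge n3.
  have -> : pencil P (- d) c = (kap * l2 ^+ 3)%:P.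
    by apply: poly_ext => x; rewrite NE hornerC l0 mul0r add0r.
  by rewrite size_polyC; case: eqP.
apply: (no_triple simpleP n0 (x := Some (- l2 / l1)) dc); rewrite /mult_ge.
have -> : pencil P (- d) c = (kap * l1 ^+ 3) *: ('X - (- l2 / l1)%:P) ^+ 3.
  by apply: poly_ext => x; rewrite NE hornerZ horner_exp hornerXsubC; field.
by rewrite -mul_polyC dvdp_mulIr.
Qed.

Lemma no_cube_basis c d kap l1 l2 x y a b : x * b - y * a != 0 -> (c != 0) || (d != 0) ->
  ~ forall s t, c * p (s * x + t * a) (s * y + t * b) + d * q (s * x + t * a) (s * y + t * b) = kap * (l1 * s + l2 * t) ^+ 3.
Proof.
move=> D0 cd H; set D := x * b - y * a in D0.
apply: (@no_cube c d kap ((l1 * b - l2 * y) / D) ((l2 * x - l1 * a) / D) cd) => X Y.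
have := H ((X * b - Y * a) / D) ((Y * x - X * y) / D).
have -> : (X * b - Y * a) / D * x + (Y * x - X * y) / D * a = X by rewrite /D; field.
have -> : (X * b - Y * a) / D * y + (Y * x - X * y) / D * b = Y by rewrite /D; field.
by move=> ->; congr (_ * _ ^+ 3); field.
Qed.

(** The coefficients of a third of the Jacobian, a quartic form. *)
Let w4 := pc 3 * qc 2 - pc 2 * qc 3.
Let w3 := 2 * (pc 3 * qc 1 - pc 1 * qc 3).
Let w2 := 3 * (pc 3 * qc 0 - pc 0 * qc 3) + (pc 2 * qc 1 - pc 1 * qc 2).
Let w1 := 2 * (pc 2 * qc 0 - pc 0 * qc 2).
Let w0 := pc 1 * qc 0 - pc 0 * qc 1.

(** At any point the partial derivatives of [v p - u q] are the multiples by [y] and [- x] of this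
    quartic, so a zero of it is what is sought; if the coefficient of [x^4] vanishes, infinity is
    one. *)
Lemma critical_point : exists x y, ((x != 0) || (y != 0)) /\ forall u v, u = p x y -> v = q x y ->
  v * cubicx pc x y - u * cubicx qc x y = 0 /\ v * cubicy pc x y - u * cubicy qc x y = 0.
Proof.
suff [x [y [xy J]]] : exists x y, ((x != 0) || (y != 0)) /\
    w4 * x ^+ 4 + w3 * (x ^+ 3 * y) + w2 * (x ^+ 2 * y ^+ 2) + w1 * (x * y ^+ 3) + w0 * y ^+ 4 = 0.
  move: J; set j := (X in X = 0) => J; exists x, y; split=> // _ _ -> ->; split.
    transitivity (y * j); last by rewrite J mulr0.
    by rewrite /j /cubic /cubicx /w4 /w3 /w2 /w1 /w0; ring.
  transitivity (- x * j); last by rewrite J mulr0.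
  by rewrite /j /cubic /cubicy /w4 /w3 /w2 /w1 /w0; ring.
have [w40|w40] := eqVneq w4 0.
  by exists 1, 0; rewrite oner_eq0 w40; split=> //; ring.
have : size (Poly [:: w0; w1; w2; w3; w4]) != 1%N by rewrite (PolyK (c := 0)).
move=> /closed_rootP [x]; rewrite /root horner_Poly /= => /eqP E.
by exists x, 1; rewrite oner_eq0 orbT; split=> //; rewrite -[RHS]E; ring.
Qed.

Lemma cubicD c d k l x y : c * cubic k x y + d * cubic l x y = cubic (fun i => c * k i + d * l i) x y.
Proof. by rewrite /cubic; ring. Qed.

(** In a basis starting with a critical point, the form of its fibre is [k2 s t^2 + k3 t^3], with
    [k2] nonzero because no cube occurs. If [ga] were 0, both forms would vanish at [s = 0]. If
    [al^3 = 27 ga], the second form plus [al^2 / 3] times the first would be [(s + al t / 3)^3]. *)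
Lemma normal_form : exists x y a b c1 c2 d1 d2 al ga : C,
  [/\ x * b - y * a != 0, c1 * d2 - c2 * d1 != 0, ga != 0, al ^+ 3 != 27 * ga & forall s t,
    c1 * p (s * x + t * a) (s * y + t * b) + c2 * q (s * x + t * a) (s * y + t * b) = s * t ^+ 2 /\
    d1 * p (s * x + t * a) (s * y + t * b) + d2 * q (s * x + t * a) (s * y + t * b) =
      s ^+ 3 + al * (s ^+ 2 * t) + ga * t ^+ 3].
Proof.
have [x [y [xy /(_ _ _ erefl erefl) []]]] := critical_point.
set u := p x y; set v := q x y => Kx Ky.
have uv : (u != 0) || (v != 0) := cubic_neq0 xy.
have [a [b D0]] : exists a b, x * b - y * a != 0.
  have [y0|y0] := eqVneq y 0; last by exists 1, 0; rewrite mulr0 mulr1 sub0r oppr_eq0.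
  by exists 0, 1; rewrite mulr0 mulr1 subr0; move: xy; rewrite y0 eqxx orbF.
have vu : (v != 0) || (- u != 0) by rewrite oppr_eq0 orbC.
pose K i := v * pc i + - u * qc i.
have KE s t : v * p (s * x + t * a) (s * y + t * b) + - u * q (s * x + t * a) (s * y + t * b) =
    (x * cubicx K a b + y * cubicy K a b) * (s * t ^+ 2) + cubic K a b * t ^+ 3.
  rewrite cubicD -/K cubic_expand.
  have -> : cubic K x y = 0 by rewrite -cubicD -/u -/v; ring.
  have -> : cubicx K x y = 0 by rewrite -[RHS]Kx /K /cubicx; ring.
  have -> : cubicy K x y = 0 by rewrite -[RHS]Ky /K /cubicy; ring.
  by rewrite !mulr0 addr0 !mul0r !add0r.
move: KE; set k2 := _ + _; set k3 := cubic K a b => KE.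
have k20 : k2 != 0.
  apply/eqP => k20; apply: (@no_cube_basis v (- u) k3 0 1 x y a b D0 vu) => s t.
  by rewrite KE k20 !mul0r !add0r mul1r.
(* The substitution of [(s - k3 t) / k2] for [s] turns [k2 s t^2 + k3 t^3] into [s t^2]. *)
pose x' := x / k2; pose y' := y / k2; pose a' := a - k3 / k2 * x; pose b' := b - k3 / k2 * y.
have D0' : x' * b' - y' * a' != 0.
  rewrite (_ : _ - _ = (x * b - y * a) / k2); first by rewrite mulf_neq0 ?invr_eq0.
  by rewrite /x' /y' /a' /b'; field.
have {}KE s t : v * p (s * x' + t * a') (s * y' + t * b') + - u * q (s * x' + t * a') (s * y' + t * b') = s * t ^+ 2.
  have -> : s * x' + t * a' = ((s - k3 * t) / k2) * x + t * a by rewrite /x' /a'; field.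
  have -> : s * y' + t * b' = ((s - k3 * t) / k2) * y + t * b by rewrite /y' /b'; field.
  by rewrite KE; field.
have [m [n mn]] : exists m n, m * u + n * v != 0.
  by case/orP: uv => h; [exists 1, 0|exists 0, 1]; rewrite !mul0r mul1r ?addr0 ?add0r.
pose H i := m * pc i + n * qc i.
pose h0 := cubic H x' y'; pose h1 := a' * cubicx H x' y' + b' * cubicy H x' y'.
pose h2 := x' * cubicx H a' b' + y' * cubicy H a' b'; pose h3 := cubic H a' b'.
have HE s t : m * p (s * x' + t * a') (s * y' + t * b') + n * q (s * x' + t * a') (s * y' + t * b') =
    h0 * s ^+ 3 + h1 * (s ^+ 2 * t) + h2 * (s * t ^+ 2) + h3 * t ^+ 3.
  by rewrite cubicD cubic_expand.
have h0E : h0 = (m * u + n * v) / k2 ^+ 3.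
  by rewrite /h0 -cubicD /u /v /x' /y' /cubic; field.
have h00 : h0 != 0 by rewrite h0E mulf_neq0 // invr_eq0 expf_neq0.
(* The coefficient of [s^3] becomes 1, and that of [s t^2] is removed with the help of the first
   form. *)
pose d1 := m / h0 - h2 / h0 * v; pose d2 := n / h0 + h2 / h0 * u.
have dE s t : d1 * p (s * x' + t * a') (s * y' + t * b') + d2 * q (s * x' + t * a') (s * y' + t * b') =
    s ^+ 3 + h1 / h0 * (s ^+ 2 * t) + h3 / h0 * t ^+ 3.
  move: (KE s t) (HE s t); rewrite /d1 /d2; move: (p _ _) (q _ _) => X Y E1 E2.
  transitivity ((m * X + n * Y) / h0 - h2 / h0 * (v * X + - u * Y)); first by field.
  by rewrite E1 E2; field.
have cd : v * d2 - - u * d1 != 0.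
  rewrite (_ : _ - _ = (m * u + n * v) / h0); first by rewrite mulf_neq0 ?invr_eq0.
  by rewrite /d1 /d2; field.
exists x', y', a', b', v, (- u), d1, d2, (h1 / h0), (h3 / h0); split=> //.
- apply/eqP => g0; have := @cubic_neq0 a' b'; move: (KE 0 1) (dE 0 1).
  rewrite g0 !expr0n /= !(mul0r, mul1r, add0r, mulr0, addr0).
  move: (p a' b') (q a' b') => X Y E1 E2 nz.
  have X0 : X = 0.
    apply: (mulfI cd); rewrite mulr0.
    transitivity (d2 * (v * X + - u * Y) - - u * (d1 * X + d2 * Y)); first by ring.
    by rewrite E1 E2 !mulr0 subr0.
  have Y0 : Y = 0.
    apply: (mulfI cd); rewrite mulr0.
    transitivity (v * (d1 * X + d2 * Y) - d1 * (v * X + - u * Y)); first by ring.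
    by rewrite E1 E2 !mulr0 subr0.
  have ab : (a' != 0) || (b' != 0).
    by apply: contraNT D0'; rewrite negb_or !negbK => /andP[/eqP -> /eqP ->]; rewrite !mulr0 subr0.
  by move: (nz ab); rewrite X0 Y0 eqxx.
- move: (h1 / h0) (h3 / h0) dE => al ga dE; apply/eqP => E.
  have nz : (d1 + al ^+ 2 / 3 * v != 0) || (d2 + al ^+ 2 / 3 * - u != 0).
    apply: contraNT cd; rewrite negb_or !negbK => /andP[/eqP e1 /eqP e2].
    apply/eqP; transitivity (v * (d2 + al ^+ 2 / 3 * - u) - - u * (d1 + al ^+ 2 / 3 * v)); first by ring.
    by rewrite e1 e2 !mulr0 subr0.
  apply: (@no_cube_basis _ _ 1 1 (al / 3) x' y' a' b' D0' nz) => s t.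
  have gE : ga = al ^+ 3 / 27 by rewrite E mulrC mulKf // pnatr_eq0.
  move: (KE s t) (dE s t); move: (p _ _) (q _ _) => X Y E1 E2.
  transitivity ((d1 * X + d2 * Y) + al ^+ 2 / 3 * (v * X + - u * Y)); first by ring.
  by rewrite E1 E2 gE; field.
Qed.

End CubicForms.

(** * Projectivities of the line *)

Section Projectivity.
Variable R : realType.
Local Notation C := R[i].
Variables x y a b : C.
Hypothesis D0 : x * b - y * a != 0.
Implicit Types (s t z w : C) (f : C -> CP1 R).

Definition proj (v : CP1 R) : CP1 R :=
  pt ((coords v).1 * x + (coords v).2 * a) ((coords v).1 * y + (coords v).2 * b).

Lemma proj_neq0 s t : (s != 0) || (t != 0) -> (s * x + t * a != 0) || (s * y + t * b != 0).
Proof.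
apply: contraTT; rewrite !negb_or !negbK => /andP[/eqP e1 /eqP e2].
have s0 : s * (x * b - y * a) = 0.
  by transitivity (b * (s * x + t * a) - a * (s * y + t * b)); [ring|rewrite e1 e2 !mulr0 subr0].
have t0 : t * (x * b - y * a) = 0.
  by transitivity (x * (s * y + t * b) - y * (s * x + t * a)); [ring|rewrite e1 e2 !mulr0 subr0].
by apply/andP; split; [move/eqP: s0|move/eqP: t0]; rewrite mulf_eq0 (negbTE D0) orbF.
Qed.

Lemma proj_pt s t : (s != 0) || (t != 0) -> proj (pt s t) = pt (s * x + t * a) (s * y + t * b).
Proof.
move=> st; have [nc E] := coordsP (pt s t).
have H : s * (coords (pt s t)).2 = t * (coords (pt s t)).1 by apply/pt_eq.
apply/pt_eq; [exact: proj_neq0|exact: proj_neq0|].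
move: H; move: (coords _).1 (coords _).2 => u v H.
apply/eqP; rewrite -subr_eq0; apply/eqP.
by transitivity ((x * b - y * a) * (t * u - s * v)); [ring|rewrite H subrr mulr0].
Qed.

Lemma proj_inj : injective proj.
Proof.
move=> u v; have [nu ->] := coordsP u; have [nv ->] := coordsP v.
move: (coords u).1 (coords u).2 (coords v).1 (coords v).2 nu nv => s t s' t' n1 n2.
rewrite !proj_pt // => /pt_eq E; apply/pt_eq => //; apply: (mulIf D0).
have {}E := E (proj_neq0 n1) (proj_neq0 n2).
apply/eqP; rewrite -subr_eq0; apply/eqP; move/eqP: E; rewrite -subr_eq0 => /eqP <-; ring.
Qed.

Lemma liftable_proj f : liftable f -> liftable (fun z => proj (f z)).
Proof.
move=> lf z; have [c [d L]] := lf z.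
exists (fun w => c w * x + d w * a), (fun w => c w * y + d w * b).
apply: nearcW L => w [dc dd cd ->]; split; [| |exact: proj_neq0|exact: proj_pt];
  by apply: diffcD; apply: diffcM => //; exact: diffc_cst.
Qed.

Lemma nonconstant_proj f : nonconstant f -> nonconstant (fun z => proj (f z)).
Proof. by move=> [z [w nfzw]]; exists z, w => /proj_inj. Qed.

End Projectivity.

Section Degree3.
Variable R : realType.
Local Notation C := R[i].
Variable P : ratfun R.
Hypothesis simpleP : forall s : CP1 R, critical_value P s -> simple_critical_value P s.
Hypothesis n3 : ratdeg P = 3%N.

Lemma solvable3 : solvable_fibres P.
Proof.
have [x [y [a [b [c1 [c2 [d1 [d2 [al [ga [D0 cd ga0 disc NF]]]]]]]]]]] := normal_form simpleP n3.
have [f [g [[lf lg nf ng] [fg0 N]]]] := elliptic_param ga0 disc.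
exists (fun z => proj x y a b (f z)), (fun z => proj x y a b (g z)).
have lF := liftable_proj D0 lf; have lG := liftable_proj D0 lg.
split; first by split=> //; exact: nonconstant_proj.
split; first by exists 0 => /(proj_inj D0).
have lift_map h : liftable h -> liftable (fun z => ratmap P (h z)).
  by move=> lh z; have [c [d /(lift_ratmap P) L]] := lh z; do 2 eexists; exact: L.
have [//|] := liftable_eq (lift_map _ lF) (lift_map _ lG).
move=> /(_ 0) /nearc_and /(_ N) /near_other [w w0 [/(_ w0) ne [s [t [fw gw rel]]]]].
case: ne; rewrite fw gw.
have n1 : (1 != 0 :> C) || (s != 0) by rewrite oner_eq0.
have n2 : (t != 0) || (1 != 0 :> C) by rewrite oner_eq0 orbT.
rewrite !(proj_pt D0) //; apply/ratmap_eq; [exact: (proj_neq0 D0)|exact: (proj_neq0 D0)|].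
rewrite n3 !hev3E.
have [E1 E2] := NF 1 s; have [E3 E4] := NF t 1.
move: E1 E2 E3 E4; set u1 := 1 * x + s * a; set u2 := 1 * y + s * b; set v1 := t * x + 1 * a; set v2 := t * y + 1 * b.
move: (cubic (fun i => (ratnum P)`_i) u1 u2) (cubic (fun i => (ratden P)`_i) u1 u2) => X1 Y1.
move: (cubic (fun i => (ratnum P)`_i) v1 v2) (cubic (fun i => (ratden P)`_i) v1 v2) => X2 Y2 E1 E2 E3 E4.
apply: (mulfI cd); apply/eqP; rewrite -subr_eq0; apply/eqP.
transitivity ((c1 * X1 + c2 * Y1) * (d1 * X2 + d2 * Y2) - (d1 * X1 + d2 * Y1) * (c1 * X2 + c2 * Y2)); first by ring.
rewrite E1 E2 E3 E4.
(* The condition for a common fibre splits into the relation of the curve and the factor [1 - s t]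
   of the diagonal. *)
transitivity ((ga * s ^+ 2 - t * (1 + s * t + al * s)) * (1 - s * t)); first by ring.
by rewrite rel subrr mul0r.
Qed.

End Degree3.

(* A rational function of degree 1 is a bijection of CP^1 without critical
   values, so the equation has no solutions f <> g; hence n <> 1. *)
Theorem theorem1p3 (R : realType) (P : ratfun R) (n : nat)
    (degP : ratdeg P = n) (n_neq1 : n <> 1%N)
    (simpleP : forall s : CP1 R, critical_value P s -> simple_critical_value P s) :
  (exists f g : R[i] -> CP1 R,
      [/\ meromorphic f, meromorphic g, nonconstant f & nonconstant g] /\
      (exists z : R[i], f z <> g z) /\
      (forall z : R[i], ratmap P (f z) = ratmap P (g z)))
  <-> (n < 4)%N.
Proof.
split=> [[f [g [[mf mg nf ng] [fg_neq fg_fib]]]]|n_lt4].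
  rewrite ltnNge; apply/negP => n_ge4; rewrite -degP in n_ge4.
  have [F1 HF] := choice (mero_lift mf); have [F2 LF] := choice HF.
  have [G1 HG] := choice (mero_lift mg); have [G2 LG] := choice HG.
  exact: (no_solution simpleP n_ge4 LF LG nf ng fg_neq fg_fib).
suff [f [g [[lf lg nf ng] [ne E]]]] : solvable_fibres P.
  by exists f, g; split=> //; split=> //; exact: lift_mero.
case: n degP n_neq1 n_lt4 => [|[|[|[|n]]]] degP n_neq1 // _.
- exact: solvable0.
- exact: solvable2.
exact: solvable3.
Qed.
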